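(* Let $M\subset\mathbb{C}^{n+1}$, $n\ge 2$, be given in coordinates $(z,w)\in\mathbb{C}^n\times\mathbb{C}$, $z=(z_1,\ldots,z_n)$, by $$w=\bar z_1z_2+\bar z_1^2.$$ If $(F_1,F_2,\ldots,F_n,G)$ is a local automorphism of $M$ at the origin, then $F_1$ depends only on $z_1$, $F_2$ and $G$ depend only on $z_2$ and $w$, and $F_1$ completely determines $F_2$ and $G$ via \begin{align*} F_2(z_2,\bar z_1z_2+\bar z_1^2)&=-\bigl(\bar F_1(\bar z_1)+\bar F_1(-\bar z_1-z_2)\bigr),\\ G(z_2,\bar z_1z_2+\bar z_1^2)&=-\bar F_1(\bar z_1)\,\bar F_1(-\bar z_1-z_2). \end{align*} The mapping $(z_1,z_2,F_3,\ldots,F_n)$ has rank $n$ at the origin. Furthermore, given any invertible function $F_1$ of one variable with $F_1(0)=0$, and arbitrary holomorphic functions $F_3,\ldots,F_n$ with $F_j(0)=0$, and such that $(z_1,z_2,F_3,\ldots,F_n)$ has rank $n$ at the origin, there exist unique $F_2$ and $G$ that complete an automorphism $(F_1,\ldots,F_n,G)$.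
   Context: A local automorphism of $M$ at the origin is a germ at the origin of a biholomorphic map of $\mathbb{C}^{n+1}$ fixing the origin and taking $M$ to $M$; its components $F_1,\ldots,F_n,G$ are holomorphic functions of $(z,w)$ near the origin. For a holomorphic function $F_1$ of one variable, $\bar F_1$ denotes the holomorphic function whose power series coefficients are the complex conjugates of those of $F_1$, i.e. $\bar F_1(\bar\zeta)=\overline{F_1(\zeta)}$. In the formulas for $F_2$ and $G$, $\bar z_1$ and $z_2$ are treated as independent variables.
   Formalization: The rank of (z_1,z_2,F_3,...,F_n) at the origin is taken with respect to the variables z only (at w=0); with rank in all of (z,w) the existence claim fails, e.g. n=3, F_1=z_1, F_3=w. *)

(* Defs.v *)
From mathcomp Require Import all_boot all_order all_algebra.
From mathcomp Require Import complex.
From mathcomp Require Import boolp classical_sets reals topology normedtype.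
From mathcomp Require Import landau derive.

Set Implicit Arguments.
Unset Strict Implicit.
Unset Printing Implicit Defensive.
Import Order.TTheory GRing.Theory Num.Theory.
Import numFieldNormedType.Exports.
Local Open Scope classical_set_scope.
Local Open Scope ring_scope.

(* Naming R[i] as a numClosedFieldType lets its normed-module structure (the
   one attached to every numClosedFieldType) be inferred. *)
Definition Cplx (R : realType) : numClosedFieldType := complex R.

(* A germ at a point is represented by a total function; only its values near
   the point are relevant, and germs are compared with [\forall x \near _]. *)
Definition holomorphic_on (K : numFieldType) (V W : normedModType K)
    (f : V -> W) (U : set V) : Prop :=
  open U /\ forall x, U x -> differentiable f x.

Definition holomorphic_near (K : numFieldType) (V W : normedModType K)
    (f : V -> W) (x : V) : Prop :=
  exists2 U : set V, U x & holomorphic_on f U.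

Definition biholomorphic (K : numFieldType) (V : normedModType K)
    (f : V -> V) (U W : set V) : Prop :=
  holomorphic_on f U /\
  exists g : V -> V,
    [/\ holomorphic_on g W,
        forall x, U x -> W (f x) /\ g (f x) = x &
        forall y, W y -> U (g y) /\ f (g y) = y].

(* Invertible germ of a holomorphic map fixing the origin. *)
Definition invertible_germ (K : numFieldType) (V : normedModType K)
    (f : V -> V) : Prop :=
  f 0 = 0 /\ exists U W : set V, U 0 /\ biholomorphic f U W.

Definition local_automorphism (K : numFieldType) (V : normedModType K)
    (M : set V) (f : V -> V) : Prop :=
  f 0 = 0 /\
  exists U W : set V,
    [/\ U 0, biholomorphic f U W & f @` (M `&` U) = M `&` W].

Section Quadric.
Variables (R : realType) (n : nat) (hn : (1 < n)%N).
Local Notation C := (Cplx R).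

Definition idx1 : 'I_n := Ordinal (ltnW hn).
Definition idx2 : 'I_n := Ordinal hn.

(* A point of C^n x C is a pair p = (z, w). *)
Definition z1 (p : 'rV[C]_n * C) : C := p.1 0 idx1.
Definition z2 (p : 'rV[C]_n * C) : C := p.1 0 idx2.

Definition quadric : set ('rV[C]_n * C) :=
  [set p | p.2 = (z1 p)^* * z2 p + ((z1 p)^*) ^+ 2].

(* The map with components F_1 = f1(z_1), F_2, F_3, ..., F_n, G; the components
   F_3, ..., F_n are the [Fs j] with 2 <= j < n (indices start at 0), the other
   entries of [Fs] are not used. *)
Definition assemble (f1 : C -> C) (F2 : 'rV[C]_n * C -> C)
    (Fs : 'I_n -> 'rV[C]_n * C -> C) (G : 'rV[C]_n * C -> C)
    (p : 'rV[C]_n * C) : 'rV[C]_n * C :=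
  (\row_(j < n) (if j == idx1 then f1 (z1 p)
                 else if j == idx2 then F2 p else Fs j p),
   G p).

(* (z_1, z_2, F_3, ..., F_n) as a map of z. On M, which is parametrized by z,
   w vanishes to second order at the origin, so the derivative there of the
   restriction to M is that of the restriction to w = 0. *)
Definition z1z2Fs (Fs : 'I_n -> 'rV[C]_n * C -> C) (z : 'rV[C]_n) : 'rV[C]_n :=
  \row_(j < n) (if (j < 2)%N then z 0 j else Fs j (z, 0)).

Definition rank_at_origin (Fs : 'I_n -> 'rV[C]_n * C -> C) : nat :=
  \rank ('J (z1z2Fs Fs) 0).

End Quadric.

Definition cbar (R : realType) (f : Cplx R -> Cplx R) (x : Cplx R) : Cplx R :=
  (f x^*)^*.

(* Main.v *)
From HB Require Import structures.
Require Import Defs.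
From mathcomp Require Import all_boot all_order all_algebra.
From mathcomp Require Import complex.
From mathcomp Require Import ring lra.
From mathcomp Require Import boolp classical_sets functions interval_inference reals prodnormedzmodule topology normedtype.
From mathcomp Require Import landau derive.

(** Let [h] be [F_1] with conjugated coefficients, i.e. [cbar F_1]. A point
    [(z, w)] lies on the quadric iff the conjugate of [z_1] is a root of
    [t ^ 2 + t z_2 = w]; the other root is then [- conj z_1 - z_2]. The theorem
    says that an automorphism acts on this equation by sending the roots [t, t']
    to [h t, h t'], so that [F_2] and [G] are given by Vieta's formulas.

    Structure of automorphisms. For a fixed value of [z_1], the points of the
    quadric form a complex affine space with coordinates [z_2, ..., z_n]. On it
    [F] is holomorphic, and [G = conj F_1 * F_2 + conj F_1 ^ 2] says that
    [conj F_1] is a root of a monic quadratic polynomial with holomorphic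
    coefficients. Such an antiholomorphic root is constant ([conj_root_const]).
    Hence [F_1], restricted to the quadric, depends on [z_1] only. An identity
    that holds for all [z_1] and its conjugate persists when the conjugate is
    replaced by an independent variable [t] ([polarization]), and then [t] can be
    any root at any point near the origin. So [F_1] depends on [z_1] only
    everywhere ([F1_first]), and [G = h t * F_2 + (h t) ^ 2] for both roots; as
    [h] is locally injective, this gives the two formulas
    ([symmetric_formulas]). They show that [F_1], [F_2] and [G] have zero derivative
    in the directions [z_3, ..., z_n], which yields the rank condition from the
    invertibility of [F].

    Existence. Conversely [- (h t + h t')] and [- h t * h t'] are symmetric in the
    roots of [t ^ 2 + t z_2 = w], so they are functions of [(z_2, w)], holomorphic
    also where the roots coincide ([rootsum_diff]). With these as [F_2] and [G],
    [h a ^ 2 + h a * F_2 - G = (h a - h t) (h a - h t')] for [a = conj z_1], so that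
    the map preserves the quadric in both directions ([quadric_equiv]). Its
    derivative at the origin is triangular, and invertible because of the rank
    hypothesis; the inverse function theorem concludes ([inverse_function]).

    The complex analysis is derived from complex differentiability by Goursat's
    subdivision argument, with finite midpoint sums along the sides of squares in
    place of contour integrals. This gives Cauchy's estimate for the derivative
    ([cauchy_ball]), from which follow the mean value inequality, second-order
    Taylor expansions, a form of the identity theorem, and strict
    differentiability, the hypothesis of the inverse function theorem. *)

Set Implicit Arguments.
Unset Strict Implicit.
Unset Printing Implicit Defensive.
Import Order.TTheory GRing.Theory Num.Theory.
Import numFieldNormedType.Exports.
Local Open Scope classical_set_scope.
Local Open Scope ring_scope.

(** * Real-valued norms and first-order expansions *)

Lemma linear_sub (K : pzRingType) (V W : lmodType K) (f : V -> W) :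
  linear f -> forall u v, f (u - v) = f u - f v.
Proof.
move=> lf u v; have := lf (-1) v u.
by rewrite !scaleN1r [- v + u]addrC [- f v + f u]addrC.
Qed.

Section NormVal.
Variable R : realType.
Local Notation C := (Cplx R).

Definition toC (x : R) : C := (real_complex R x : complex R).
Definition re (z : C) : R := complex.Re (z : complex R).
Definition im (z : C) : R := complex.Im (z : complex R).

(** Norms over [C] take values in [C]; their real parts live in [R], where order
    is total and linear arithmetic applies. [nm] is extracted from an opaque
    proof so that unification never unfolds the structures behind a norm. *)
Lemma nm_key (V : normedModType C) : {N : V -> R | forall v, N v = re `|v|}.
Proof. by exists (fun v => re `|v|). Qed.

Definition nm (V : normedModType C) (v : V) : R := sval (nm_key V) v.

Lemma nm_def (V : normedModType C) (v : V) : nm v = re `|v|.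
Proof. exact: (svalP (nm_key V) v). Qed.

Lemma toC_le (x y : R) : (toC x <= toC y) = (x <= y).
Proof. exact: lecR. Qed.
Lemma toC_lt (x y : R) : (toC x < toC y) = (x < y).
Proof. exact: ltcR. Qed.
Lemma toCD (x y : R) : toC (x + y) = toC x + toC y. Proof. exact: (rmorphD (real_complex R)). Qed.
Lemma toCM (x y : R) : toC (x * y) = toC x * toC y. Proof. exact: (rmorphM (real_complex R)). Qed.

Lemma toC_re (z : C) : 0 <= z -> toC (re z) = z.
Proof. by move=> z0; apply: RRe_real; apply: ger0_real. Qed.

Lemma nmE (V : normedModType C) (v : V) : `|v| = toC (nm v).
Proof. by rewrite nm_def toC_re. Qed.

Lemma nm_ge0 (V : normedModType C) (v : V) : 0 <= nm v.
Proof. by rewrite -toC_le -nmE normr_ge0. Qed.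

Lemma nmD (V : normedModType C) (u v : V) : nm (u + v) <= nm u + nm v.
Proof. by rewrite -toC_le toCD -!nmE ler_normD. Qed.

Lemma nmZ (V : normedModType C) (a : C) (v : V) : nm (a *: v) = nm a * nm v.
Proof. by apply: (@complexI R); rewrite -[LHS]nmE normrZ !nmE -toCM. Qed.

Lemma nmM (a b : C) : nm (a * b) = nm a * nm b.
Proof. by apply: (@complexI R); rewrite -[LHS]nmE normrM !nmE -toCM. Qed.

Lemma nmN (V : normedModType C) (v : V) : nm (- v) = nm v.
Proof. by rewrite !nm_def normrN. Qed.

Lemma nm0 (V : normedModType C) : nm (0 : V) = 0.
Proof. by rewrite nm_def normr0. Qed.

Lemma nm_eq0 (V : normedModType C) (v : V) : (nm v == 0) = (v == 0).
Proof.
apply/eqP/eqP => [h|->]; last exact: nm0.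
by apply/eqP; rewrite -normr_eq0 nmE h.
Qed.

Lemma nm_gt0 (V : normedModType C) (v : V) : (0 < nm v) = (v != 0).
Proof. by rewrite lt_def nm_ge0 nm_eq0 andbT. Qed.

Lemma nmB (V : normedModType C) (u v : V) : nm (u - v) <= nm u + nm v.
Proof. by rewrite -(nmN v) nmD. Qed.

Lemma nmBC (V : normedModType C) (u v : V) : nm (u - v) = nm (v - u).
Proof. by rewrite -nmN opprB. Qed.

Lemma nm_split (V : normedModType C) (w u v : V) :
  nm (u - v) <= nm (u - w) + nm (w - v).
Proof. by have := nmD (u - w) (w - v); rewrite addrA subrK. Qed.

Lemma nm1 : nm (1 : C) = 1.
Proof. by rewrite nm_def normr1. Qed.

Lemma nm_toC (x : R) : nm (toC x) = `|x|.
Proof.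
apply: (@complexI R); rewrite -[LHS]nmE /toC.
by rewrite normc_def /= expr0n /= addr0 sqrtr_sqr.
Qed.

Lemma nm_nat (k : nat) : nm (k%:R : C) = k%:R.
Proof. by rewrite -(rmorph_nat (real_complex R)) nm_toC normr_nat. Qed.

Lemma nmV (a : C) : nm a^-1 = (nm a)^-1.
Proof.
have [->|a0] := eqVneq a 0; first by rewrite invr0 nm0 invr0.
have n0 : nm a != 0 by rewrite nm_eq0.
apply: (mulfI n0); rewrite -nmM mulfV // mulfV //; exact: nm1.
Qed.

Lemma nmX (a : C) n : nm (a ^+ n) = nm a ^+ n.
Proof. by elim: n => [|n IH]; rewrite ?expr0 ?nm1 // !exprS nmM IH. Qed.

Lemma nm_conj (a : C) : nm a^* = nm a.
Proof. by rewrite !nm_def norm_conjC. Qed.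

Definition ic : C := (Complex 0 1 : complex R).

Lemma nm_ic : nm ic = 1.
Proof.
apply: (@complexI R); rewrite -[LHS]nmE normc_def /=.
by rewrite expr0n expr1n add0r sqrtr1.
Qed.

Lemma ic2 : ic * ic = -1.
Proof. by have := sqr_i R; rewrite expr2. Qed.

Lemma reim (z : C) : z = toC (re z) + ic * toC (im z).
Proof. exact: complexE. Qed.

Lemma reD (y z : C) : re (y + z) = re y + re z.
Proof. by case: y z => [a b] [c d]. Qed.
Lemma imD (y z : C) : im (y + z) = im y + im z.
Proof. by case: y z => [a b] [c d]. Qed.
Lemma imN (z : C) : im (- z) = - im z.
Proof. by case: z. Qed.
Lemma reN (z : C) : re (- z) = - re z.
Proof. by case: z. Qed.
Lemma im_toC (x : R) : im (toC x) = 0. Proof. by []. Qed.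
Lemma re_toC (x : R) : re (toC x) = x. Proof. by []. Qed.
Lemma imM (y z : C) : im (y * z) = re y * im z + im y * re z.
Proof. by case: y z => [a b] [c d]. Qed.
Lemma reM (y z : C) : re (y * z) = re y * re z - im y * im z.
Proof. by case: y z => [a b] [c d]. Qed.

Lemma nm_sqr (z : C) : nm z ^+ 2 = re z ^+ 2 + im z ^+ 2.
Proof.
apply: (@complexI R); rewrite add_Re2_Im2 (rmorphXn (real_complex R)).
by congr (_ ^+ 2); symmetry; apply: (@nmE C z).
Qed.

Lemma re_le_nm (z : C) : `|re z| <= nm z.
Proof.
rewrite -(@ler_pXn2r _ 2) ?nnegrE ?nm_ge0 //.
by rewrite nm_sqr real_normK ?num_real // lerDl sqr_ge0.
Qed.

Lemma im_le_nm (z : C) : `|im z| <= nm z.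
Proof.
rewrite -(@ler_pXn2r _ 2) ?nnegrE ?nm_ge0 //.
by rewrite nm_sqr real_normK ?num_real // lerDr sqr_ge0.
Qed.

Lemma nm_le_reim (z : C) : nm z <= `|re z| + `|im z|.
Proof.
rewrite {1}(reim z); apply: le_trans (nmD _ _) _.
by rewrite nmM nm_ic mul1r !nm_toC.
Qed.

Lemma nbhs_nm (V : normedModType C) (x : V) (P : V -> Prop) :
  (\forall y \near x, P y) <->
  exists2 d : R, 0 < d & forall y, nm (y - x) < d -> P y.
Proof.
split=> [/nbhs_normP [e /= e0 He]|[d d0 Hd]].
  have ee : toC (re e) = e by rewrite toC_re // ltW.
  exists (re e) => [|y yx]; first by rewrite -toC_lt ee.
  by apply: He; rewrite /ball_ /= -ee nmE toC_lt nmBC.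
apply/nbhs_normP; exists (toC d) => /=; first by rewrite -[0]/(toC 0) toC_lt.
by move=> y; rewrite /ball_ /= nmE toC_lt nmBC; apply: Hd.
Qed.

(** Differentiability at [x] with derivative [L], as an epsilon-delta estimate in
    [R]; [L] is a bare function, so that explicit formulas can be used for it. *)
Definition expands (V W : normedModType C) (f : V -> W) (x : V) (L : V -> W) :=
  forall e : R, 0 < e -> exists2 d : R, 0 < d &
    forall h, nm h < d -> nm (f (x + h) - f x - L h) <= e * nm h.

Lemma eqo_nm (V W : normedModType C) (g : V -> W) :
  (g =o_ (0 : V) id) <-> (forall e : R, 0 < e -> exists2 d : R, 0 < d &
    forall h, nm h < d -> nm (g h) <= e * nm h).
Proof.
split=> [/eqoP H e e0|H].
  have e0' : 0 < toC e by rewrite -[0]/(toC 0) toC_lt.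
  have /nbhs_nm [d d0 Hd] := H _ e0'.
  exists d => // h hd; have := Hd h; rewrite subr0 => /(_ hd).
  by rewrite !nmE -toCM toC_le.
apply/eqoP => e e0; have ee : toC (re e) = e by rewrite toC_re // ltW.
have [|d d0 Hd] := H (re e); first by rewrite -toC_lt ee.
apply/nbhs_nm; exists d => // y; rewrite subr0 => /Hd.
by rewrite !nmE -ee -toCM toC_le.
Qed.

Lemma diff_expands (V W : normedModType C) (f : V -> W) (x : V) :
  differentiable f x -> expands f x ('d f x).
Proof.
move=> df; have /eqo_nm : (fun h => f (x + h) - f x - 'd f x h) =o_ (0 : V) id.
  move: (diff_locally df) => /eqaddoP H.
  apply/eqoP => e e0; have := H e e0.
  apply: filterS => h.
  rewrite -[X in `|X| <= _ -> _]/(f (h + x) - (f x + 'd f x h)).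
  by rewrite opprD addrA [h + x]addrC.
exact.
Qed.

Lemma bounded_continuous_lin (V W : normedModType C) (L : {linear V -> W}) (K : R) :
  (forall v, nm (L v) <= K * nm v) -> continuous L.
Proof.
move=> HK; apply: bounded_linear_continuous; apply/linear_boundedP.
exists (toC K); split; first by apply/complex_realP; exists K.
move=> r Kr x; apply: le_trans (_ : toC K * `|x| <= _).
  by rewrite !nmE -toCM toC_le.
by rewrite ler_wpM2r // ltW.
Qed.

Lemma continuous_lin_bounded (V W : normedModType C) (L : {linear V -> W}) :
  continuous L -> exists2 K : R, 0 < K & forall v, nm (L v) <= K * nm v.
Proof.
move=> /linear_lipschitz [k k0 Hk].
have kk : toC (re k) = k by rewrite toC_re // ltW.
exists (re k); first by rewrite -toC_lt kk.
by move=> v; have := Hk v; rewrite !nmE -kk -toCM toC_le.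
Qed.

Lemma expands_diff (V W : normedModType C) (f : V -> W) (x : V)
    (L : {linear V -> W}) (K : R) :
  (forall v, nm (L v) <= K * nm v) -> expands f x L ->
  differentiable f x /\ 'd f x = L :> (V -> W).
Proof.
move=> HK fL.
have Lc := bounded_continuous_lin HK.
have E : f \o shift x = cst (f x) + L +o_ (0 : V) id.
  apply/eqaddoP => e e0.
  have /eqo_nm/eqoP := fL; move=> /(_ e e0).
  apply: filterS => h.
  rewrite -[X in _ -> `|X| <= _]/(f (h + x) - (f x + L h)).
  by rewrite opprD addrA [h + x]addrC.
have D := diff_unique Lc E; split=> //.
by apply/diff_locallyP; rewrite D.
Qed.

Lemma expands_linear_diff (V W : normedModType C) (f : V -> W) (x : V)
    (L : V -> W) (K : R) : linear L ->
  (forall v, nm (L v) <= K * nm v) -> expands f x L ->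
  differentiable f x /\ 'd f x = L :> (V -> W).
Proof.
move=> linL HK fL.
pose L' : {linear V -> W} := HB.pack_for {linear V -> W} L (GRing.isLinear.Build _ V W *:%R L linL).
exact: (@expands_diff V W f x L' K HK fL).
Qed.

End NormVal.

(** * Completeness and triadic subdivision *)

Section Completeness.
Variable R : realType.
Local Notation C := (Cplx R).

Lemma nm_coord n (v : 'rV[C]_n) j : nm (v 0 j) <= nm v.
Proof.
rewrite -toC_le -!nmE -[`|v|]/(mx_norm v) mx_normE.
rewrite -[leLHS]nngE num_le.
exact: (le_bigmax _ (fun i : 'I_1 * 'I_n => `|v i.1 i.2|%:nng) (0, j)).
Qed.

Lemma nm_rV_le n (v : 'rV[C]_n) r : 0 <= r ->
  (forall j, nm (v 0 j) <= r) -> nm v <= r.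
Proof.
move=> r0 H; have [v0|] := eqVneq (mx_norm v) 0.
  by rewrite (mx_norm_eq0 v0) nm0.
move=> /mx_norm_neq0 [[i j] /= E].
by rewrite -toC_le -nmE -[`|v|]/(mx_norm v) E /= nmE toC_le (ord1 i) H.
Qed.

Lemma nm_pairE (V W : normedModType C) (p : V * W) :
  nm p = Num.max (nm p.1) (nm p.2).
Proof.
rewrite {1}nm_def prod_normE !nmE; case: (leP (nm p.1) (nm p.2)) => h.
  by rewrite max_r ?toC_le.
by rewrite max_l ?toC_le // ltW.
Qed.

Lemma nm_pair1 (V W : normedModType C) (p : V * W) : nm p.1 <= nm p.
Proof. by rewrite nm_pairE le_max lexx. Qed.

Lemma nm_pair2 (V W : normedModType C) (p : V * W) : nm p.2 <= nm p.
Proof. by rewrite nm_pairE le_max lexx orbT. Qed.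

Lemma nm_pair_le (V W : normedModType C) (p : V * W) r :
  nm p.1 <= r -> nm p.2 <= r -> nm p <= r.
Proof. by move=> h1 h2; rewrite nm_pairE ge_max h1. Qed.

Lemma nested_real (a e : nat -> R) :
  (forall m n, (m <= n)%N -> `|a n - a m| <= e m) ->
  exists l, forall m, `|a m - l| <= e m.
Proof.
move=> H.
have e0 m : 0 <= e m by apply: le_trans (H m m (leqnn m)); rewrite normr_ge0.
have K m n : a m - e m <= a n + e n.
  case/orP: (leq_total m n) => /H; rewrite ler_norml => /andP [h1 h2];
  by have := e0 m; have := e0 n; lra.
pose S := [set x | exists m, x = a m - e m].
have hS : has_sup S.
  split; first by exists (a 0%N - e 0%N); exists 0%N.
  by exists (a 0%N + e 0%N) => _ [m ->]; apply: K.
exists (sup S) => m; rewrite ler_norml.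
have h1 : a m - e m <= sup S by apply: ub_le_sup; [case: hS|exists m].
have h2 : sup S <= a m + e m.
  by apply: ge_sup; [case: hS|move=> _ [k ->]; apply: K].
by apply/andP; split; lra.
Qed.

(** Completeness with an explicit rate; the factor [2] absorbs the passage from
    real and imaginary parts to complex numbers, and the form is stable under
    products. *)
Definition nested_complete (V : normedModType C) :=
  forall (u : nat -> V) (e : nat -> R),
    (forall m n, (m <= n)%N -> nm (u n - u m) <= e m) ->
    exists l, forall m, nm (u m - l) <= 2 * e m.

Lemma nested_complete_C : nested_complete C.
Proof.
move=> u e H.
have [|x Hx] := @nested_real (fun m => re (u m)) e.
  move=> m n mn /=; apply: le_trans (H _ _ mn).
  by rewrite -reN -reD re_le_nm.
have [|y Hy] := @nested_real (fun m => im (u m)) e.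
  move=> m n mn /=; apply: le_trans (H _ _ mn).
  by rewrite -imN -imD im_le_nm.
exists (toC x + ic R * toC y) => m.
apply: le_trans (nm_le_reim _) _.
have := Hx m; have := Hy m => /=.
rewrite reD imD reN imN reD imD reM imM /= /re /im /=.
rewrite !mul0r !mul1r !subrr !addr0 !add0r.
lra.
Qed.

Lemma nested_complete_rV n : nested_complete ('rV[C]_n).
Proof.
move=> u e H.
have e0 m : 0 <= e m by apply: le_trans (H m m (leqnn m)); rewrite nm_ge0.
have : forall j, exists l : C, forall m, nm (u m 0 j - l) <= 2 * e m.
  move=> j; apply: nested_complete_C => m k mk.
  by apply: le_trans (H _ _ mk); have := nm_coord (u k - u m) j; rewrite !mxE.
move=> /choice [l Hl]; exists (\row_j l j) => m.
by apply: nm_rV_le => [|j]; [rewrite mulr_ge0|rewrite !mxE].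
Qed.

Lemma nested_complete_pair (V W : normedModType C) :
  nested_complete V -> nested_complete W -> nested_complete (V * W)%type.
Proof.
move=> HV HW u e H.
have [|x Hx] := HV (fun m => (u m).1) e.
  by move=> m n mn; apply: le_trans (H _ _ mn); apply: (@nm_pair1 V W (u n - u m)).
have [|y Hy] := HW (fun m => (u m).2) e.
  by move=> m n mn; apply: le_trans (H _ _ mn); apply: (@nm_pair2 V W (u n - u m)).
by exists (x, y) => m; apply: nm_pair_le; [apply: Hx|apply: Hy].
Qed.

Lemma triadic_pow_small (e : R) : 0 < e -> exists m, 3^-1 ^+ m < e.
Proof.
move=> e0; have [m Hm] : exists m : nat, e^-1 < m%:R.
  by exists (Num.truncn e^-1).+1; apply: truncnS_gt.
exists m; rewrite exprVn invf_plt ?posrE ?exprn_gt0 //.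
apply: lt_le_trans Hm _; rewrite -natrX ler_nat.
by rewrite ltnW // ltn_expl.
Qed.

(** Cousin's principle for squares: a property that passes from the nine thirds
    of a square to the square, and holds for all small squares around each point,
    holds for the whole square; otherwise nested bad squares shrink to a point.
    Thirds rather than halves keep the centre of a square inside the middle
    subsquare, which the treatment of punctures relies on. *)
Lemma triadic_induction (P : R -> R -> R -> Prop) (x y l : R) :
  0 < l ->
  (forall x y l, 0 < l ->
    (forall i j : 'I_3, P (x + i%:R * (l / 3)) (y + j%:R * (l / 3)) (l / 3)) ->
    P x y l) ->
  (forall u v, x <= u <= x + l -> y <= v <= y + l ->
    exists2 d, 0 < d & forall x' y' l', 0 < l' -> l' < d ->
      x <= x' -> x' + l' <= x + l -> y <= y' -> y' + l' <= y + l ->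
      x' <= u <= x' + l' -> y' <= v <= y' + l' -> P x' y' l') ->
  P x y l.
Proof.
move=> l0 Hsub Hpt; apply: contrapT => nP.
pose T := {q : R * R * R | 0 < q.2 /\ ~ P q.1.1 q.1.2 q.2}.
pose Rel (s t : T) := (sval t).2 = (sval s).2 / 3 /\
  exists i j : 'I_3, (sval t).1.1 = (sval s).1.1 + i%:R * ((sval s).2 / 3) /\
                     (sval t).1.2 = (sval s).1.2 + j%:R * ((sval s).2 / 3).
have step (s : T) : {t : T | Rel s t}.
  apply: cid; case: s => -[[a b] c] /= [c0 nPs].
  apply: contrapT => Hno; apply: (nPs); apply: Hsub => // i j.
  apply: contrapT => nPij; apply: Hno.
  have h : 0 < (a + i%:R * (c / 3), b + j%:R * (c / 3), c / 3).2 /\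
     ~ P (a + i%:R * (c / 3)) (b + j%:R * (c / 3)) (c / 3).
    by split=> //=; rewrite divr_gt0.
  by exists (exist _ (a + i%:R * (c / 3), b + j%:R * (c / 3), c / 3) h);
    split=> //=; exists i, j.
pose s0 : T := exist _ (x, y, l) (conj l0 nP).
have [s [ss Hs]] := dependent_choice step s0.
have Ls m : (sval (s m)).2 = l * 3^-1 ^+ m.
  elim: m => [|m IH]; first by rewrite ss /= expr0 mulr1.
  by have [-> _] := Hs m; rewrite IH exprSr mulrA.
pose X m := (sval (s m)).1.1; pose Y m := (sval (s m)).1.2; pose L m := (sval (s m)).2.
have Lp m : 0 < L m by case: (svalP (s m)).
have i3 (i : 'I_3) : 0 <= (i%:R : R) <= 2.
  by rewrite ler0n (ler_nat _ i 2) -ltnS ltn_ord.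
have mono m n : (m <= n)%N -> [/\ X m <= X n, X n + L n <= X m + L m,
                                Y m <= Y n & Y n + L n <= Y m + L m].
  move=> /subnK <-; elim: (n - m)%N => [|k [h1 h2 h3 h4]]; first by rewrite add0n.
  rewrite addSn; have [e1 [i [j [e2 e3]]]] := Hs (k + m)%N.
  rewrite -!/(X _) -!/(Y _) -!/(L _) in e1 e2 e3.
  have /andP [i0 i2] := i3 i; have /andP [j0 j2] := i3 j; have := Lp (k + m)%N.
  move: e1 e2 e3 => -> -> -> Lkm.
  have := mulr_ge0 i0 (ltW Lkm); have := mulr_ge0 j0 (ltW Lkm).
  have := ler_wpM2r (ltW Lkm) i2; have := ler_wpM2r (ltW Lkm) j2.
  by move=> g1 g2 g3 g4; split; lra.
have lim (Z : nat -> R) : (forall m n, (m <= n)%N -> Z m <= Z n /\ Z n + L n <= Z m + L m) ->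
    exists u, forall m, Z m <= u <= Z m + L m.
  move=> HZ.
  have [|u Hu] := @nested_real (fun m => Z m + L m / 2) (fun m => L m / 2).
    by move=> m n /HZ [h1 h2]; rewrite ler_norml; have := Lp n; move=> h3; apply/andP; split; lra.
  by exists u => m; have := Hu m; rewrite ler_norml => /andP [h1 h2]; apply/andP; split; lra.
have [|u Hu] := lim X; first by move=> m n /mono [].
have [|v Hv] := lim Y; first by move=> m n /mono [].
have X0 : X 0%N = x by rewrite /X ss.
have Y0 : Y 0%N = y by rewrite /Y ss.
have L0 : L 0%N = l by rewrite /L ss.
have [||d d0 Hd] := Hpt u v.
  by rewrite -X0 -L0.
  by rewrite -Y0 -L0.
have [m Hm] : exists m, 3^-1 ^+ m < d / l by apply: triadic_pow_small; rewrite divr_gt0.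
have := (svalP (s m)).2; apply.
have [h1 h2 h3 h4] := mono 0%N m (leq0n m).
rewrite X0 Y0 L0 in h1 h2 h3 h4.
apply: Hd => //; first exact: Lp.
  by rewrite Ls mulrC -ltr_pdivlMr.
  exact: Hu.
exact: Hv.
Qed.

End Completeness.

(** * Goursat's lemma for midpoint sums *)

Section Goursat.
Variable R : realType.
Local Notation C := (Cplx R).

(** Midpoint rule with [3 ^ N] steps for the integral of [g] over the segment
    from [p] to [p + v]. Finite sums stand for contour integrals throughout. *)
Fixpoint midsum (N : nat) (g : C -> C) (p v : C) : C :=
  if N is N'.+1 then
    midsum N' g p (v / 3) + midsum N' g (p + v / 3) (v / 3)
    + midsum N' g (p + v / 3 + v / 3) (v / 3)
  else v * g (p + v / 2).

Lemma midsum_eq N g p p' v v' : p = p' -> v = v' -> midsum N g p v = midsum N g p' v'.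
Proof. by move=> -> ->. Qed.

Lemma midsum_lin N f g (c p v : C) :
  midsum N (fun z => f z + c * g z) p v = midsum N f p v + c * midsum N g p v.
Proof. by elim: N p v => [|N IH] p v /=; rewrite ?IH; ring. Qed.

(** The midpoint rule is exact on affine functions, for every subdivision; this
    replaces the existence of primitives. *)
Lemma midsum_affine N (a b p v : C) :
  midsum N (fun z => a + b * z) p v = a * v + b * (p * v + v ^+ 2 / 2).
Proof. by elim: N p v => [|N IH] p v /=; rewrite ?IH; field. Qed.

(** [phi] is the norm, for upper bounds, or plus or minus an imaginary part, for
    lower bounds. *)
Lemma midsum_subadd (phi : C -> R) N g p v (m : R) :
  (forall a b, phi (a + b) <= phi a + phi b) ->
  (forall a, phi (a / 3) = phi a / 3) ->
  (forall t, 0 <= t <= 1 -> phi (v * g (p + toC t * v)) <= m) ->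
  phi (midsum N g p v) <= m.
Proof.
move=> phiD phiZ; elim: N p v m => [|N IH] p v m H /=.
  have -> : v / 2 = toC 2^-1 * v.
    by rewrite [RHS]mulrC; congr (_ * _); rewrite /toC fmorphV rmorph_nat.
  by apply: H; lra.
have third k : (k <= 2)%N -> phi (midsum N g (p + k%:R * (v / 3)) (v / 3)) <= m / 3.
  move=> k2; apply: IH => t t01.
  have -> : v / 3 * g (p + k%:R * (v / 3) + toC t * (v / 3)) =
            (v * g (p + toC ((k%:R + t) / 3) * v)) / 3.
    rewrite mulrAC; congr (_ * g _ / _).
    have -> : toC ((k%:R + t) / 3) = (k%:R + toC t) / 3.
      by rewrite /toC fmorph_div rmorphD !rmorph_nat.
    by field.
  rewrite phiZ ler_wpM2r //; apply: H.
  have : (k%:R : R) <= 2 by rewrite (ler_nat _ k 2).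
  by have := ler0n R k; move=> ? ?; lra.
have := third 0%N isT; have := third 1%N isT; have := third 2%N isT.
rewrite mul0r addr0 mul1r (_ : p + 2%:R * (v / 3) = p + v / 3 + v / 3); last by ring.
move=> h2 h1 h0; apply: le_trans (phiD _ _) _.
have := phiD (midsum N g p (v / 3)) (midsum N g (p + v / 3) (v / 3)).
lra.
Qed.

(** The anticlockwise contour sum of the square with corners [p], [p + s],
    [p + s + i s] and [p + i s]. *)
Definition sqsum N g (p s : C) : C :=
  midsum N g p s + midsum N g (p + s) (ic R * s)
  - midsum N g (p + ic R * s) s - midsum N g p (ic R * s).

(** Refining the subdivision is the same as adding the sums of the nine
    subsquares, because inner edges cancel. *)
Lemma sqsum_nine N g (p s : C) :
  sqsum N.+1 g p s =
  \sum_(i < 3) \sum_(j < 3)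
    sqsum N g (p + i%:R * (s / 3) + ic R * (j%:R * (s / 3))) (s / 3).
Proof.
pose t := s / 3.
pose H (i j : nat) := midsum N g (p + i%:R * t + ic R * (j%:R * t)) t.
pose V (i j : nat) := midsum N g (p + i%:R * t + ic R * (j%:R * t)) (ic R * t).
have E (i j : nat) : sqsum N g (p + i%:R * t + ic R * (j%:R * t)) t =
    H i j + V i.+1 j - H i j.+1 - V i j.
  rewrite /sqsum; congr (_ + _ - _ - _); apply: midsum_eq => //;
  by rewrite -natr1; ring.
rewrite -/t !big_ord_recr !big_ord0 /= !E /=.
have st : s = 3 * t by rewrite /t; field.
have Hj j : midsum N.+1 g (p + ic R * (j%:R * t)) s = H 0%N j + H 1%N j + H 2%N j.
  rewrite /= /H -/t; congr (_ + _ + _); apply: midsum_eq => //; ring.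
have Vi i : midsum N.+1 g (p + i%:R * t) (ic R * s) = V i 0%N + V i 1%N + V i 2%N.
  rewrite /= /V -mulrA -/t; congr (_ + _ + _); apply: midsum_eq => //; ring.
rewrite /sqsum.
have -> : midsum N.+1 g p s = H 0%N 0%N + H 1%N 0%N + H 2%N 0%N.
  by rewrite -Hj; apply: midsum_eq => //; ring.
have -> : midsum N.+1 g (p + ic R * s) s = H 0%N 3 + H 1%N 3 + H 2%N 3.
  by rewrite -Hj; apply: midsum_eq => //; rewrite st; ring.
have -> : midsum N.+1 g p (ic R * s) = V 0%N 0%N + V 0%N 1%N + V 0%N 2%N.
  by rewrite -Vi; apply: midsum_eq => //; ring.
have -> : midsum N.+1 g (p + s) (ic R * s) = V 3 0%N + V 3 1%N + V 3 2%N.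
  by rewrite -Vi; apply: midsum_eq => //; rewrite st; ring.
ring.
Qed.

Lemma sqsum_lin N f g (c p s : C) :
  sqsum N (fun z => f z + c * g z) p s = sqsum N f p s + c * sqsum N g p s.
Proof. by rewrite /sqsum !midsum_lin; ring. Qed.

Lemma sqsum_affine N (a b p s : C) : sqsum N (fun z => a + b * z) p s = 0.
Proof. by rewrite /sqsum !midsum_affine; field. Qed.

End Goursat.

Section GoursatLemma.
Variable R : realType.
Local Notation C := (Cplx R).
Local Notation ic := (ic R).

Definition pt (x y : R) : C := toC x + ic * toC y.

Lemma re_pt x y : re (pt x y) = x.
Proof. by rewrite /pt reD reM /re /im /= mul0r mulr0 subrr addr0. Qed.
Lemma im_pt x y : im (pt x y) = y.
Proof. by rewrite /pt imD imM /re /im /= mul0r mul1r !add0r. Qed.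
Definition insq (x y l : R) (z : C) := (x <= re z <= x + l) && (y <= im z <= y + l).

Definition onbd (x y l : R) (z : C) :=
  insq x y l z && [|| re z == x, re z == x + l, im z == y | im z == y + l].

Definition sqr N (g : C -> C) (x y l : R) := sqsum N g (pt x y) (toC l).

Lemma sqr_bound N g x y l (B : R) : 0 <= l ->
  (forall z, onbd x y l z -> nm (g z) <= B) -> nm (sqr N g x y l) <= 4 * l * B.
Proof.
move=> l0 H; rewrite /sqr /sqsum.
have E q v : nm v = l -> (forall t, 0 <= t <= 1 -> onbd x y l (q + toC t * v)) ->
    nm (midsum N g q v) <= l * B.
  move=> vl Hq; apply: midsum_subadd => [a b|a|t t01]; first exact: nmD.
    rewrite nmM nmV; congr (_ * _^-1).
    by exact: nm_nat.
  by rewrite nmM vl ler_wpM2l //; apply/H/Hq.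
have tl t : 0 <= t <= 1 -> 0 <= t * l <= l.
  by move=> /andP [t0 t1]; rewrite mulr_ge0 //= -[leRHS]mul1r ler_wpM2r.
have e1 : nm (midsum N g (pt x y) (toC l)) <= l * B.
  apply: E => [|t /tl /andP [t0 t1]]; first by rewrite nm_toC ger0_norm.
  rewrite [X in onbd _ _ _ X](_ : _ = pt (x + t * l) y); last by rewrite /pt toCD toCM; ring.
  by rewrite /onbd /insq re_pt im_pt eqxx !orbT andbT; apply/andP; split; lra.
have e2 : nm (midsum N g (pt x y + toC l) (ic * toC l)) <= l * B.
  apply: E => [|t /tl /andP [t0 t1]]; first by rewrite nmM nm_ic mul1r nm_toC ger0_norm.
  rewrite [X in onbd _ _ _ X](_ : _ = pt (x + l) (y + t * l)); last by rewrite /pt !toCD toCM; ring.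
  by rewrite /onbd /insq re_pt im_pt eqxx !orbT andbT; apply/andP; split; lra.
have e3 : nm (midsum N g (pt x y + ic * toC l) (toC l)) <= l * B.
  apply: E => [|t /tl /andP [t0 t1]]; first by rewrite nm_toC ger0_norm.
  rewrite [X in onbd _ _ _ X](_ : _ = pt (x + t * l) (y + l)); last by rewrite /pt !toCD toCM; ring.
  by rewrite /onbd /insq re_pt im_pt eqxx !orbT andbT; apply/andP; split; lra.
have e4 : nm (midsum N g (pt x y) (ic * toC l)) <= l * B.
  apply: E => [|t /tl /andP [t0 t1]]; first by rewrite nmM nm_ic mul1r nm_toC ger0_norm.
  rewrite [X in onbd _ _ _ X](_ : _ = pt x (y + t * l)); last by rewrite /pt !toCD toCM; ring.
  by rewrite /onbd /insq re_pt im_pt eqxx /= andbT; apply/andP; split; lra.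
apply: le_trans (nmB _ _) _.
apply: le_trans (lerD (nmB _ _) (lexx _)) _.
apply: le_trans (lerD (lerD (nmD _ _) (lexx _)) (lexx _)) _.
lra.
Qed.

Lemma sqr_nine N g x y l : sqr N.+1 g x y l =
  \sum_(i < 3) \sum_(j < 3) sqr N g (x + i%:R * (l / 3)) (y + j%:R * (l / 3)) (l / 3).
Proof.
have l3 : toC (l / 3) = toC l / 3 by rewrite /toC fmorph_div rmorph_nat.
have nn (k : nat) : toC (R:=R) k%:R = k%:R by rewrite /toC rmorph_nat.
rewrite /sqr sqsum_nine; apply: eq_bigr => i _; apply: eq_bigr => j _.
rewrite -l3; congr sqsum; rewrite /pt !toCD !toCM !nn; ring.
Qed.

(** Goursat's argument: on a small square around a point, [f] is affine up to
    [o(l)], so its sum is [o(l ^ 2)]; the bound [e * l ^ 2] is additive over nine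
    subsquares, and triadic induction propagates it. *)
Lemma goursat (f : C -> C) x y l : 0 < l ->
  (forall z, insq x y l z -> differentiable f z) ->
  forall e, 0 < e -> exists N0, forall N, (N0 <= N)%N -> nm (sqr N f x y l) <= e.
Proof.
move=> l0 Hf.
suff H : forall e, 0 < e -> exists N0, forall N, (N0 <= N)%N -> nm (sqr N f x y l) <= e * l ^+ 2.
  move=> e e0; have [|N0 HN] := H (e / l ^+ 2); first by rewrite divr_gt0 ?exprn_gt0.
  by exists N0 => N /HN; rewrite divfK // gt_eqF // exprn_gt0.
move=> e e0.
apply: (@triadic_induction R (fun x y l => exists N0, forall N, (N0 <= N)%N ->
  nm (sqr N f x y l) <= e * l ^+ 2) x y l l0).
- move=> {Hf} {}x {}y {}l {}l0 H.
  have /choice [M HM] : forall ij : 'I_3 * 'I_3, exists N0, forall N, (N0 <= N)%N ->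
     nm (sqr N f (x + ij.1%:R * (l / 3)) (y + ij.2%:R * (l / 3)) (l / 3)) <= e * (l / 3) ^+ 2.
    by move=> [i j]; apply: H.
  exists (\max_ij M ij).+1 => -[//|N]; rewrite ltnS => HN.
  rewrite sqr_nine pair_big /=.
  apply: le_trans (_ : \sum_(ij : 'I_3 * 'I_3) (e * (l / 3) ^+ 2) <= _); last first.
    by rewrite sumr_const card_prod !card_ord -mulr_natr; lra.
  elim/big_rec2: _ => [|ij a b _ IH]; first by rewrite nm0.
  apply: le_trans (nmD _ _) _; apply: lerD => //.
  by apply: HM; apply: leq_trans HN; apply: (leq_bigmax ij).
- move=> u v Hu Hv.
  have dz : differentiable f (pt u v).
    by apply: Hf; rewrite /insq re_pt im_pt Hu.
  set z := pt u v in dz.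
  have e8 : 0 < e / 8 by lra.
  have [d d0 Hd] := diff_expands dz e8.
  exists (d / 2); first by lra.
  move=> x' y' l' l'0 l'd _ _ _ _ Hu' Hv'.
  exists 0%N => N _.
  pose a := f z - 'd f z 1 * z; pose b := 'd f z 1 : C.
  have -> : sqr N f x' y' l' = sqr N (fun w => f w - (a + b * w)) x' y' l'.
    rewrite /sqr.
    have -> : (fun w => f w - (a + b * w)) = (fun w => f w + (-1) * (a + b * w)).
      by apply: funext => w; rewrite mulN1r.
    by rewrite sqsum_lin sqsum_affine mulr0 addr0.
  rewrite (_ : e * _ = 4 * l' * (e / 8 * (2 * l'))); last by field.
  apply: sqr_bound; first exact: ltW.
  move=> w /andP [/andP [w1 w2] _].
  have wz : nm (w - z) <= 2 * l'.
    apply: le_trans (nm_le_reim _) _.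
    rewrite reD imD reN imN /z re_pt im_pt.
    have h1 : `|re w - u| <= l' by rewrite ler_norml; apply/andP; split; lra.
    have h2 : `|im w - v| <= l' by rewrite ler_norml; apply/andP; split; lra.
    lra.
  have := Hd (w - z); rewrite [z + _]addrC subrK.
  have -> : 'd f z (w - z) = b * (w - z).
    by rewrite -{1}[w - z]mulr1 -[(w - z) * 1]/((w - z) *: (1 : C)) linearZ /= mulrC.
  rewrite (_ : f w - f z - _ = f w - (a + b * w)); last by rewrite /a -/b; ring.
  move=> H; apply: le_trans (H _) _; first by lra.
  by rewrite ler_wpM2l // ltW.
Qed.

End GoursatLemma.

(** * Sums around a puncture *)

Section CauchyEstimate.
Variable R : realType.
Local Notation C := (Cplx R).
Local Notation ic := (ic R).

(** Sums around the square of half-side [r] centred at [c]. *)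
Definition csq N (g : C -> C) (c : C) (r : R) :=
  sqr N g (re c - r) (im c - r) (2 * r).

Definition incsq (c : C) (r : R) (z : C) := insq (re c - r) (im c - r) (2 * r) z.

Lemma incsq_nm (c : C) r z : incsq c r z -> nm (z - c) <= 2 * r.
Proof.
move=> /andP [/andP [h1 h2] /andP [h3 h4]]; apply: le_trans (nm_le_reim _) _.
rewrite reD imD reN imN.
have H1 : `|re z - re c| <= r by rewrite ler_norml; apply/andP; split; lra.
have H2 : `|im z - im c| <= r by rewrite ler_norml; apply/andP; split; lra.
lra.
Qed.

Lemma incsq_bd (c : C) r z : 0 <= r ->
  onbd (re c - r) (im c - r) (2 * r) z -> r <= nm (z - c).
Proof.
move=> r0 /andP [_ H].
have hr := re_le_nm (z - c); have hi := im_le_nm (z - c).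
rewrite reD reN in hr; rewrite imD imN in hi.
case/or4P: H => /eqP E; [apply: le_trans hr|apply: le_trans hr|apply: le_trans hi|apply: le_trans hi];
by rewrite E ler_normr; apply/orP; lra.
Qed.

Lemma csq_bound N g (c : C) r B : 0 < r ->
  (forall z, incsq c r z -> z != c -> r <= nm (z - c) -> nm (g z) <= B) ->
  nm (csq N g c r) <= 8 * r * B.
Proof.
move=> r0 H; rewrite (_ : 8 * r = 4 * (2 * r)); last by ring.
apply: sqr_bound => [|z Hz]; first by lra.
have rz := incsq_bd (ltW r0) Hz.
case/andP: Hz => Hz _; apply: H => //.
by rewrite -subr_eq0 -nm_gt0; lra.
Qed.

(** Of the nine subsquares only the middle one contains the centre; Goursat's
    lemma disposes of the others. *)
Lemma csq_shrink g (c : C) r : 0 < r ->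
  (forall z, incsq c r z -> z != c -> differentiable g z) ->
  forall d, 0 < d -> exists N0, forall N, (N0 <= N)%N ->
    nm (csq N.+1 g c r) <= nm (csq N g c (r / 3)) + d.
Proof.
move=> r0 Hg d d0.
pose a := re c; pose b := im c.
have H : forall ij : 'I_3 * 'I_3, exists N0, forall N, (N0 <= N)%N ->
    ij != (1, 1) -> nm (sqr N g (a - r + ij.1%:R * (2 * r / 3))
                       (b - r + ij.2%:R * (2 * r / 3)) (2 * r / 3)) <= d / 9.
  move=> [i j] /=; have [_|nij] := eqVneq (i, j) (1, 1); first by exists 0%N.
  have [|z||N0 HN] := @goursat R g (a - r + i%:R * (2 * r / 3))
      (b - r + j%:R * (2 * r / 3)) (2 * r / 3) _ _ (d / 9).
  - lra.
  - move=> /andP [/andP [h1 h2] /andP [h3 h4]].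
    have i2 : (i%:R : R) <= 2 by rewrite (ler_nat _ i 2) -ltnS.
    have j2 : (j%:R : R) <= 2 by rewrite (ler_nat _ j 2) -ltnS.
    have i0 : (0 : R) <= i%:R by [].
    have j0 : (0 : R) <= j%:R by [].
    apply: Hg.
      rewrite /incsq /insq -/a -/b; apply/andP; split; apply/andP; split; nra.
    apply/negP => /eqP zc; move/eqP: nij; apply.
    rewrite zc -/a -/b in h1 h2 h3 h4.
    have E (k : 'I_3) : 0 <= r - k%:R * (2 * r / 3) -> r <= k%:R * (2 * r / 3) + 2 * r / 3 -> k = 1.
      by case: k => -[|[|[|//]]] kk h h'; apply: val_inj => //=; exfalso; rewrite /= in h h'; lra.
    by congr pair; apply: E; lra.
  - lra.
  - by exists N0 => N /HN.
have /choice [M HM] := H.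
exists (\max_ij M ij) => N HN.
rewrite /csq sqr_nine pair_big /= (bigD1 (1, 1)) //=.
apply: le_trans (nmD _ _) _; apply: lerD.
  rewrite -/a -/b mul1r (_ : a - r + 2 * r / 3 = a - r / 3); last by field.
  by rewrite (_ : b - r + 2 * r / 3 = b - r / 3) 1?mulrA //; field.
have E : d = \sum_(ij : 'I_3 * 'I_3) d / 9.
  by rewrite sumr_const card_prod !card_ord -mulr_natr; field.
rewrite E [leRHS](bigD1 (1, 1)) //=.
apply: ler_wpDl; first by lra.
elim/big_rec2: _ => [|ij x y nij IH]; first by rewrite nm0.
apply: le_trans (nmD _ _) _; apply: lerD => //.
by apply: HM => //; apply: leq_trans HN; apply: (leq_bigmax ij).
Qed.

(** A singularity of order [o(1 / |z - c|)] does not contribute: shrink the square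
    until the trivial bound is small. *)
Lemma csq_punctured g (c : C) r : 0 < r ->
  (forall z, incsq c r z -> z != c -> differentiable g z) ->
  (forall e, 0 < e -> exists2 d, 0 < d &
     forall z, z != c -> nm (z - c) < d -> nm (g z) * nm (z - c) <= e) ->
  forall e, 0 < e -> exists N0, forall N, (N0 <= N)%N -> nm (csq N g c r) <= e.
Proof.
move=> r0 Hg Hc e e0.
have [|d d0 Hd] := Hc (e / 16); first by lra.
have [m Hm] : exists m, 3^-1 ^+ m < d / (2 * r) by apply: triadic_pow_small; rewrite divr_gt0 //; lra.
have {}Hm : r * 3^-1 ^+ m < d / 2.
  rewrite mulrC -ltr_pdivlMr //; apply: lt_le_trans Hm _.
  by rewrite (_ : d / 2 / r = d / (2 * r)) //; field; rewrite gt_eqF.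
suff : forall m r, 0 < r -> r * 3^-1 ^+ m < d / 2 ->
   (forall z, incsq c r z -> z != c -> differentiable g z) ->
   forall e', e / 2 < e' -> exists N0, forall N, (N0 <= N)%N -> nm (csq N g c r) <= e'.
  by move=> /(_ m r r0 Hm Hg e); apply; lra.
move=> {Hm Hg r0}{}m; elim: m => [|m IH] {}r r0.
  rewrite expr0 mulr1 => rd _ e' ee'; exists 0%N => N _.
  apply: le_trans (ltW ee'); rewrite (_ : e / 2 = 8 * r * (e / 16 / r)); last by field; rewrite gt_eqF.
  apply: csq_bound => // z zr zc rz.
  rewrite ler_pdivlMr //; apply: le_trans (Hd z zc _).
    by rewrite ler_wpM2l ?nm_ge0.
  by apply: le_lt_trans (incsq_nm zr) _; lra.
move=> rm Hg e' ee'.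
have [||z||N1 HN1] := IH (r / 3) _ _ _ ((e' + e / 2) / 2).
- lra.
- by move: rm; rewrite exprS mulrA.
- move=> /andP [h1 h2] zc; apply: Hg => //.
  by rewrite /incsq /insq; apply/andP; split; lra.
- lra.
have [|N2 HN2] := csq_shrink r0 Hg (_ : 0 < (e' - e / 2) / 2); first by lra.
exists (maxn N1 N2).+1 => -[//|N]; rewrite ltnS geq_max => /andP [n1 n2].
apply: le_trans (HN2 N n2) _; have := HN1 N n1; lra.
Qed.

(** The sums of [1 / (z - c)] tend to [2 i pi]; a lower bound that holds for every
    subdivision suffices to estimate derivatives. On each side, and
    up to its orientation, [v / (z - c)] has imaginary part at least [1]. *)
Lemma csq_inv N (c : C) r : 0 < r -> 4 <= nm (csq N (fun z => (z - c)^-1) c r).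
Proof.
move=> r0; apply: le_trans (im_le_nm _); apply: le_trans (ler_norm _).
pose g := fun z => (z - c)^-1.
have side (v q : C) (s : R) : (forall t, 0 <= t <= 1 -> 1 <= s * im (v * g (q + toC t * v))) ->
    1 <= s * im (midsum N g q v).
  move=> H; rewrite -lerN2.
  apply: (@midsum_subadd R (fun z => - (s * im z))).
  - by move=> a b; rewrite imD mulrDr opprD.
  - move=> a; rewrite (_ : (3 : C)^-1 = toC (3^-1)); last by rewrite /toC fmorphV rmorph_nat.
    by rewrite imM im_toC re_toC mulr0 add0r; ring.
  - by move=> t t01; rewrite lerN2; apply: H.
have inv (t : R) (w : C) : re w ^+ 2 + im w ^+ 2 != 0 ->
    im (w^-1) = - im w / (re w ^+ 2 + im w ^+ 2) /\ re (w^-1) = re w / (re w ^+ 2 + im w ^+ 2).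
  by case: w => x y /= _; split=> //; rewrite /im /= ?mulNr.
have key (v w : C) (s : R) : re w ^+ 2 + im w ^+ 2 <= s * (im v * re w - re v * im w) ->
    0 < re w ^+ 2 + im w ^+ 2 -> 1 <= s * im (v * w^-1).
  move=> h w0; have [//|h1 h2] := inv 0 w; first by rewrite gt_eqF.
  rewrite imM h1 h2.
  rewrite (_ : s * _ = (s * (im v * re w - re v * im w)) / (re w ^+ 2 + im w ^+ 2)); last by field; rewrite gt_eqF.
  by rewrite ler_pdivlMr // mul1r.
rewrite /csq /sqr /sqsum !(imD, imN).
have side' (q v : C) (s : R) :
   (forall t, 0 <= t <= 1 -> 
     re (q + toC t * v - c) ^+ 2 + im (q + toC t * v - c) ^+ 2 <=
       s * (im v * re (q + toC t * v - c) - re v * im (q + toC t * v - c)) /\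
     0 < re (q + toC t * v - c) ^+ 2 + im (q + toC t * v - c) ^+ 2) ->
   1 <= s * im (midsum N g q v).
  by move=> H; apply: side => t /H [h1 h2]; apply: key.
have simp := (reD, imD, reN, imN, reM, imM, re_pt, im_pt, re_toC, im_toC).
have rei : re ic = 0 by []. have imi : im ic = 1 by [].
set p := pt _ _.
have facts (t : R) : 0 <= t <= 1 ->
    [/\ 0 <= r ^+ 2 * (t * (1 - t)), 0 < r ^+ 2 & 0 <= (r * (2 * t - 1)) ^+ 2].
  move=> /andP [t0 t1]; split; rewrite ?exprn_gt0 ?sqr_ge0 //.
  by apply: mulr_ge0; [rewrite sqr_ge0|apply: mulr_ge0; rewrite ?subr_ge0].
have s1 : 1 <= 1 * im (midsum N g p (toC (2 * r))).
  apply: side' => t t01; have [f1 f2 f3] := facts t t01; rewrite /p !simp.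
  by split; lra.
have s2 : 1 <= 1 * im (midsum N g (p + toC (2 * r)) (ic * toC (2 * r))).
  apply: side' => t t01; have [f1 f2 f3] := facts t t01; rewrite /p !simp rei imi.
  by split; lra.
have s3 : 1 <= -1 * im (midsum N g (p + ic * toC (2 * r)) (toC (2 * r))).
  apply: side' => t t01; have [f1 f2 f3] := facts t t01; rewrite /p !simp rei imi.
  by split; lra.
have s4 : 1 <= -1 * im (midsum N g p (ic * toC (2 * r))).
  apply: side' => t t01; have [f1 f2 f3] := facts t t01; rewrite /p !simp rei imi.
  by split; lra.
rewrite -/g; lra.
Qed.

End CauchyEstimate.

(** * Cauchy's estimate and the mean value inequality *)

Section OneVariable.
Variable R : realType.
Local Notation C := (Cplx R).

(** The complex derivative; it is opaque for the same reason as [nm]. *)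
Lemma dz_key : {D : (C -> C) -> C -> C | forall f z, D f z = 'd f z (1 : C)}.
Proof. by exists (fun (f : C -> C) z => 'd f z (1 : C)). Qed.

Definition dz : (C -> C) -> C -> C := sval dz_key.

Lemma dz_def (f : C -> C) (z : C) : dz f z = 'd f z (1 : C).
Proof. exact: (svalP dz_key). Qed.

Lemma dz_lin (f : C -> C) (z h : C) : 'd f z h = dz f z * h :> C.
Proof. by rewrite dz_def -{1}[h]mulr1 -[h * 1]/(h *: (1 : C)) linearZ /= mulrC. Qed.

Lemma dz_expands (f : C -> C) (z : C) :
  differentiable f z -> expands f z (fun h : C => dz f z * h : C).
Proof.
move=> /diff_expands H e e0; have [d d0 Hd] := H e e0.
by exists d => // h hd; rewrite -dz_lin; apply: Hd.
Qed.

Lemma expands_dz (f : C -> C) (z a : C) : expands f z (fun h : C => a * h : C) ->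
  differentiable f z /\ dz f z = a.
Proof.
move=> H; have [|||D E] := @expands_linear_diff R C C f z (fun h => a * h) (nm a).
- by move=> k u v; rewrite mulrDr -[k *: u]/(k * u) -[k *: (a * u)]/(k * (a * u)) mulrCA.
- by move=> v; rewrite nmM.
- exact: H.
by split=> //; rewrite dz_def E /= mulr1.
Qed.

Lemma diff_inv (c z : C) : z != c -> differentiable (fun z : C => (z - c)^-1) z.
Proof.
move=> zc; apply: (@differentiableV _ _ (fun z : C => z - c)); last by rewrite subr_eq0.
by apply: differentiableB => //; exact: differentiable_cst.
Qed.

(** With [k z = (f z - f c) / (z - c) ^ 2], the function
    [g z = k z - f' c / (z - c)] has a singularity of order [o(1 / |z - c|)] at [c], so
    its sums vanish in the limit. Hence [|f' c|] times the sum of [1 / (z - c)], which is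
    at least [4], is at most the sum of [k], which is at most [8 * B / r]. *)
Lemma cauchy_square (f : C -> C) (c : C) r B : 0 < r ->
  (forall z, incsq c r z -> differentiable f z) ->
  (forall z, incsq c r z -> nm (f z - f c) <= B) ->
  nm (dz f c) <= 2 * B / r.
Proof.
move=> r0 Hf HB.
have cc : incsq c r c by rewrite /incsq /insq; apply/andP; split; lra.
pose k z := (f z - f c) * ((z - c)^-1 * (z - c)^-1).
pose g z := k z + (- dz f c) * (z - c)^-1.
have dk z : incsq c r z -> z != c -> differentiable k z.
  move=> zr zc; apply: differentiableM.
    by apply: differentiableB; [exact: Hf|exact: differentiable_cst].
  by apply: differentiableM; exact: diff_inv.
have dg z : incsq c r z -> z != c -> differentiable g z.
  move=> zr zc; apply: differentiableD; first exact: dk.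
  by apply: differentiableM; [exact: differentiable_cst|exact: diff_inv].
have Hg : forall e, 0 < e -> exists2 d, 0 < d &
     forall z, z != c -> nm (z - c) < d -> nm (g z) * nm (z - c) <= e.
  move=> e e0; have [d d0 Hd] := dz_expands (Hf c cc) e0.
  exists d => // z zc zd; have := Hd _ zd; rewrite [c + _]addrC subrK => H.
  have zc0 : z - c != 0 by rewrite subr_eq0.
  have n0 : nm (z - c) != 0 by rewrite nm_eq0.
  have E : g z = (f z - f c - dz f c * (z - c)) * ((z - c)^-1 * (z - c)^-1).
    by rewrite /g /k; field.
  rewrite E nmM nmM nmV.
  rewrite (_ : _ * nm (z - c) = nm (f z - f c - dz f c * (z - c)) / nm (z - c)); last by field.
  by rewrite ler_pdivrMr // nm_gt0.
have lim := csq_punctured r0 dg Hg.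
suff H : forall e, 0 < e -> 4 * nm (dz f c) <= 8 * B / r + e.
  rewrite -subr_ge0; case: (lerP 0 (2 * B / r - nm (dz f c))) => // h.
  have e0 : 0 < 2 * (nm (dz f c) - 2 * B / r) by lra.
  by have := H _ e0; rewrite (_ : 8 * B / r = 4 * (2 * B / r)); [lra|ring].
move=> e e0; have [N HN] := lim e e0; have {}HN := HN N (leqnn N).
have K := csq_inv N c r0.
have E : csq N g c r = csq N k c r + (- dz f c) * csq N (fun z => (z - c)^-1) c r.
  by rewrite /csq /sqr -sqsum_lin.
have Bk : nm (csq N k c r) <= 8 * B / r.
  rewrite (_ : 8 * B / r = 8 * r * (B / r ^+ 2)); last by field; rewrite gt_eqF.
  apply: csq_bound => // z zr zc rz.
  rewrite /k nmM nmM nmV -invfM -expr2.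
  have B0 : 0 <= B by apply: le_trans (HB z zr); apply: nm_ge0.
  apply: ler_pM; rewrite ?nm_ge0 ?HB // ?invr_ge0 ?sqr_ge0 //.
  by rewrite lef_pV2 ?posrE ?exprn_gt0 ?lerXn2r ?nnegrE ?nm_ge0 ?(ltW r0) // (lt_le_trans r0).
have : nm (dz f c) * nm (csq N (fun z => (z - c)^-1) c r) <= 8 * B / r + e.
  rewrite -nmM (_ : _ * _ = csq N k c r - csq N g c r); last by rewrite E; ring.
  by apply: le_trans (nmB _ _) _; apply: lerD.
apply: le_trans; rewrite mulrC; apply: ler_wpM2l => //; exact: nm_ge0.
Qed.

Definition hol_ball (f : C -> C) (c : C) (r : R) :=
  forall z, nm (z - c) < r -> differentiable f z.

Lemma cauchy_ball f c r B : 0 < r -> hol_ball f c r ->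
  (forall z, nm (z - c) < r -> nm (f z - f c) <= B) ->
  nm (dz f c) <= 6 * B / r.
Proof.
move=> r0 Hf HB.
have sub z : incsq c (r / 3) z -> nm (z - c) < r.
  by move=> /incsq_nm h; apply: le_lt_trans h _; lra.
have := @cauchy_square f c (r / 3) B.
rewrite (_ : 2 * B / (r / 3) = 6 * B / r); last by field; rewrite gt_eqF.
by apply=> [|z /sub|z /sub]; [lra|exact: Hf|exact: HB].
Qed.

Lemma ball_convex (c x y : C) r t : nm (x - c) < r -> nm (y - c) < r -> 0 <= t <= 1 ->
  nm (x + toC t * (y - x) - c) < r.
Proof.
move=> hx hy /andP [t0 t1].
have -> : x + toC t * (y - x) - c = toC (1 - t) * (x - c) + toC t * (y - c).
  have -> : toC (1 - t) = 1 - toC t by rewrite /toC rmorphB rmorph1.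
  by ring.
apply: le_lt_trans (nmD _ _) _; rewrite !nmM !nm_toC !ger0_norm //; last by lra.
have [->|t0'] := eqVneq t 0; first by rewrite mul0r subr0 mul1r addr0.
have tp : 0 < t by rewrite lt_def t0'.
have h1 : t * nm (y - c) < t * r by rewrite ltr_pM2l.
have h2 : (1 - t) * nm (x - c) <= (1 - t) * r by apply: ler_wpM2l; [lra|exact: ltW].
lra.
Qed.

(** The derivative is only known to be bounded, not continuous; triadic induction
    along the segment, a one-dimensional use of the planar principle, turns the
    pointwise first-order expansion into a global estimate. *)
Lemma mean_value_bound f c r L : hol_ball f c r ->
  (forall z, nm (z - c) < r -> nm (dz f z) <= L) ->
  forall x y, nm (x - c) < r -> nm (y - c) < r -> nm (f y - f x) <= L * nm (y - x).
Proof.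
move=> Hf HL x y xr yr.
suff H : forall e, 0 < e -> nm (f y - f x) <= (L + e) * nm (y - x).
  have [->|] := eqVneq y x; first by rewrite !subrr nm0 mulr0.
  rewrite -subr_eq0 -nm_gt0 => n0.
  case: (lerP (nm (f y - f x)) (L * nm (y - x))) => // h.
  have e0 : 0 < (nm (f y - f x) - L * nm (y - x)) / (2 * nm (y - x)).
    by rewrite divr_gt0 ?mulr_gt0 ?subr_gt0.
  have := H _ e0; rewrite mulrDl.
  rewrite (_ : _ / _ * _ = (nm (f y - f x) - L * nm (y - x)) / 2); last by field; rewrite gt_eqF.
  lra.
move=> e e0; pose v := y - x.
pose P (a b l : R) := nm (f (x + toC (a + l) * v) - f (x + toC a * v)) <= (L + e) * (l * nm v).
suff : P 0 0 1.
  rewrite /P add0r -[toC 1]/(real_complex R 1) rmorph1 -[toC 0]/(real_complex R 0) rmorph0.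
  by rewrite !mul1r mul0r addr0 (_ : x + v = y) // /v addrC subrK.
apply: (@triadic_induction R P); first exact: ltr01.
- move=> a b l l0 H.
  have := H 0 0; have := H 1 0; have := H 2%:R 0.
  rewrite /P /= mul0r mul1r addr0.
  have -> : (2%:R : R) * (l / 3) = l / 3 + l / 3 by ring.
  rewrite (_ : a + (l / 3 + l / 3) + l / 3 = a + l); last by field.
  rewrite !addrA.
  set f3 := f _; set f2 := f _; set f1 := f _; set f0 := f _ => h3 h2 h1.
  have n1 := nm_split f2 f3 f0; have n2 := nm_split f1 f2 f0.
  lra.
- move=> u w /andP [u0 u1] _.
  rewrite add0r in u1.
  have zr : nm (x + toC u * v - c) < r by apply: ball_convex => //; rewrite u0.
  have [d d0 Hd] := dz_expands (Hf _ zr) e0.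
  exists (d / (nm v + 1)); first by rewrite divr_gt0 // ltr_wpDl ?nm_ge0.
  move=> a b l l0 ld _ _ _ _ /andP [a1 a2] _; rewrite /P.
  have v0 := nm_ge0 v.
  have E s : `|s - u| <= l -> nm (f (x + toC s * v) - f (x + toC u * v)) <= (L + e) * (`|s - u| * nm v).
    move=> su; set z := x + toC u * v in zr Hd *.
    have es : x + toC s * v = z + toC (s - u) * v.
      rewrite /z; have -> : toC (s - u) = toC s - toC u by rewrite /toC rmorphB.
      by ring.
    have hs : nm (toC (s - u) * v) = `|s - u| * nm v by rewrite nmM nm_toC.
    have := Hd (toC (s - u) * v); rewrite -es hs => H.
    have {}H : nm (f (x + toC s * v) - f z - dz f z * (toC (s - u) * v)) <= e * (`|s - u| * nm v).
      apply: H; apply: le_lt_trans (_ : l * (nm v + 1) < d).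
        by apply: ler_pM => //; lra.
      by rewrite -ltr_pdivlMr // ltr_wpDl.
    have : nm (f (x + toC s * v) - f z) <= nm (f (x + toC s * v) - f z - dz f z * (toC (s - u) * v))
        + nm (dz f z * (toC (s - u) * v)).
      by apply: le_trans (nmD _ _); rewrite subrK.
    rewrite [nm (dz f z * _)]nmM hs.
    have : nm (dz f z) * (`|s - u| * nm v) <= L * (`|s - u| * nm v).
      by apply: ler_wpM2r; [apply: mulr_ge0|apply: HL].
    lra.
  have m1 : `|a - u| = u - a by rewrite distrC ger0_norm // subr_ge0.
  have m2 : `|a + l - u| = a + l - u by rewrite ger0_norm // subr_ge0.
  have h1 : nm (f (x + toC a * v) - f (x + toC u * v)) <= (L + e) * ((u - a) * nm v).
    by rewrite -m1; apply: E; rewrite m1; lra.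
  have h2 : nm (f (x + toC (a + l) * v) - f (x + toC u * v)) <= (L + e) * ((a + l - u) * nm v).
    by rewrite -m2; apply: E; rewrite m2; lra.
  have := nm_split (f (x + toC u * v)) (f (x + toC (a + l) * v)) (f (x + toC a * v)).
  rewrite [nm (f (x + toC u * v) - _)]nmBC; lra.
Qed.

End OneVariable.

(** * Second-order Taylor expansions *)

Section SecondOrder.
Variable R : realType.
Local Notation C := (Cplx R).

Lemma hol_ballS (f : C -> C) (c : C) r s : s <= r -> hol_ball f c r -> hol_ball f c s.
Proof. by move=> sr H z zs; apply: H; apply: lt_le_trans sr. Qed.

Lemma dz_comb (f g : C -> C) (c z : C) : differentiable f z -> differentiable g z ->
  differentiable (fun w => f w + c * g w) z /\
  dz (fun w => f w + c * g w) z = dz f z + c * dz g z.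
Proof.
move=> /dz_expands Hf /dz_expands Hg; apply: expands_dz => e e0.
have c1 : 0 < nm c + 1 by rewrite ltr_wpDl ?nm_ge0.
have [|d d0 Hd] := Hf (e / 2); first by lra.
have [|d' d'0 Hd'] := Hg (e / 2 / (nm c + 1)); first by rewrite !divr_gt0.
exists (Num.min d d'); first by rewrite lt_min d0.
move=> h; rewrite lt_min => /andP [/Hd h1 /Hd' h2].
have -> : f (z + h) + c * g (z + h) - (f z + c * g z) - (dz f z + c * dz g z) * h =
  (f (z + h) - f z - dz f z * h) + c * (g (z + h) - g z - dz g z * h) by ring.
apply: le_trans (nmD _ _) _; rewrite nmM.
have : nm c * nm (g (z + h) - g z - dz g z * h) <= e / 2 * nm h.
  apply: le_trans (_ : (nm c + 1) * nm (g (z + h) - g z - dz g z * h) <= _).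
    by rewrite ler_wpM2r ?nm_ge0 // lerDl.
  by move: h2; rewrite mulrAC ler_pdivlMr // mulrC.
lra.
Qed.

Lemma dz_id (z : C) : differentiable (fun w : C => w) z /\ dz (fun w : C => w) z = 1.
Proof.
apply: expands_dz => e e0; exists 1 => // h _.
rewrite mul1r [z + h]addrC addrK subrr nm0.
by apply: mulr_ge0; [exact: ltW|exact: nm_ge0].
Qed.

Lemma dz_shift (f : C -> C) (x z : C) : differentiable f (x + z) ->
  differentiable (fun w => f (x + w)) z /\ dz (fun w => f (x + w)) z = dz f (x + z).
Proof.
move=> /dz_expands H; apply: expands_dz => e e0.
by have [d d0 Hd] := H e e0; exists d => // h hd; rewrite addrA; apply: Hd.
Qed.

Lemma hol_bounded (f : C -> C) p r : 0 < r -> hol_ball f p r ->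
  exists s B : R, [/\ 0 < s, s <= r, 0 < B & forall z, nm (z - p) < s -> nm (f z) <= B].
Proof.
move=> r0 Hf; have dp : differentiable f p by apply: Hf; rewrite subrr nm0.
have [d d0 Hd] := dz_expands dp ltr01.
exists (Num.min d r), (nm (f p) + (nm (dz f p) + 1) * d + 1); split.
- by rewrite lt_min d0.
- by rewrite ge_min lexx orbT.
- have := mulr_ge0 (addr_ge0 (nm_ge0 (dz f p)) ler01) (ltW d0); have := nm_ge0 (f p); lra.
move=> z; rewrite lt_min => /andP [zd _].
have := Hd _ zd; rewrite [p + _]addrC subrK mul1r => H.
have E : f z = (f z - f p - dz f p * (z - p)) + dz f p * (z - p) + f p by ring.
rewrite E; apply: le_trans (nmD _ _) _.
have h := nmD (f z - f p - dz f p * (z - p)) (dz f p * (z - p)).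
rewrite [nm (dz f p * _)]nmM in h.
have : nm (dz f p) * nm (z - p) <= nm (dz f p) * d.
  by apply: ler_wpM2l; [exact: nm_ge0|exact: ltW].
lra.
Qed.

(** Cauchy's estimate at [0] for [w |-> f (x + w) - f (y + w)], which the mean
    value inequality bounds by a multiple of [|x - y|]. *)
Lemma dz_lipschitz (f : C -> C) p r B : 0 < r -> hol_ball f p r ->
  (forall z, nm (z - p) < r -> nm (f z) <= B) ->
  exists2 L : R, 0 <= L & forall x y, nm (x - p) < r / 4 -> nm (y - p) < r / 4 ->
     nm (dz f x - dz f y) <= L * nm (x - y).
Proof.
move=> r0 Hf HB.
have B0 : 0 <= B by apply: le_trans (HB p _); rewrite ?nm_ge0 // subrr nm0.
have near (z w : C) (s t : R) : nm (z - p) < s -> nm (w - z) < t -> s + t <= r -> nm (w - p) < r.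
  by move=> h1 h2; have := nm_split z w p; lra.
pose L1 := 24 * B / r.
have HL1 z : nm (z - p) < r / 2 -> nm (dz f z) <= L1.
  move=> zr; have := @cauchy_ball R f z (r / 2) (2 * B).
  rewrite (_ : 6 * (2 * B) / (r / 2) = L1); last by rewrite /L1; field; rewrite gt_eqF.
  apply; first lra.
    by move=> w wz; apply: Hf; apply: near zr wz _; lra.
  move=> w wz; apply: le_trans (nmB _ _) _.
  have := HB w (near _ _ _ _ zr wz (ltac:(lra))).
  have : nm (f z) <= B by apply: HB; lra.
  lra.
have L10 : 0 <= L1 by apply: divr_ge0; [exact: mulr_ge0|exact: ltW].
move: L1 HL1 L10 => L1 HL1 L10.
exists (6 * (2 * L1) / (r / 4)); first by apply: divr_ge0; lra.
move=> x y xr yr.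
pose k w := f (x + w) + (-1) * f (y + w).
have dk w : nm w < r / 4 -> differentiable k w /\ dz k w = dz f (x + w) - dz f (y + w).
  move=> wr.
  have [d1 e1] : differentiable (fun w => f (x + w)) w /\ dz (fun w => f (x + w)) w = dz f (x + w).
    by apply: dz_shift; apply: Hf; apply: near xr _ _; [rewrite addrC addKr; exact: wr|lra].
  have [d2 e2] : differentiable (fun w => f (y + w)) w /\ dz (fun w => f (y + w)) w = dz f (y + w).
    by apply: dz_shift; apply: Hf; apply: near yr _ _; [rewrite addrC addKr; exact: wr|lra].
  by have [d e] := dz_comb (-1) d1 d2; split=> //; rewrite e e1 e2 mulN1r.
have Bk w : nm w < r / 4 -> nm (k w) <= L1 * nm (x - y).
  move=> wr; rewrite /k mulN1r (_ : x - y = x + w - (y + w)); last by ring.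
  apply: (@mean_value_bound R f p (r / 2) L1) => //.
  - by apply: hol_ballS Hf; lra.
  - by have := nm_split y (y + w) p; rewrite [y + w - y]addrC addKr; lra.
  - by have := nm_split x (x + w) p; rewrite [x + w - x]addrC addKr; lra.
have [_ e0] : differentiable k 0 /\ dz k 0 = dz f (x + 0) - dz f (y + 0).
  by apply: dk; rewrite nm0; lra.
rewrite !addr0 in e0; rewrite -e0.
have := @cauchy_ball R k 0 (r / 4) (2 * (L1 * nm (x - y))).
rewrite (_ : 6 * (2 * (L1 * nm (x - y))) / (r / 4) = 6 * (2 * L1) / (r / 4) * nm (x - y)); last by field; rewrite gt_eqF.
apply; first lra.
  by move=> z; rewrite subr0 => /dk [].
move=> z; rewrite subr0 => zr; apply: le_trans (nmB _ _) _.
have := Bk z zr; have := Bk 0; rewrite nm0 => /(_ (ltac:(lra))); lra.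
Qed.

(** Uniformity in the base point is what makes difference quotients of [f]
    converge to [f'] uniformly. *)
Lemma taylor1 (f : C -> C) p r L : 0 < r -> hol_ball f p r -> 0 <= L ->
  (forall x y, nm (x - p) < r -> nm (y - p) < r -> nm (dz f x - dz f y) <= L * nm (x - y)) ->
  forall z v, nm (z - p) < r / 2 -> nm v < r / 4 ->
    nm (f (z + v) - f z - dz f z * v) <= 2 * L * nm v ^+ 2.
Proof.
move=> r0 Hf L0 HL z v zr vr.
have [->|] := eqVneq v 0; first by rewrite addr0 mulr0 !subrr nm0 expr0n mulr0.
rewrite -nm_gt0 => v0.
have near w : nm w < 2 * nm v -> nm (z + w - p) < r.
  by have := nm_split z (z + w) p; rewrite [z + w - z]addrC addKr; lra.
pose k w := f (z + w) + (- dz f z) * w.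
have dk w : nm w < 2 * nm v -> differentiable k w /\ dz k w = dz f (z + w) - dz f z.
  move=> wr; have [d1 e1] := dz_shift (Hf _ (near w wr)).
  have [d2 e2] := dz_id w.
  by have [d e] := dz_comb (- dz f z) d1 d2; split=> //; rewrite e e1 e2 mulr1.
have := @mean_value_bound R k 0 (2 * nm v) (L * (2 * nm v)).
have -> : f (z + v) - f z - dz f z * v = k v - k 0 by rewrite /k mulr0 !addr0; ring.
move=> H; have := H _ _ 0 v; rewrite !subr0 nm0.
rewrite (_ : 2 * L * nm v ^+ 2 = L * (2 * nm v) * nm v); last by ring.
apply; [by move=> w; rewrite subr0 => /dk [] | | lra | lra].
move=> w; rewrite subr0 => wr; have [_ ->] := dk w wr.
apply: le_trans (HL _ _ (near w wr) _) _; first by lra.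
by rewrite [z + w - z]addrC addKr; apply: ler_wpM2l => //; exact: ltW.
Qed.

(** The derivative is differentiable: the difference quotients [q v] of [f]
    converge uniformly to [f'] with rate [|v|], so by Cauchy's estimate their
    derivatives [D v] at [p] form a Cauchy family, whose limit is the second
    derivative [A]. *)
Lemma dz_expands2 (f : C -> C) p r : 0 < r -> hol_ball f p r ->
  exists (A : C) (K d : R), [/\ 0 < d, 0 <= K & forall v, nm v < d ->
    nm (dz f (p + v) - dz f p - A * v) <= K * nm v ^+ 2].
Proof.
move=> r0 Hf; have [s [B [s0 sr B0 HB]]] := hol_bounded r0 Hf.
have {}Hf := hol_ballS sr Hf.
have [L L0 HL] := dz_lipschitz s0 Hf HB.
have q0 : 0 < s / 4 by lra.
have Hq : hol_ball f p (s / 4) by apply: hol_ballS Hf; lra.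
have T := taylor1 q0 Hq L0 HL.
pose d := s / 16.
pose q v z := v^-1 * (f (v + z) + (-1) * f z).
have near v z : nm v < d -> nm (z - p) < s / 8 -> nm (v + z - p) < s / 4.
  by rewrite -[v + z - p]addrA; have := nmD v (z - p); rewrite /d; lra.
have dq v z : nm v < d -> nm (z - p) < s / 8 ->
   differentiable (q v) z /\ dz (q v) z = v^-1 * (dz f (v + z) - dz f z).
  move=> vd zs; have [d1 e1] := dz_shift (Hq _ (near v z vd zs)).
  have [|d2 e2] := dz_comb (-1) d1 (_ : differentiable f z); first by apply: Hf; lra.
  have c0 : differentiable (fun _ : C => (0 : C)) z by exact: differentiable_cst.
  have [d3 e3] := dz_comb v^-1 c0 d2.
  have Eq : q v = fun w => 0 + v^-1 * (f (v + w) + -1 * f w).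
    by apply: funext => w; rewrite add0r.
  by rewrite Eq; split=> //; rewrite e3 e2 e1 mulN1r dz_def diff_cst add0r.
have qf v z : v != 0 -> nm v < d -> nm (z - p) < s / 8 -> nm (q v z - dz f z) <= 2 * L * nm v.
  move=> v0 vd zs; have := T z v; rewrite /d in vd * => /(_ (ltac:(lra)) (ltac:(lra))).
  have n0 : nm v != 0 by rewrite nm_eq0.
  have -> : q v z - dz f z = v^-1 * (f (z + v) - f z - dz f z * v).
    by rewrite /q [v + z]addrC; field.
  rewrite nmM nmV => h; rewrite mulrC ler_pdivrMr ?nm_gt0 //.
  by apply: le_trans h _; rewrite expr2 mulrA.
pose K := 6 * (4 * L) / (s / 8).
have K0 : 0 <= K by apply: divr_ge0; lra.
pose D v := v^-1 * (dz f (v + p) - dz f p).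
have DD v w : v != 0 -> w != 0 -> nm v < d -> nm w < d -> nm (D v - D w) <= K * (nm v + nm w).
  move=> v0 w0 vd wd.
  have dk z : nm (z - p) < s / 8 -> differentiable (fun x => q v x + (-1) * q w x) z /\
     dz (fun x => q v x + (-1) * q w x) z = v^-1 * (dz f (v + z) - dz f z) - w^-1 * (dz f (w + z) - dz f z).
    move=> zs; have [d1 e1] := dq v z vd zs; have [d2 e2] := dq w z wd zs.
    by have [d3 e3] := dz_comb (-1) d1 d2; split=> //; rewrite e3 e1 e2 mulN1r.
  have pp : nm (p - p) < s / 8 by rewrite subrr nm0; lra.
  have [_ <-] := dk p pp.
  have -> : K * (nm v + nm w) = 6 * (4 * L * (nm v + nm w)) / (s / 8).
    by rewrite /K; field; rewrite gt_eqF.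
  have bk z : nm (z - p) < s / 8 -> nm (q v z + (-1) * q w z) <= 2 * L * (nm v + nm w).
    move=> zs; have := qf v z v0 vd zs; have := qf w z w0 wd zs.
    have := nm_split (dz f z) (q v z) (q w z); rewrite mulN1r [nm (dz f z - _)]nmBC; lra.
  apply: cauchy_ball; first lra.
    by move=> z /dk [].
  move=> z zs; apply: le_trans (nmB _ _) _; have := bk z zs; have := bk p pp; lra.
pose vv m : C := toC (d / 2 * 3^-1 ^+ m).
have nvv m : nm (vv m) = d / 2 * 3^-1 ^+ m.
  by rewrite nm_toC ger0_norm // mulr_ge0 ?exprn_ge0 // /d; lra.
have vvd m : 0 < nm (vv m) < d.
  rewrite nvv mulr_gt0 ?exprn_gt0 /d; [|lra|by []|by []].
  have : (3^-1 : R) ^+ m <= 1 by rewrite exprn_ile1 //; lra.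
  have : 0 < s / 16 / 2 by lra.
  move=> h1 h2; apply: le_lt_trans (_ : s / 16 / 2 * 1 < _); last lra.
  by rewrite ler_pM2l.
have [|A HA] := @nested_complete_C R (fun m => D (vv m)) (fun m => 2 * K * nm (vv m)).
  move=> m n mn; have /andP [m0 md] := vvd m; have /andP [n0 nd] := vvd n.
  rewrite nm_gt0 in m0; rewrite nm_gt0 in n0.
  apply: le_trans (DD _ _ n0 m0 nd md) _.
  have : nm (vv n) <= nm (vv m).
    rewrite !nvv ler_wpM2l //; first by rewrite /d; lra.
    by rewrite ler_wiXn2l //; lra.
  move=> h; rewrite (_ : 2 * K * nm (vv m) = K * (2 * nm (vv m))); last by ring.
  by apply: ler_wpM2l => //; lra.
exists A, (6 * K), d; split=> //; first by rewrite /d; lra.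
  by rewrite mulr_ge0.
move=> v vd; have [->|v0] := eqVneq v 0.
  by rewrite addr0 mulr0 !subrr nm0 expr0n mulr0.
have vp : 0 < nm v by rewrite nm_gt0.
have -> : dz f (p + v) - dz f p - A * v = (D v - A) * v by rewrite /D [v + p]addrC; field.
rewrite nmM expr2 mulrA; apply: ler_wpM2r; first exact: ltW.
have [m Hm] : exists m, nm (vv m) <= nm v.
  have [m Hm] : exists m, 3^-1 ^+ m < nm v / (d / 2).
    by apply: triadic_pow_small; rewrite divr_gt0 // /d; lra.
  exists m; rewrite nvv mulrC -ler_pdivlMr; first exact: ltW.
  by rewrite /d; lra.
have /andP [m0 md] := vvd m; rewrite nm_gt0 in m0.
have h1 := DD v (vv m) v0 m0 vd md; have h2 := HA m.
have := nm_split (D (vv m)) (D v) A.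
have : K * nm (vv m) <= K * nm v by apply: ler_wpM2l.
lra.
Qed.

(** The mean value inequality applied to
    [f (p + w) - f' p * w - (A / 2) * w ^ 2], whose derivative is [O(|w| ^ 2)]. *)
Lemma taylor2 (f : C -> C) p r : 0 < r -> hol_ball f p r ->
  exists (A : C) (K d : R), [/\ 0 < d, 0 <= K & forall h, nm h < d ->
    nm (f (p + h) - f p - dz f p * h - A * h ^+ 2) <= K * nm h ^+ 3].
Proof.
move=> r0 Hf; have [A [K [d [d0 K0 H]]]] := dz_expands2 r0 Hf.
pose s := Num.min (d / 2) (r / 2).
have s0 : 0 < s by rewrite lt_min; apply/andP; split; lra.
have [sd sr] : s <= d / 2 /\ s <= r / 2 by rewrite !ge_min !lexx orbT.
exists (A / 2), (4 * K), s; split=> //; first by rewrite mulr_ge0.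
move=> h hs; have [->|] := eqVneq h 0.
  by rewrite addr0 subrr mulr0 expr0n /= mulr0 !subr0 nm0 expr0n /= mulr0.
rewrite -nm_gt0 => h0.
pose k w := (f (p + w) + (- dz f p) * w) + (- (A / 2)) * (w * w).
have dk w : nm w < 2 * nm h -> differentiable k w /\ dz k w = dz f (p + w) - dz f p - A * w.
  move=> wh; have [|d1 e1] := dz_shift (_ : differentiable f (p + w)).
    by apply: Hf; rewrite [p + w]addrC addrK; lra.
  have [d2 e2] := dz_id w.
  have [d3 e3] := dz_comb (- dz f p) d1 d2.
  have [d4 e4] : differentiable (fun w : C => w * w) w /\ dz (fun w : C => w * w) w = 2 * w.
    apply: expands_dz => e e0; exists e => // x xe.
    rewrite (_ : _ - _ - _ = x * x); last by ring.
    by rewrite nmM ler_wpM2r ?nm_ge0 // ltW.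
  have [d5 e5] := dz_comb (- (A / 2)) d3 d4.
  by split=> //; rewrite e5 e3 e4 e1 e2; field.
have -> : f (p + h) - f p - dz f p * h - A / 2 * h ^+ 2 = k h - k 0.
  by rewrite /k mulr0 !addr0 mul0r mulr0; ring.
have := @mean_value_bound R k 0 (2 * nm h) (K * (2 * nm h) ^+ 2).
move=> M; have := M _ _ 0 h; rewrite !subr0 nm0.
rewrite (_ : 4 * K * nm h ^+ 3 = K * (2 * nm h) ^+ 2 * nm h); last by ring.
apply; [by move=> w; rewrite subr0 => /dk [] | | lra | lra].
move=> w; rewrite subr0 => wr; have [_ ->] := dk w wr.
apply: le_trans (H w _) _; first lra.
apply: ler_wpM2l => //; rewrite lerXn2r ?nnegrE ?nm_ge0 ?ltW //; lra.
Qed.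

End SecondOrder.

(** * Identity theorem, polarization, antiholomorphic roots *)

Section Polarization.
Variable R : realType.
Local Notation C := (Cplx R).

Lemma conj_toC (x : R) : (toC x)^* = toC x.
Proof. by apply: conj_Creal; apply/complex_realP; exists x. Qed.

Lemma conj_ic : (ic R)^* = - ic R.
Proof. by apply/eqP; rewrite /ic eq_complex /= oppr0 !eqxx. Qed.

Lemma line_diff (V : normedModType C) (L : V -> C) (p v : V) (z : C) :
  differentiable L (p + z *: v) ->
  differentiable (fun w : C => L (p + w *: v)) z /\
  dz (fun w : C => L (p + w *: v)) z = 'd L (p + z *: v) v.
Proof.
move=> /diff_expands H; apply: expands_dz => e e0.
have v1 : 0 < nm v + 1 by have := nm_ge0 v; lra.
have [|d d0 Hd] := H (e / (nm v + 1)); first by rewrite divr_gt0.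
exists (d / (nm v + 1)); first by rewrite divr_gt0.
move=> h; rewrite ltr_pdivlMr // => hd.
have hv : nm (h *: v) <= nm h * (nm v + 1) by rewrite nmZ ler_wpM2l ?nm_ge0 // lerDl.
have := Hd (h *: v); rewrite linearZ /= scalerDl addrA -[h *: 'd L _ v]/(h * 'd L _ v).
rewrite [h * 'd L _ v]mulrC => /(_ (le_lt_trans hv hd)) H1.
apply: le_trans H1 _; rewrite mulrAC ler_pdivrMr //.
by rewrite -mulrA ler_wpM2l // ltW.
Qed.

(** A function that vanishes on the real axis has zero value and derivative at
    [0], so its quotient by [z] is again holomorphic, vanishes on the real axis,
    and is bounded: by the mean value inequality near [0], trivially elsewhere. *)
Lemma real_zero_div (g : C -> C) r B : 0 < r -> hol_ball g 0 r ->
  (forall z, nm z < r -> nm (g z) <= B) ->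
  (forall x : R, `|x| < r -> g (toC x) = 0) ->
  [/\ hol_ball (fun z => g z * z^-1) 0 r,
      forall z, nm z < r -> nm (g z * z^-1) <= 16 * B / r &
      forall x : R, `|x| < r -> g (toC x) * (toC x)^-1 = 0].
Proof.
move=> r0 Hg HB Hx.
have g0 : g 0 = 0 by rewrite -[0]/(toC 0) Hx // normr0.
have [A [K [d [d0 K0 HT]]]] := taylor2 r0 Hg.
have dg0 : dz g 0 = 0.
  apply/eqP; rewrite -nm_eq0; apply/eqP/le_anti; rewrite nm_ge0 andbT.
  rewrite leNgt; apply/negP => n0.
  pose M := nm A + K + 1.
  have M0 : 0 < M by have := nm_ge0 A; rewrite /M; lra.
  pose x := Num.min (Num.min (d / 2) (r / 2)) (Num.min 1 (nm (dz g 0) / (2 * M))).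
  have x0 : 0 < x by rewrite !lt_min !divr_gt0 ?mulr_gt0 //; lra.
  have [[xd xr] [x1 xM]] : (x <= d / 2 /\ x <= r / 2) /\ (x <= 1 /\ x <= nm (dz g 0) / (2 * M)).
    by rewrite /x !ge_min !lexx !orbT.
  have := HT (toC x); rewrite add0r g0 Hx; last by rewrite gtr0_norm //; lra.
  rewrite nm_toC gtr0_norm //.
  move=> /(_ (ltac:(lra))) h.
  have E : dz g 0 * toC x = - (0 - 0 - dz g 0 * toC x - A * toC x ^+ 2) - A * toC x ^+ 2 by ring.
  have : nm (dz g 0) * x <= K * x ^+ 3 + nm A * x ^+ 2.
    rewrite -[X in _ * X <= _](ger0_norm (ltW x0)) -nm_toC -nmM E.
    apply: le_trans (nmB _ _) _; rewrite nmN nmM nmX nm_toC gtr0_norm //.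
    by apply: lerD.
  have : K * x ^+ 3 + nm A * x ^+ 2 <= (M * x) * x.
    have q3 : x ^+ 3 <= x ^+ 2 by rewrite exprS ler_piMl ?sqr_ge0.
    have := ler_wpM2l K0 q3.
    have := sqr_ge0 x.
    have -> : M * x * x = nm A * x ^+ 2 + K * x ^+ 2 + x ^+ 2 by rewrite /M; ring.
    lra.
  move=> h1 h2; have {h1 h2} := le_trans h2 h1.
  rewrite ler_pM2r // => h3.
  have : M * x <= nm (dz g 0) / 2.
    rewrite -ler_pdivlMl // (_ : M^-1 * _ = nm (dz g 0) / (2 * M)) //.
    by field; rewrite gt_eqF.
  lra.
split.
- move=> z; rewrite subr0 => zr; have [->|z0] := eqVneq z 0.
    suff [] : differentiable (fun z => g z * z^-1) 0 /\ dz (fun z => g z * z^-1) 0 = A by [].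
    apply: expands_dz => e e0.
    exists (Num.min d (e / (K + 1))).
      by rewrite lt_min d0 divr_gt0 //; lra.
    move=> h; rewrite lt_min => /andP [hd he].
    rewrite g0 mul0r subr0 add0r.
    have [->|h0] := eqVneq h 0; first by rewrite g0 mul0r mulr0 subrr nm0 mulr0.
    have := HT h hd; rewrite add0r g0 dg0 mul0r !subr0 => H.
    have -> : g h / h - A * h = (g h - A * h ^+ 2) / h by field.
    rewrite nmM nmV ler_pdivrMr ?nm_gt0 //; apply: le_trans H _.
    rewrite (_ : K * nm h ^+ 3 = (K * nm h) * nm h * nm h); last by ring.
    do 2! (apply: ler_wpM2r; first exact: nm_ge0).
    move: he; rewrite ltr_pdivlMr; last by lra.
    by have := nm_ge0 h; lra.
  apply: differentiableM; first by apply: Hg; rewrite subr0.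
  have := diff_inv z0; congr (differentiable _ _).
  by apply: funext => w; rewrite subr0.
- move=> z zr; rewrite nmM nmV.
  have B0 : 0 <= B by apply: le_trans (HB z zr); exact: nm_ge0.
  have [->|z0] := eqVneq z 0.
    by rewrite g0 nm0 mul0r divr_ge0 ?mulr_ge0 // ltW.
  rewrite ler_pdivrMr ?nm_gt0 //.
  case: (lerP (r / 4) (nm z)) => hz.
    apply: le_trans (HB z zr) _.
    have : 16 * B / r * (r / 4) <= 16 * B / r * nm z.
      by apply: ler_wpM2l => //; apply: divr_ge0; lra.
    rewrite (_ : 16 * B / r * (r / 4) = 4 * B); last by field; rewrite gt_eqF.
    lra.
  have := @mean_value_bound R g 0 (r / 4) (16 * B / r).
  move=> H; have := H _ _ 0 z; rewrite !subr0 g0 subr0 nm0.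
  apply; [by apply: hol_ballS Hg; lra| |lra|by []].
  move=> w; rewrite subr0 => wr.
  rewrite (_ : 16 * B / r = 6 * (2 * B) / (3 * r / 4)); last by field; rewrite gt_eqF.
  have near y : nm (y - w) < 3 * r / 4 -> nm y < r.
    by have := nmD (y - w) w; rewrite subrK; lra.
  apply: cauchy_ball; first lra.
    by move=> y /near yr; apply: Hg; rewrite subr0.
  move=> y /near yr; apply: le_trans (nmB _ _) _; have := HB y yr; have := HB w; lra.
- by move=> x xr; rewrite Hx // mul0r.
Qed.

(** Dividing [k] times by [z] bounds [g z] by [B * (16 / r * |z|) ^ k]; the radius
    [r / 48] makes the ratio at most [1 / 3]. *)
Lemma identity_theorem (g : C -> C) r B : 0 < r -> hol_ball g 0 r ->
  (forall z, nm z < r -> nm (g z) <= B) ->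
  (forall x : R, `|x| < r -> g (toC x) = 0) ->
  forall z, nm z < r / 48 -> g z = 0.
Proof.
move=> r0 Hg HB Hx z zr.
have zr' : nm z < r by lra.
have H : forall k (g : C -> C) B, hol_ball g 0 r ->
  (forall z, nm z < r -> nm (g z) <= B) ->
  (forall x : R, `|x| < r -> g (toC x) = 0) -> nm (g z) <= B * (16 / r * nm z) ^+ k.
  elim=> [|k IH] {}g {}B {}Hg {}HB {}Hx; first by rewrite expr0 mulr1; exact: HB.
  have [h1 h2 h3] := real_zero_div r0 Hg HB Hx.
  have := IH _ _ h1 h2 h3.
  have [->|z0] := eqVneq z 0.
    have -> : g 0 = 0 by rewrite -[0]/(toC 0) Hx // normr0.
    by rewrite nm0 mulr0 exprS mul0r mulr0.
  rewrite nmM nmV ler_pdivrMr ?nm_gt0 // => /le_trans; apply.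
  by rewrite exprS le_eqVlt; apply/orP; left; apply/eqP; ring.
apply/eqP; rewrite -nm_eq0; apply/eqP/le_anti; rewrite nm_ge0 andbT.
have B0 : 0 <= B by apply: le_trans (HB z zr'); exact: nm_ge0.
rewrite leNgt; apply/negP => gz.
have [k Hk] : exists k, 3^-1 ^+ k < nm (g z) / (B + 1).
  by apply: triadic_pow_small; rewrite divr_gt0 //; lra.
have := H k g B Hg HB Hx.
have q : 16 / r * nm z <= 3^-1.
  by rewrite mulrAC ler_pdivrMr //; lra.
have q0 : 0 <= 16 / r * nm z by rewrite mulr_ge0 ?nm_ge0 // divr_ge0 // ltW.
have : (16 / r * nm z) ^+ k <= 3^-1 ^+ k by rewrite lerXn2r ?nnegrE //; lra.
move: Hk; rewrite ltr_pdivlMr; last by lra.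
move=> h1 h2 h3.
have p0 : 0 <= (3^-1 : R) ^+ k by rewrite exprn_ge0 //; lra.
have := ler_wpM2l B0 h2.
lra.
Qed.

(** In the coordinates [x = (s + t) / 2] and [y = (s - t) / 2i], the totally real
    plane [t = conj s] is the locus where [x] and [y] are real; the identity
    theorem makes first [x], then [y] complex. *)
Lemma polarization (L : C * C -> C) r B : 0 < r ->
  (forall p : C * C, nm p.1 < r -> nm p.2 < r -> differentiable L p /\ nm (L p) <= B) ->
  (forall s : C, nm s < r -> L (s, s^*) = 0) ->
  forall s t : C, nm s < r / 96 -> nm t < r / 96 -> L (s, t) = 0.
Proof.
move=> r0 HL H0.
have pair_eq (a b c d z : C) : ((a, b) + z *: (c, d) : (C * C)%type) = (a + z * c, b + z * d) by [].
have nmic (z : C) : nm (z * ic R) = nm z by rewrite nmM nm_ic mulr1.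
have key1 (x : C) (y : R) : nm x < r / 96 -> `|y| < r / 2 ->
    L (x + toC y * ic R, x - toC y * ic R) = 0.
  move=> xr yr.
  have nyi : nm (toC y * ic R) < r / 2 by rewrite nmic nm_toC.
  pose g (w : C) := L ((toC y * ic R, - (toC y * ic R)) + w *: (1, 1)).
  have b (w : C) : nm w < r / 2 ->
      differentiable L ((toC y * ic R, - (toC y * ic R)) + w *: (1, 1)) /\ nm (g w) <= B.
    move=> wr; rewrite /g pair_eq mulr1; apply: HL => /=.
      by have := nmD (toC y * ic R) w; lra.
    by have := nmD (- (toC y * ic R)) w; rewrite nmN; lra.
  have := @identity_theorem g (r / 2) B.
  rewrite (_ : r / 2 / 48 = r / 96); last by field.
  move=> H; have := H _ _ _ _ x xr; rewrite /g pair_eq mulr1 addrC [- _ + _]addrC; apply.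
  - lra.
  - by move=> w; rewrite subr0 => /b [D _]; have [] := line_diff D.
  - by move=> w /b [].
  - move=> a ar; rewrite pair_eq mulr1.
    have -> : - (toC y * ic R) + toC a = (toC y * ic R + toC a)^*.
      by rewrite rmorphD rmorphM /= !conj_toC conj_ic mulrN.
    apply: H0; apply: le_lt_trans (nmD _ _) _; rewrite nm_toC; lra.
move=> s t sr tr.
pose x := (s + t) / 2; pose y := - ic R * (s - t) / 2.
have n2 : nm (2%:R^-1 : C) = 2^-1.
  by rewrite nmV nm_nat.
have xr : nm x < r / 96 by rewrite /x nmM n2; have := nmD s t; lra.
have yr : nm y < r / 96.
  by rewrite /y !nmM n2 nmN nm_ic mul1r; have := nmB s t; lra.
have es : s = x + y * ic R.
  have -> : y * ic R = - (ic R * ic R) * (s - t) / 2 by rewrite /y; ring.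
  by rewrite ic2 /x; field.
have et : t = x - y * ic R.
  have -> : y * ic R = - (ic R * ic R) * (s - t) / 2 by rewrite /y; ring.
  by rewrite ic2 /x; field.
pose g (w : C) := L ((x, x) + w *: (ic R, - ic R)).
have b (w : C) : nm w < r / 2 -> differentiable L ((x, x) + w *: (ic R, - ic R)) /\ nm (g w) <= B.
  move=> wr; rewrite /g pair_eq; apply: HL => /=; apply: le_lt_trans (nmD _ _) _;
  by rewrite ?mulrN ?nmN nmic; lra.
have := @identity_theorem g (r / 2) B.
rewrite (_ : r / 2 / 48 = r / 96); last by field.
move=> H; have := H _ _ _ _ y yr; rewrite /g pair_eq mulrN -es -et; apply.
- lra.
- by move=> w; rewrite subr0 => /b [D _]; have [] := line_diff D.
- by move=> w /b [].
- by move=> a ar; rewrite pair_eq mulrN; exact: key1.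
Qed.

Lemma expandsD (u f : C -> C) t (L1 L2 : C -> C) : expands u t L1 -> expands f t L2 ->
  expands (fun z => u z + f z) t (fun h => L1 h + L2 h).
Proof.
move=> H1 H2 e e0.
have [|d d0 Hd] := H1 (e / 2); first by lra.
have [|d' d'0 Hd'] := H2 (e / 2); first by lra.
exists (Num.min d d'); first by rewrite lt_min d0.
move=> h; rewrite lt_min => /andP [/Hd h1 /Hd' h2].
rewrite (_ : _ - _ = (u (t + h) - u t - L1 h) + (f (t + h) - f t - L2 h)); last by ring.
by apply: le_trans (nmD _ _) _; lra.
Qed.

Lemma expandsM (u f : C -> C) t (L1 L2 : C -> C) K : 0 <= K ->
  (forall h, nm (L1 h) <= K * nm h) -> (forall h, nm (L2 h) <= K * nm h) ->
  expands u t L1 -> expands f t L2 ->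
  expands (fun z => u z * f z) t (fun h => u t * L2 h + L1 h * f t).
Proof.
move=> K0 B1 B2 H1 H2 e e0.
pose M := nm (u t) + nm (f t) + (K + 1) ^+ 2 + 1.
have M0 : 0 < M by have := nm_ge0 (u t); have := nm_ge0 (f t); have := sqr_ge0 (K + 1); rewrite /M; lra.
pose e' := Num.min 1 (e / (2 * M)).
have e'0 : 0 < e' by rewrite lt_min ltr01 divr_gt0 // mulr_gt0.
have [e'1 e'M] : e' <= 1 /\ e' <= e / (2 * M) by rewrite !ge_min !lexx orbT.
clearbody e'.
have [d d0 Hd] := H1 e' e'0.
have [d' d'0 Hd'] := H2 e' e'0.
exists (Num.min (Num.min d d') e'); first by rewrite !lt_min d0 d'0 e'0.
move=> h; rewrite !lt_min => /andP [/andP [/Hd h1 /Hd' h2] h3].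
set a := u (t + h) - u t - L1 h in h1; set b := f (t + h) - f t - L2 h in h2.
rewrite (_ : _ - _ = u t * b + a * f t + (a + L1 h) * (b + L2 h)); last by rewrite /a /b; ring.
have n0 := nm_ge0 h.
have bd (c l : C) : nm c <= e' * nm h -> nm l <= K * nm h -> nm (c + l) <= (K + 1) * nm h.
  move=> hc hl; apply: le_trans (nmD _ _) _.
  have : e' * nm h <= 1 * nm h by apply: ler_wpM2r.
  lra.
have p1 : nm ((a + L1 h) * (b + L2 h)) <= (K + 1) ^+ 2 * e' * nm h.
  rewrite nmM; apply: le_trans (_ : ((K + 1) * nm h) * ((K + 1) * nm h) <= _).
    by apply: ler_pM; rewrite ?nm_ge0 // bd.
  rewrite (_ : _ * _ * (_ * _) = (K + 1) ^+ 2 * nm h * nm h); last by ring.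
  apply: ler_wpM2r => //; apply: ler_wpM2l; [exact: sqr_ge0|exact: ltW].
have p2 : nm (u t * b) <= nm (u t) * (e' * nm h) by rewrite nmM ler_wpM2l ?nm_ge0.
have p3 : nm (a * f t) <= nm (f t) * (e' * nm h) by rewrite nmM mulrC ler_wpM2l ?nm_ge0.
have q1 := nmD (u t * b + a * f t) ((a + L1 h) * (b + L2 h)).
have q2 := nmD (u t * b) (a * f t).
have : M * (e' * nm h) <= e * nm h.
  rewrite mulrA; apply: ler_wpM2r => //.
  have : M * e' <= M * (e / (2 * M)) by rewrite ler_pM2l.
  rewrite (_ : M * (e / (2 * M)) = e / 2); last by field; rewrite gt_eqF.
  lra.
have : 0 <= e' * nm h by rewrite mulr_ge0 // ltW.
rewrite /M; lra.
Qed.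

Lemma expands_conj (f : C -> C) t c : expands f t (fun h : C => c * h : C) ->
  expands (fun z => (f z)^*) t (fun h : C => c^* * h^* : C).
Proof.
move=> H e e0; have [d d0 Hd] := H e e0; exists d => // h /Hd.
by rewrite -[X in X <= _ -> _]nm_conj !rmorphB rmorphM.
Qed.

(** A function that vanishes near [t] has zero derivative, and the real-linear
    map [h |-> a * conj h + b * h] determines [a]: compare real and imaginary
    directions. *)
Lemma antilinear_zero (a b : C) (g : C -> C) (t : C) (d : R) : 0 < d ->
  (forall h, nm h < d -> g (t + h) = 0) ->
  expands g t (fun h => a * h^* + b * h) -> a = 0.
Proof.
move=> d0 g0 H; apply/eqP; rewrite -nm_eq0; apply/eqP/le_anti; rewrite nm_ge0 andbT.
rewrite leNgt; apply/negP => na.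
have [|d' d'0 Hd'] := H (nm a / 2); first by lra.
pose x := Num.min (d / 2) (d' / 2).
have x0 : 0 < x by rewrite lt_min !divr_gt0.
have [x1 x2] : x <= d / 2 /\ x <= d' / 2 by rewrite !ge_min !lexx orbT.
have gt0 : g t = 0 by rewrite -[t]addr0 g0 // nm0.
have nx : nm (toC x) = x by rewrite nm_toC gtr0_norm.
have nix : nm (ic R * toC x) = x by rewrite nmM nm_ic mul1r.
have h1 := Hd' (toC x); rewrite nx g0 ?nx ?gt0 ?conj_toC in h1; last by lra.
have {}h1 := h1 (ltac:(lra)).
have h2 := Hd' (ic R * toC x).
rewrite nix g0 ?nix ?gt0 ?rmorphM /= ?conj_toC ?conj_ic in h2; last by lra.
have {}h2 := h2 (ltac:(lra)).
rewrite !(subr0, sub0r, nmN) in h1 h2.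
have e1 : nm (a * toC x + b * toC x) = nm (a + b) * x by rewrite -mulrDl nmM nx.
have e2 : nm (a * (- ic R * toC x) + b * (ic R * toC x)) = nm (b - a) * x.
  by rewrite (_ : _ + _ = (b - a) * (ic R * toC x)) ?nmM ?nm_ic ?mul1r ?nx //; ring.
rewrite e1 ler_pM2r // in h1; rewrite e2 ler_pM2r // in h2.
have := nmB (a + b) (b - a).
have -> : a + b - (b - a) = 2%:R * a by ring.
rewrite nmM nm_nat; lra.
Qed.

(** Differentiating the equation in the antiholomorphic direction gives
    [(2 conj phi + f) * conj phi' = 0]. If [phi'] were nonzero at a point, hence
    around it, then [conj phi = - f / 2] would be holomorphic there and its
    antiholomorphic derivative [conj phi'] would vanish. *)
Lemma conj_root_const (phi f g : C -> C) r :
  hol_ball phi 0 r -> hol_ball f 0 r -> hol_ball g 0 r ->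
  (forall t, nm t < r -> (phi t)^* ^+ 2 + (phi t)^* * f t = g t) ->
  forall x y, nm x < r -> nm y < r -> phi x = phi y.
Proof.
move=> Hphi Hf Hg E.
have nearr (t h : C) : nm t < r -> nm h < r - nm t -> nm (t + h) < r.
  by move=> _; have := nmD t h; lra.
have ex (k : C -> C) t : hol_ball k 0 r -> nm t < r -> expands k t (fun h : C => dz k t * h : C).
  by move=> Hk tr; apply: dz_expands; apply: Hk; rewrite subr0.
have S1 t : nm t < r -> dz phi t = 0 \/ 2%:R * (phi t)^* + f t = 0.
  move=> tr; set c := dz phi t.
  suff : (2%:R * (phi t)^* + f t) * c^* = 0.
    move/eqP; rewrite mulf_eq0 => /orP [/eqP|]; first by right.
    by rewrite conjC_eq0 => /eqP; left.
  have Eu := expands_conj (ex phi t Hphi tr).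
  have Ef := ex f t Hf tr; have Eg := ex g t Hg tr.
  pose K := nm c + nm (dz f t).
  have K0 : 0 <= K by rewrite addr_ge0 ?nm_ge0.
  have B1 (h : C) : nm (c^* * h^*) <= K * nm h.
    by rewrite nmM !nm_conj ler_wpM2r ?nm_ge0 // lerDl nm_ge0.
  have B2 (h : C) : nm (dz f t * h) <= K * nm h.
    by rewrite nmM ler_wpM2r ?nm_ge0 // lerDr nm_ge0.
  have E1 := expandsM K0 B1 B1 Eu Eu.
  have E2 := expandsM K0 B1 B2 Eu Ef.
  have Eng : expands (fun z => - g z) t (fun h : C => - (dz g t * h)).
    by move=> e e0; have [d d0 Hd] := Eg e e0; exists d => // h /Hd; rewrite -nmN !opprD.
  have E3 := expandsD (expandsD E1 E2) Eng.
  have E4 : expands (fun z => (phi z)^* * (phi z)^* + (phi z)^* * f z + - g z) t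
      (fun h => (2%:R * (phi t)^* + f t) * c^* * h^* + ((phi t)^* * dz f t - dz g t) * h).
    by move: E3; congr (expands _ _ _); apply: funext => h; rewrite -/c; ring.
  have rt : 0 < r - nm t by lra.
  apply: (antilinear_zero rt _ E4) => h hr /=.
  by rewrite -(E _ (nearr _ _ tr hr)) expr2 subrr.
have S2 t : nm t < r -> dz phi t = 0.
  move=> tr; apply/eqP; apply/negPn/negP => c0.
  have r' : 0 < r - nm t by lra.
  have Hphi' : hol_ball phi t (r - nm t).
    move=> z zt; apply: Hphi; rewrite subr0.
    by have := nmD t (z - t); rewrite addrC subrK; lra.
  have [A [K [d [d0 K0 HA]]]] := dz_expands2 r' Hphi'.
  pose M := nm A + K + 1.
  have M0 : 0 < M by have := nm_ge0 A; rewrite /M; lra.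
  have n0 : 0 < nm (dz phi t) by rewrite nm_gt0.
  pose d' := Num.min (Num.min d (r - nm t)) (Num.min 1 (nm (dz phi t) / M)).
  have d'0 : 0 < d' by rewrite !lt_min d0 r' ltr01 divr_gt0.
  have Z h : nm h < d' -> 2%:R * (phi (t + h))^* + f (t + h) = 0.
    rewrite !lt_min => /andP [/andP [hd hr] /andP [h1 hM]].
    have [hz|//] := S1 (t + h) (nearr _ _ tr hr).
    exfalso; have := HA h hd; rewrite hz sub0r => h2.
    have hh := nm_ge0 h.
    have : nm (dz phi t) <= nm A * nm h + K * nm h ^+ 2.
      rewrite -nmM -nmN (_ : - dz phi t = (- dz phi t - A * h) + A * h); last by ring.
      apply: le_trans (nmD _ _) _; lra.
    have : K * nm h ^+ 2 <= K * nm h.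
      by apply: ler_wpM2l => //; rewrite expr2 ler_piMl // ltW.
    move: hM; rewrite ltr_pdivlMr // /M; lra.
  have Eu := expands_conj (ex phi t Hphi tr).
  have E2 := expandsD (expandsD Eu Eu) (ex f t Hf tr).
  have : 2%:R * (dz phi t)^* = 0.
    have E4 : expands (fun z => (phi z)^* + (phi z)^* + f z) t
        (fun h => 2%:R * (dz phi t)^* * h^* + dz f t * h).
      by move: E2; congr (expands _ _ _); apply: funext => h; ring.
    by apply: (antilinear_zero d'0 _ E4) => h /Z <- /=; ring.
  move/eqP; rewrite mulf_eq0 conjC_eq0 (negbTE c0) orbF pnatr_eq0 //.
move=> x y xr yr; apply/eqP; rewrite -subr_eq0 -nm_eq0; apply/eqP/le_anti.
rewrite nm_ge0 andbT; have := @mean_value_bound R phi 0 r 0 Hphi _ y x.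
rewrite !subr0 mul0r; apply => // z; rewrite subr0 => /S2 ->.
by rewrite nm0.
Qed.

End Polarization.

(** * Germs of holomorphic functions *)

Section Germs.
Variable R : realType.
Local Notation C := (Cplx R).

Lemma open_nmball (V : normedModType C) (x : V) (r : R) : open [set y | nm (y - x) < r].
Proof.
rewrite openE => y /= yr; apply/nbhs_nm; exists (r - nm (y - x)); first by lra.
by move=> z zy; have := nm_split y z x => /=; lra.
Qed.

Lemma holomorphic_nearP (V W : normedModType C) (f : V -> W) (x : V) :
  holomorphic_near f x <-> exists2 r : R, 0 < r & forall y, nm (y - x) < r -> differentiable f y.
Proof.
split=> [[U Ux [Uo Uf]]|[r r0 Hf]].
  have /nbhs_nm [d d0 Hd] : nbhs x U by apply: open_nbhs_nbhs.
  by exists d => // y /Hd /Uf.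
exists [set y | nm (y - x) < r]; first by rewrite /= subrr nm0.
by split=> [|y]; [exact: open_nmball|exact: Hf].
Qed.

(** Both roots of [t ^ 2 + t b = w] tend to [0] with [b] and [w]. *)
Lemma small_quadratic_root (b w : C) (e : R) : 0 < e -> nm b <= e -> nm w <= e ^+ 2 ->
  exists2 t : C, t ^+ 2 + t * b = w & nm t <= 2 * e.
Proof.
move=> e0 be we; pose D := b ^+ 2 + 4%:R * w.
have n4 : nm (4%:R : C) = 4.
  exact: nm_nat.
have n2 : nm (2%:R^-1 : C) = 2^-1.
  by rewrite nmV nm_nat.
have De : nm (sqrtC D) <= 3 * e.
  rewrite -(@ler_pXn2r _ 2) ?nnegrE ?nm_ge0 //; last by lra.
  rewrite -nmX sqrtCK; apply: le_trans (nmD _ _) _; rewrite nmX nmM n4.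
  have : nm b ^+ 2 <= e ^+ 2 by rewrite lerXn2r ?nnegrE ?nm_ge0 //; lra.
  rewrite exprMn; have := sqr_ge0 e; lra.
exists ((- b + sqrtC D) / 2).
  have E := sqrtCK D.
  rewrite (_ : _ + _ = (sqrtC D ^+ 2 - b ^+ 2) / 4%:R); last by field.
  by rewrite E /D; field.
rewrite nmM n2; have := nmD (- b) (sqrtC D); rewrite nmN; lra.
Qed.

Lemma coord_diff (V W : normedModType C) (f : V -> W) (l : W -> C) (x : V) :
  linear (l : W -> C^o) -> (forall w, nm (l w) <= nm w) -> differentiable f x ->
  differentiable (fun y => l (f y)) x /\
  forall v, 'd (fun y => l (f y)) x v = l ('d f x v).
Proof.
move=> ll lb df.
have lB u v : l (u - v) = l u - l v.
  exact: (linear_sub ll).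
have [K K0 HK] := continuous_lin_bounded (diff_continuous df).
have Ex : expands (fun y => l (f y)) x (fun v => l ('d f x v)).
  move=> e e0; have [d d0 Hd] := diff_expands df e0; exists d => // h /Hd H.
  by rewrite -!lB; apply: le_trans H.
have [|v|D E] := @expands_linear_diff R V C (fun y => l (f y)) x (fun v => l ('d f x v)) K _ _ Ex.
- by move=> a u v; rewrite linearP ll.
- exact: le_trans (lb _) (HK v).
by split=> // v; rewrite E.
Qed.

Lemma cbar_diff (f : C -> C) (t : C) : differentiable f t^* ->
  differentiable (cbar f) t /\ dz (cbar f) t = (dz f t^*)^*.
Proof.
move=> df; apply: expands_dz => e e0; have [d d0 Hd] := dz_expands df e0.
exists d => // h hd; rewrite /cbar.
have := Hd h^*; rewrite nm_conj => /(_ hd).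
by rewrite -[X in X <= _ -> _]nm_conj !rmorphB rmorphM /= conjCK -rmorphD.
Qed.

Lemma hol_cbar (f : C -> C) r : hol_ball f 0 r -> hol_ball (cbar f) 0 r.
Proof.
move=> H z zr; have [|//] := @cbar_diff f z _.
by apply: H; rewrite subr0 nm_conj -[z]subr0.
Qed.

(** Values at double roots are obtained as limits of values at simple ones. *)
Lemma zero_off_point (k : C -> C) (d : R) : 0 < d -> differentiable k 0 ->
  (forall x, x != 0 -> nm x < d -> k x = 0) -> k 0 = 0.
Proof.
move=> d0 /dz_expands H Hk; apply/eqP; rewrite -nm_eq0; apply/eqP/le_anti.
rewrite nm_ge0 andbT leNgt; apply/negP => k0.
have [d' d'0 Hd'] := H 1 ltr01.
pose M := nm (dz k 0) + 1.
have M0 : 0 < M by have := nm_ge0 (dz k 0); rewrite /M; lra.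
pose x := Num.min (Num.min (d / 2) (d' / 2)) (nm (k 0) / (2 * M)).
have x0 : 0 < x by rewrite !lt_min !divr_gt0 ?mulr_gt0.
have [xd xd' xM] : [/\ x <= d / 2, x <= d' / 2 & x <= nm (k 0) / (2 * M)].
  by rewrite !ge_min !lexx !orbT.
have nx : nm (toC x) = x by rewrite nm_toC gtr0_norm.
have := Hd' (toC x); rewrite add0r Hk ?nx; [|by rewrite -nm_gt0 nx|by lra].
move=> /(_ (ltac:(lra))) h.
have : nm (k 0) <= nm (0 - k 0 - dz k 0 * toC x) + nm (dz k 0) * x.
  have := nmD (0 - k 0 - dz k 0 * toC x) (dz k 0 * toC x).
  by rewrite subrK sub0r nmN nmM nx.
have : M * x <= nm (k 0) / 2.
  rewrite -ler_pdivlMl // (_ : M^-1 * _ = nm (k 0) / (2 * M)) //.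
  by field; rewrite gt_eqF.
rewrite /M; lra.
Qed.

(** Local injectivity in a quantitative form: [f w - f' 0 * w] has small
    derivative near [0]. *)
Lemma locally_expanding (f : C -> C) r : 0 < r -> hol_ball f 0 r -> dz f 0 != 0 ->
  exists2 d : R, 0 < d & forall x y, nm x < d -> nm y < d ->
    nm (dz f 0) / 2 * nm (x - y) <= nm (f x - f y).
Proof.
move=> r0 Hf f0; set a := dz f 0 in f0 *.
have na : 0 < nm a by rewrite nm_gt0.
have [A [K [d [d0 K0 HA]]]] := dz_expands2 r0 Hf.
pose M := nm A + K + 1.
have M0 : 0 < M by have := nm_ge0 A; rewrite /M; lra.
pose s := Num.min (Num.min d r) (Num.min 1 (nm a / (2 * M))).
have s0 : 0 < s by rewrite !lt_min d0 r0 ltr01 divr_gt0 ?mulr_gt0.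
have [sd sr s1 sM] : [/\ s <= d, s <= r, s <= 1 & s <= nm a / (2 * M)].
  by split; rewrite !ge_min lexx ?orbT.
exists s => // x y xs ys.
pose k w := f w + (- a) * w.
have dk w : nm w < s -> differentiable k w /\ dz k w = dz f w - a.
  move=> ws; have dfw : differentiable f w by apply: Hf; rewrite subr0; lra.
  have [d2 e2] := dz_id w; have [d3 e3] := dz_comb (- a) dfw d2.
  by split=> //; rewrite e3 e2 mulr1.
have := @mean_value_bound R k 0 s (nm a / 2).
move=> H; have {H} := H _ _ y x; rewrite !subr0.
have -> : k x - k y = (f x - f y) - a * (x - y) by rewrite /k; ring.
move=> H.
have {H} : nm (f x - f y - a * (x - y)) <= nm a / 2 * nm (x - y).
  apply: H; [by move=> w; rewrite subr0 => /dk []| |exact: ys|exact: xs].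
  move=> w; rewrite subr0 => ws; have [_ ->] := dk w ws.
  have := HA w (lt_le_trans ws sd); rewrite add0r -/a => h.
  have nw := nm_ge0 w.
  rewrite (_ : dz f w - a = (dz f w - a - A * w) + A * w); last by ring.
  apply: le_trans (nmD _ _) _; rewrite [nm (A * w)]nmM.
  have : K * nm w ^+ 2 <= K * nm w.
    by apply: ler_wpM2l => //; rewrite expr2 ler_piMl //; lra.
  have : M * nm w <= nm a / 2.
    rewrite -ler_pdivlMl // (_ : M^-1 * _ = nm a / (2 * M)); last by field; rewrite gt_eqF.
    lra.
  rewrite /M; lra.
have := nmB (f x - f y - a * (x - y)) (f x - f y).
rewrite (_ : f x - f y - a * (x - y) - (f x - f y) = - (a * (x - y))); last by ring.
rewrite nmN nmM; lra.
Qed.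

(** Pointwise forms of the differentiation rules: stating them for explicit
    lambda terms spares unification the search for [\+] or [\o]. *)
Lemma fdiffD (V : normedModType C) (f g : V -> C) x :
  differentiable f x -> differentiable g x -> differentiable (fun p => f p + g p) x.
Proof. exact: differentiableD. Qed.
Lemma fdiffB (V : normedModType C) (f g : V -> C) x :
  differentiable f x -> differentiable g x -> differentiable (fun p => f p - g p) x.
Proof. exact: differentiableB. Qed.
Lemma fdiffM (V : normedModType C) (f g : V -> C) x :
  differentiable f x -> differentiable g x -> differentiable (fun p => f p * g p) x.
Proof. exact: differentiableM. Qed.
Lemma fdiff_comp (U V W : normedModType C) (f : U -> V) (g : V -> W) x :
  differentiable f x -> differentiable g (f x) -> differentiable (fun p => g (f p)) x.
Proof. exact: differentiable_comp. Qed.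
Lemma fdiff_cst (U V : normedModType C) (v : V) (x : U) : differentiable (fun _ : U => v) x.
Proof. exact: differentiable_cst. Qed.
Lemma fdiff_id (V : normedModType C) (x : V) : differentiable (fun y : V => y) x.
Proof. exact: (ex_diff (is_diff_def := is_diff_id x)). Qed.

End Germs.

(** * The components of an automorphism along the quadric *)

Section Structure.
Variables (R : realType) (n : nat) (hn : (1 < n)%N).
Local Notation C := (Cplx R).
Local Notation V := ('rV[C]_n * C)%type.
Local Notation i1 := (idx1 hn).
Local Notation i2 := (idx2 hn).
Local Notation z1 := (z1 (R := R) hn).
Local Notation z2 := (z2 (R := R) hn).

Definition e1 : 'rV[C]_n := delta_mx 0 i1.
Definition e2 : 'rV[C]_n := delta_mx 0 i2.

Lemma idx12 : (i2 == i1) = false. Proof. by []. Qed.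

Lemma nm_delta (j : 'I_n) : nm (delta_mx 0 j : 'rV[C]_n) <= 1.
Proof.
apply: nm_rV_le => // k; rewrite mxE eqxx /=.
by case: (k == j); rewrite ?nm1 ?nm0.
Qed.

Lemma z1_lin : linear (z1 : V -> C^o).
Proof. by move=> a u v; rewrite /Defs.z1 /= !mxE. Qed.
Lemma z2_lin : linear (z2 : V -> C^o).
Proof. by move=> a u v; rewrite /Defs.z2 /= !mxE. Qed.
Lemma snd_lin : linear ((fun p : V => p.2) : V -> C^o).
Proof. by []. Qed.
Lemma z1_nm (p : V) : nm (z1 p) <= nm p.
Proof. exact: le_trans (nm_coord _ _) (nm_pair1 _). Qed.
Lemma z2_nm (p : V) : nm (z2 p) <= nm p.
Proof. exact: le_trans (nm_coord _ _) (nm_pair1 _). Qed.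

(** A parametrization of the complexified quadric: [s] stands for [z_1], [t] for
    its conjugate, and [y] for the remaining variables; its first coordinate is
    meant to vanish. On [t = conj s] it parametrizes the quadric. *)
Definition cquad (y : 'rV[C]_n) (st : C * C) : V :=
  (st.1 *: e1 + y, st.2 * y 0 i2 + st.2 ^+ 2).

Lemma cquad_diff y st : differentiable (cquad y) st.
Proof.
pose L (h : C * C) : V := (h.1 *: e1, h.2 * (y 0 i2 + 2%:R * st.2)).
have [||e e0|//] := @expands_linear_diff R _ _ (cquad y) st L (1 + nm (y 0 i2 + 2%:R * st.2)).
- move=> a u v; rewrite /L; congr pair; rewrite /=; first by rewrite scalerDl scalerA.
  by rewrite mulrDl -[a *: u.2]/(a * u.2) -[a *: (_ * _)]/(a * _) mulrA.
- move=> v; have c0 := nm_ge0 (y 0 i2 + 2%:R * st.2); have v0 := nm_ge0 v.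
  apply: nm_pair_le => /=.
    rewrite nmZ; apply: le_trans (_ : nm v.1 * 1 <= _).
      by apply: ler_wpM2l; [exact: nm_ge0|exact: nm_delta].
    have := nm_pair1 v; have := mulr_ge0 c0 v0; lra.
  rewrite nmM; have := ler_wpM2r c0 (nm_pair2 v); lra.
exists e => // h he.
have -> : cquad y (st + h) - cquad y st - L h = (0, h.2 ^+ 2).
  rewrite /cquad /L; congr pair; rewrite /=.
    by rewrite scalerDl opprD addrACA subrr addr0 [st.1 *: e1 + _]addrC addrK subrr.
  by ring.
apply: nm_pair_le => /=; first by rewrite nm0 mulr_ge0 ?nm_ge0 // ltW.
rewrite nmX expr2; have h2 := nm_pair2 h.
by apply: ler_pM; [exact: nm_ge0|exact: nm_ge0|exact: le_trans h2 (ltW he)|exact: h2].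
Qed.

Lemma cquad_nm y (s t : C) d : d <= 1 -> nm s < d -> nm t < d -> nm y <= 2 * d ->
  nm (cquad y (s, t)) < 3 * d.
Proof.
move=> d1 sd td yd; have s0 := nm_ge0 s; have t0 := nm_ge0 t; have y0 := nm_ge0 y.
rewrite nm_pairE gt_max /=; apply/andP; split.
  apply: le_lt_trans (nmD _ _) _; rewrite nmZ.
  have : nm s * nm e1 <= nm s * 1 by apply: ler_wpM2l => //; exact: nm_delta.
  lra.
apply: le_lt_trans (nmD _ _) _; rewrite nmM nmX.
have := nm_coord y i2.
have : nm t * nm (y 0 i2) <= 1 * nm (y 0 i2) by apply: ler_wpM2r; [exact: nm_ge0|lra].
have : nm t ^+ 2 <= 1 * nm t by rewrite expr2; apply: ler_wpM2r => //; lra.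
lra.
Qed.

Lemma cquad_quadric (y : 'rV[C]_n) (s : C) : y 0 i1 = 0 -> quadric hn (cquad y (s, s^*)).
Proof.
move=> y1; rewrite /quadric /= /Defs.z1 /Defs.z2 /cquad /= !mxE y1 eqxx idx12 /=.
by rewrite mulr1 addr0 mulr0 add0r.
Qed.

Lemma z1_cquad (y : 'rV[C]_n) (s t : C) : y 0 i1 = 0 -> z1 (cquad y (s, t)) = s.
Proof. by move=> y1; rewrite /Defs.z1 /cquad /= !mxE y1 eqxx /= mulr1 addr0. Qed.

(** Every point [p] lies on the complexified quadric, with [t] any root of
    [t ^ 2 + t z_2 = w]. *)
Lemma cquad_root (p : V) (t : C) : t ^+ 2 + t * z2 p = p.2 ->
  p = cquad (p.1 - z1 p *: e1) (z1 p, t) /\ (p.1 - z1 p *: e1) 0 i1 = 0.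
Proof.
move=> E; split.
  rewrite /cquad /= [_ + (_ - _)]addrC subrK !mxE idx12 /= mulr0 subr0.
  by rewrite -[p.1 0 i2]/(z2 p) addrC E; case: p {E}.
by rewrite !mxE eqxx /= mulr1 /Defs.z1 subrr.
Qed.

Variables (F : V -> V) (rho B : R).
Hypothesis rho0 : 0 < rho.
Hypothesis dF : forall p, nm p < rho -> differentiable F p.
Hypothesis bF : forall p, nm p < rho -> nm (F p) <= B.
Hypothesis FM : forall p, nm p < rho -> quadric hn p -> quadric hn (F p).

Let d1 := Num.min rho 1 / 3.

Let d1_facts : [/\ 0 < d1, d1 <= 1 & 3 * d1 <= rho].
Proof.
have h1 : Num.min rho 1 <= rho by rewrite ge_min lexx.
have h2 : Num.min rho 1 <= 1 by rewrite ge_min lexx orbT.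
have h3 : 0 < Num.min rho 1 by rewrite lt_min rho0 ltr01.
rewrite /d1; split; lra.
Qed.

Let F1 p := z1 (F p).
Let F2 p := z2 (F p).
Let G p := (F p).2.

Let dF1 p : nm p < rho -> differentiable F1 p.
Proof. by move=> /dF D; have [] := coord_diff z1_lin z1_nm D. Qed.
Let dF2 p : nm p < rho -> differentiable F2 p.
Proof. by move=> /dF D; have [] := coord_diff z2_lin z2_nm D. Qed.
Let dG p : nm p < rho -> differentiable G p.
Proof. by move=> /dF D; have [] := coord_diff snd_lin (@nm_pair2 R _ _) D. Qed.

(** For fixed [z_1] the quadric contains a complex affine space with coordinates
    [z_2, ..., z_n]. Along each line of it, the equation
    [G = conj F_1 * F_2 + conj F_1 ^ 2] exhibits [conj F_1] as a root of a monic
    quadratic with holomorphic coefficients, so [F_1] is constant. *)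
Lemma F1_leaf (s : C) (y : 'rV[C]_n) : nm s < d1 -> nm y < d1 -> y 0 i1 = 0 ->
  F1 (cquad y (s, s^*)) = F1 (cquad 0 (s, s^*)).
Proof.
move=> sd yd y1; have [d0 d1_1 d1r] := d1_facts.
(* the line through [cquad 0 (s, conj s)] and [cquad y (s, conj s)] *)
pose p0 : V := (s *: e1, (s^*) ^+ 2); pose v : V := (y, s^* * y 0 i2).
have line (x : C) : p0 + x *: v = cquad (x *: y) (s, s^*).
  rewrite /cquad /p0 /v; congr pair; rewrite /= mxE.
  by rewrite -[x *: (_ * _)]/(x * _); ring.
have small (x : C) : nm x < 2 -> nm (p0 + x *: v) < rho.
  move=> x2; rewrite line; apply: lt_le_trans d1r; apply: cquad_nm; rewrite ?nm_conj //.
  rewrite nmZ; apply: ler_pM; rewrite ?nm_ge0 ?ltW //.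
have hol (k : V -> C) : (forall p, nm p < rho -> differentiable k p) ->
    hol_ball (fun x => k (p0 + x *: v)) 0 2.
  by move=> Hk x; rewrite subr0 => /small /Hk D; have [] := line_diff D.
have := @conj_root_const R _ _ _ 2 (hol F1 dF1) (hol F2 dF2) (hol G dG).
move=> H; have := H _ 1 0; rewrite nm1 nm0 !line scale1r scale0r; apply => //; last first.
  by rewrite (ltr_nat _ 1 2).
move=> x x2; have x0 : (x *: y) 0 i1 = 0 by rewrite mxE y1 mulr0.
have := FM (small x x2); rewrite line => /(_ (cquad_quadric s x0)).
by rewrite /quadric /= -/(G _) -/(F1 _) -/(F2 _) => ->; rewrite addrC.
Qed.

Let small2 (y : 'rV[C]_n) (s t : C) : nm s < d1 -> nm t < d1 -> nm y <= 2 * d1 ->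
  nm (cquad y (s, t)) < rho.
Proof.
move=> sd td yd; have [d0 d1_1 d1r] := d1_facts.
by apply: lt_le_trans d1r; apply: cquad_nm.
Qed.

(* 96 is the loss of radius in the polarization lemma *)
Let d2 := d1 / 96.

(** The previous lemma, polarized: [conj s] becomes an independent variable. *)
Lemma F1_cquad (s t : C) (y : 'rV[C]_n) : nm s < d2 -> nm t < d2 -> nm y < d1 -> y 0 i1 = 0 ->
  F1 (cquad y (s, t)) = F1 (cquad 0 (s, t)).
Proof.
move=> sd td yd y1; have [d0 d1_1 d1r] := d1_facts.
apply/eqP; rewrite -subr_eq0; apply/eqP.
have := @polarization R (fun p => F1 (cquad y p) - F1 (cquad 0 p)) d1 (2 * B).
apply; [exact: d0| |by move=> a ad; rewrite F1_leaf // subrr|exact: sd|exact: td].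
move=> [a b] /= ad bd.
have h1 : nm (cquad y (a, b)) < rho by apply: small2 => //; lra.
have h2 : nm (cquad 0 (a, b)) < rho by apply: small2 => //; rewrite nm0; lra.
split.
  exact: fdiffB (fdiff_comp (cquad_diff _ _) (dF1 h1)) (fdiff_comp (cquad_diff _ _) (dF1 h2)).
apply: le_trans (nmB _ _) _.
have := le_trans (z1_nm _) (bF h1); have := le_trans (z1_nm _) (bF h2); lra.
Qed.

Let d3 := d2 / 4.

Let d3_facts : [/\ 0 < d3, d3 <= 1, 4 * d3 <= d2, d2 <= d1 & d3 <= rho].
Proof. by have [h1 h2 h3] := d1_facts; rewrite /d3 /d2; split; lra. Qed.

Let root (p : V) (e : R) : 0 < e -> e <= 1 -> nm p < e ^+ 2 ->
  exists2 t, t ^+ 2 + t * z2 p = p.2 & nm t <= 2 * e.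
Proof.
move=> e0 e1 pe; apply: small_quadratic_root => //.
  apply: le_trans (z2_nm p) _; apply: le_trans (ltW pe) _.
  by rewrite expr2 ler_piMl // ltW.
by apply: le_trans (nm_pair2 p) (ltW pe).
Qed.

(** [F_1] read on the [z_1]-axis; it is the function of one variable through which
    [F_1] factors. *)
Definition first_factor (s : C) : C := F1 (s *: e1, 0).
Let f1 := first_factor.

Let resid (p : V) : nm p < d3 -> nm (p.1 - z1 p *: e1) < 2 * d3.
Proof.
move=> pd; apply: le_lt_trans (nmB _ _) _; rewrite nmZ.
have : nm (z1 p) * nm e1 <= nm (z1 p) * 1.
  by apply: ler_wpM2l; [exact: nm_ge0|exact: nm_delta].
have := z1_nm p; have := nm_pair1 p; lra.
Qed.

(** Write [p] as [cquad y (z_1, t)]. The variable [y] can be changed at will, and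
    at [y = - t e_2] the last coordinate [t y_2 + t ^ 2] is [0], as it is for
    [t = 0]. *)
Lemma F1_first (p : V) : nm p < d3 ^+ 2 -> F1 p = f1 (z1 p).
Proof.
move=> pd; have [d30 d31 d32 d21 d3r] := d3_facts.
have pd3 : nm p < d3 by apply: lt_le_trans pd _; rewrite expr2 ler_piMl // ltW.
have [t E td] := root d30 d31 pd.
have [Ep y1] := cquad_root E.
have zd := z1_nm p; have rd := resid pd3.
set y := p.1 - z1 p *: e1 in Ep y1 rd.
have H1 : F1 (cquad y (z1 p, t)) = F1 (cquad 0 (z1 p, t)) by apply: F1_cquad => //; lra.
have y2 : (- t *: e2) 0 i1 = 0 by rewrite !mxE eq_sym idx12 mulr0.
have e2n : nm (- t *: e2) < d1.
  rewrite nmZ nmN; have : nm t * nm e2 <= nm t * 1.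
    by apply: ler_wpM2l; [exact: nm_ge0|exact: nm_delta].
  lra.
have H2 : F1 (cquad (- t *: e2) (z1 p, t)) = F1 (cquad 0 (z1 p, t)).
  by apply: F1_cquad => //; lra.
have H3 : F1 (cquad (- t *: e2) (z1 p, 0)) = F1 (cquad 0 (z1 p, 0)).
  by apply: F1_cquad => //; rewrite ?nm0; lra.
rewrite [in LHS]Ep H1 -H2.
have -> : cquad (- t *: e2) (z1 p, t) = cquad (- t *: e2) (z1 p, 0).
  by rewrite /cquad /=; congr pair; rewrite !mxE !eqxx /=; ring.
rewrite H3 /f1 /first_factor /cquad /=; congr F1.
by rewrite addr0 mul0r add0r expr0n.
Qed.

Lemma first_factor_hol : hol_ball f1 0 rho.
Proof.
move=> s; rewrite subr0 => sr.
have E : (fun s : C => F1 (0 + s *: ((e1, 0) : V))) = f1.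
  apply: funext => x; rewrite /f1 /first_factor add0r; congr F1.
  by congr pair; rewrite /= -[x *: 0]/(x * 0) mulr0.
have : nm (0 + s *: ((e1, 0) : V)) < rho.
  rewrite add0r nmZ; apply: le_lt_trans sr; rewrite -[leRHS]mulr1.
  apply: ler_wpM2l; first exact: nm_ge0.
  by apply: nm_pair_le => /=; rewrite ?nm0 //; exact: nm_delta.
by move=> /dF1 D; have [D' _] := line_diff D; rewrite -E.
Qed.

Let h := cbar f1.

Let hol_h : hol_ball h 0 rho. Proof. exact: hol_cbar first_factor_hol. Qed.

Let d4 := d3 ^+ 2 / 3.
Let d5 := d4 / 96.

Let d4_facts : [/\ 0 < d4, d4 <= 1, 3 * d4 <= d3 ^+ 2, d4 <= d3 & 3 * d4 <= rho].
Proof.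
have [d30 d31 d32 d21 d3r] := d3_facts.
have q : d3 ^+ 2 <= d3 by rewrite expr2 ler_piMl // ltW.
have q0 : 0 < d3 ^+ 2 by rewrite exprn_gt0.
by rewrite /d4; split; lra.
Qed.

(** The defining equation at the image point, polarized: the conjugate of
    [F_1 (cquad y (s, conj s))] is [cbar F_1] evaluated at the conjugate of [s]. *)
Lemma G_cquad (s t : C) (y : 'rV[C]_n) : nm s < d5 -> nm t < d5 -> nm y < d4 -> y 0 i1 = 0 ->
  G (cquad y (s, t)) = h t * F2 (cquad y (s, t)) + h t ^+ 2.
Proof.
move=> sd td yd y1; have [d40 d41 d43 d4d d4r] := d4_facts.
have B0 : 0 <= B by apply: le_trans (@bF 0 _); rewrite ?nm_ge0 // nm0.
have small (a b : C) : nm a < d4 -> nm b < d4 -> nm (cquad y (a, b)) < d3 ^+ 2.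
  by move=> ad bd; apply: lt_le_trans d43; apply: cquad_nm => //; lra.
have lr (p : V) : nm p < d3 ^+ 2 -> nm p < rho.
  move=> pd; have [d30 d31 d32 d21 d3r] := d3_facts.
  by apply: lt_le_trans pd _; apply: le_trans d3r; rewrite expr2 ler_piMl // ltW.
have e1rho (x : C) : nm (x *: e1) <= nm x.
  rewrite nmZ -[leRHS]mulr1; apply: ler_wpM2l; [exact: nm_ge0|exact: nm_delta].
have hB (x : C) : nm x < d4 -> nm (h x) <= B.
  move=> xd; rewrite /h /cbar nm_conj /f1 /first_factor.
  apply: le_trans (z1_nm _) _; apply: bF.
  have := e1rho x^*; rewrite nm_conj => ?.
  by rewrite nm_pairE gt_max /= nm0 rho0 andbT; lra.
have dsnd (p : C * C) : differentiable (fun p : C * C => p.2) p.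
  have [|||//] := @coord_diff R (C * C)%type (C * C)%type id (fun p => p.2) p.
  - by [].
  - by move=> w; exact: nm_pair2.
  - exact: fdiff_id.
have := @polarization R (fun p => G (cquad y p) - (h p.2 * F2 (cquad y p) + h p.2 * h p.2)) d4
   (B + (B * B + B * B)).
move=> H; apply/eqP; rewrite -subr_eq0 expr2; apply/eqP.
apply: (H d40 _ _ s t sd td) => {H}.
- move=> [a b] /= ad bd.
  have q := lr _ (small a b ad bd).
  have dh : differentiable (fun p : C * C => h p.2) (a, b).
    apply: (fdiff_comp (dsnd (a, b))).
    by apply: hol_h; rewrite subr0 /=; lra.
  have dQ := cquad_diff y (a, b).
  split; first exact: fdiffB (fdiff_comp dQ (dG q))
                       (fdiffD (fdiffM dh (fdiff_comp dQ (dF2 q))) (fdiffM dh dh)).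
  have bq := bF q; have h1 := hB b bd.
  have g1 : nm (G (cquad y (a, b))) <= B by apply: le_trans bq; exact: nm_pair2.
  have g2 : nm (F2 (cquad y (a, b))) <= B by apply: le_trans (z2_nm _) bq.
  apply: le_trans (nmB _ _) _; apply: lerD => //.
  apply: le_trans (nmD _ _) _; rewrite !nmM.
  by apply: lerD; apply: ler_pM => //; exact: nm_ge0.
- move=> a ad /=; have ad' : nm a^* < d4 by rewrite nm_conj.
  have q := lr _ (small a _ ad ad').
  have := FM q (cquad_quadric a y1).
  rewrite /quadric /= -/(G _) -/(z1 _) -/(F1 _) -/(F2 _) => ->.
  rewrite F1_first ?z1_cquad //; last exact: small.
  by rewrite /h /cbar conjCK; ring.
Qed.

Let d6 := d5 / 4.

Let d6_facts : [/\ 0 < d6, 4 * d6 <= d5, d5 <= d4, d6 <= 1 & d6 <= rho].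
Proof. by have [h1 h2 h3 h4 h5] := d4_facts; rewrite /d6 /d5; split; lra. Qed.

Lemma quadratic_relation (p : V) (t : C) : nm p < d6 -> nm t < d5 -> t ^+ 2 + t * z2 p = p.2 ->
  G p = h t * F2 p + h t ^+ 2.
Proof.
move=> pd td E; have [d60 d65 d54 d61 d6r] := d6_facts.
have [Ep y1] := cquad_root E.
rewrite Ep; apply: G_cquad => //.
  by have := z1_nm p; lra.
apply: le_lt_trans (nmB _ _) _; rewrite nmZ.
have : nm (z1 p) * nm e1 <= nm (z1 p) * 1.
  by apply: ler_wpM2l; [exact: nm_ge0|exact: nm_delta].
have := z1_nm p; have := nm_pair1 p; lra.
Qed.

Hypothesis df1 : dz f1 0 != 0.

(** A point [(z, w)] has two roots [t] and [- t - z_2]; applying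
    [quadratic_relation] to both shows that [h t] and [h (- t - z_2)] are roots of
    [X ^ 2 + F_2 X = G]. They are distinct when the roots are, as [h] is locally
    injective, and Vieta's formulas give [F_2] and [G]. Double roots are limits
    of simple ones. *)
Lemma symmetric_formulas : exists2 d : R, 0 < d & forall (p : V) (t : C),
  nm p < d -> nm t < d -> t ^+ 2 + t * z2 p = p.2 ->
  F2 p = - (h t + h (- t - z2 p)) /\ G p = - (h t * h (- t - z2 p)).
Proof.
have [d60 d65 d54 d61 d6r] := d6_facts.
have dh0 : dz h 0 != 0.
  have [|_ E] := @cbar_diff R f1 0; first by apply: first_factor_hol; rewrite subr0 conjC0 nm0.
  by rewrite /h E conjC_eq0 conjC0.
have [d d0 Hd] := locally_expanding rho0 hol_h dh0.
pose m := Num.min d d6 / 8.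
have [m0 md m6] : [/\ 0 < m, 8 * m <= d & 8 * m <= d6].
  have h1 : Num.min d d6 <= d by rewrite ge_min lexx.
  have h2 : Num.min d d6 <= d6 by rewrite ge_min lexx orbT.
  have h3 : 0 < Num.min d d6 by rewrite lt_min d0 d60.
  by rewrite /m; split; lra.
have distinct (p : V) (t : C) : nm p < d6 -> nm t < 2 * m -> nm (z2 p) < 2 * m ->
    t ^+ 2 + t * z2 p = p.2 -> t != - t - z2 p ->
    F2 p = - (h t + h (- t - z2 p)) /\ G p = - (h t * h (- t - z2 p)).
  move=> pd td zd E tt'; pose t' := - t - z2 p.
  have td' : nm t' < 4 * m by have := nmB (- t) (z2 p); rewrite nmN /t'; lra.
  have E' : t' ^+ 2 + t' * z2 p = p.2 by rewrite -E /t'; ring.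
  have r1 : G p = h t * F2 p + h t ^+ 2 by apply: quadratic_relation => //; lra.
  have r2 : G p = h t' * F2 p + h t' ^+ 2 by apply: quadratic_relation => //; lra.
  have hh : h t - h t' != 0.
    rewrite -nm_gt0; have t1d : nm t < d by lra. have t2d : nm t' < d by lra.
    apply: lt_le_trans (Hd t t' t1d t2d).
    by rewrite !mulr_gt0 // nm_gt0 // subr_eq0.
  have : (h t - h t') * (F2 p + (h t + h t')) = 0.
    rewrite (_ : _ * _ = (h t * F2 p + h t ^+ 2) - (h t' * F2 p + h t' ^+ 2)); last by ring.
    by rewrite -r1 -r2 subrr.
  move/eqP; rewrite mulf_eq0 (negbTE hh) /= addr_eq0 => /eqP F2E.
  by split=> //; rewrite r1 F2E -/t'; ring.
exists m => // p t pm tm E.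
have zm := z2_nm p.
have [tt'|] := eqVneq t (- t - z2 p); last by apply: distinct => //; lra.
(* [pe x] is the point with the same [z] that has [t + x] as a root *)
pose pe (x : C) : V := (p.1, (t + x) ^+ 2 + (t + x) * z2 p).
have pe0 : pe 0 = p by rewrite /pe addr0 E; case: (p).
have pez x : z2 (pe x) = z2 p by [].
have dpe x : differentiable pe x.
  have [||e e0|//] := @expands_linear_diff R C V pe x
    (fun k => (0, k * (2%:R * (t + x) + z2 p))) (nm (2%:R * (t + x) + z2 p)).
  - move=> a u v; congr pair; rewrite /= ?scaler0 ?addr0 //.
    by rewrite mulrDl -[a *: u]/(a * u) -[a *: (_ * _)]/(a * _) mulrA.
  - by move=> v; apply: nm_pair_le => /=; rewrite ?nm0 ?mulr_ge0 ?nm_ge0 // nmM mulrC.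
  exists e => // k ke; apply: nm_pair_le => /=.
    by rewrite subrr subr0 nm0 mulr_ge0 ?nm_ge0 // ltW.
  rewrite (_ : _ - _ = k * k); last by ring.
  by rewrite nmM; apply: ler_wpM2r; [exact: nm_ge0|exact: ltW].
have pes x : nm x < m -> nm (pe x) < d6.
  move=> xm; rewrite nm_pairE gt_max /=; apply/andP; split.
    by have := nm_pair1 p; lra.
  apply: le_lt_trans (nmD _ _) _; rewrite nmX nmM.
  have q := nmD t x.
  have : nm (t + x) ^+ 2 <= 1 * nm (t + x).
    by rewrite expr2; apply: ler_wpM2r; [exact: nm_ge0|lra].
  have : nm (t + x) * nm (z2 p) <= 1 * nm (z2 p).
    by apply: ler_wpM2r; [exact: nm_ge0|lra].
  lra.
have dhx (a b : C) : nm a < rho -> differentiable (fun x => h (a + b * x)) 0.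
  move=> ar; apply: (@fdiff_comp R C C C (fun x => a + b * x) h).
    exact: fdiffD (fdiff_cst _ _) (fdiffM (fdiff_cst _ _) (fdiff_id _)).
  by apply: hol_h; rewrite mulr0 addr0 subr0.
have Eh x : h (- (t + x) - z2 p) = h (- t - z2 p + (-1) * x) by congr h; ring.
have Eh' x : h (t + x) = h (t + 1 * x) by rewrite mul1r.
have tr : nm t < rho by lra.
have tr' : nm (- t - z2 p) < rho by rewrite -tt'.
have dis x : x != 0 -> nm x < m ->
    F2 (pe x) = - (h (t + 1 * x) + h (- t - z2 p + (-1) * x)) /\
    G (pe x) = - (h (t + 1 * x) * h (- t - z2 p + (-1) * x)).
  move=> x0 xm; rewrite -Eh -Eh' -(pez x); apply: distinct => //; rewrite ?pez.
  - exact: pes.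
  - by have := nmD t x; lra.
  - lra.
  rewrite -subr_eq0 [X in X != 0](_ : _ = 2%:R * x + (t - (- t - z2 p))); last by ring.
  by rewrite -tt' subrr addr0 mulf_neq0 // pnatr_eq0.
have dF2p : differentiable (fun x => F2 (pe x)) 0.
  by apply: (fdiff_comp (dpe 0)); apply: dF2; rewrite pe0; lra.
have dGp : differentiable (fun x => G (pe x)) 0.
  by apply: (fdiff_comp (dpe 0)); apply: dG; rewrite pe0; lra.
have D1 := dhx t 1 tr; have D2 := dhx (- t - z2 p) (-1) tr'.
have K1 := @zero_off_point R (fun x => F2 (pe x) +
   (h (t + 1 * x) + h (- t - z2 p + (-1) * x))) m m0.
have K2 := @zero_off_point R (fun x => G (pe x) +
   (h (t + 1 * x) * h (- t - z2 p + (-1) * x))) m m0.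
move: K1 K2; rewrite !mulr0 !addr0 pe0 => K1 K2; split; apply/eqP; rewrite -addr_eq0; apply/eqP.
  apply: K1; first exact: fdiffD dF2p (fdiffD D1 D2).
  by move=> x x0 /(dis x x0) [-> _]; rewrite addNr.
apply: K2; first exact: fdiffD dGp (fdiffM D1 D2).
by move=> x x0 /(dis x x0) [_ ->]; rewrite addNr.
Qed.

Lemma F1_first_near : exists2 d : R, 0 < d & forall p, nm p < d -> F1 p = f1 (z1 p).
Proof.
have [d30 _ _ _ _] := d3_facts.
by exists (d3 ^+ 2); [rewrite exprn_gt0|exact: F1_first].
Qed.

End Structure.

(** * Derivatives of vector-valued maps and the rank at the origin *)

Section Derivatives.
Variable R : realType.
Local Notation C := (Cplx R).

Lemma expands_row (V : normedModType C) n (f L : V -> 'rV[C]_n) (x : V) :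
  (forall j, expands (fun y => f y 0 j) x (fun v => L v 0 j)) -> expands f x L.
Proof.
move=> H e e0.
have /choice [d Hd] : forall j, exists d : R, 0 < d /\ forall h, nm h < d ->
    nm (f (x + h) 0 j - f x 0 j - L h 0 j) <= e * nm h.
  by move=> j; have [d d0 Hd] := H j e e0; exists d.
exists (\big[Num.min/1]_j d j).
  by elim/big_ind: _ => [//|a b a0 b0|j _]; [rewrite lt_min a0|case: (Hd j)].
move=> h hd; apply: nm_rV_le => [|j]; first by apply: mulr_ge0; [exact: ltW|exact: nm_ge0].
have [_ Hj] := Hd j; rewrite !mxE; apply: Hj; apply: lt_le_trans hd _.
exact: bigmin_le_cond.
Qed.

Lemma row_diff (V : normedModType C) n (f : V -> 'rV[C]_n) (x : V) :
  (forall j, differentiable (fun y => f y 0 j) x) ->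
  differentiable f x /\ forall v j, ('d f x v) 0 j = 'd (fun y => f y 0 j) x v.
Proof.
move=> H; pose L (v : V) : 'rV[C]_n := \row_j 'd (fun y => f y 0 j) x v.
have /choice [K HK] : forall j, exists K : R, 0 < K /\ forall v, nm ('d (fun y => f y 0 j) x v) <= K * nm v.
  by move=> j; have [K K0 HK] := continuous_lin_bounded (diff_continuous (H j)); exists K.
have EL : expands f x L.
  apply: expands_row => j.
  have -> : (fun v => L v 0 j) = 'd (fun y => f y 0 j) x by apply: funext => v; rewrite mxE.
  exact: diff_expands.
have [a u v|v|D E] := @expands_linear_diff R V _ f x L (\sum_j K j) _ _ EL.
- by apply/rowP => j; rewrite !mxE linearP.
- apply: nm_rV_le => [|j].
    by apply: mulr_ge0; [apply: sumr_ge0 => i _; case: (HK i) => /ltW|exact: nm_ge0].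
  rewrite mxE; have [_ h] := HK j; apply: le_trans (h v) _; apply: ler_wpM2r; first exact: nm_ge0.
  by rewrite (bigD1 j) //= lerDl; apply: sumr_ge0 => i _; case: (HK i) => /ltW.
by split=> // v j; rewrite E mxE.
Qed.

Lemma pair_diff (V W1 W2 : normedModType C) (f : V -> W1) (g : V -> W2) (x : V) :
  differentiable f x -> differentiable g x ->
  differentiable (fun y => (f y, g y)) x /\
  forall v, 'd (fun y => (f y, g y)) x v = ('d f x v, 'd g x v).
Proof.
move=> df dg.
have [K1 K10 HK1] := continuous_lin_bounded (diff_continuous df).
have [K2 K20 HK2] := continuous_lin_bounded (diff_continuous dg).
have EL : expands (fun y => (f y, g y)) x (fun v => ('d f x v, 'd g x v)).
  move=> e e0; have [d d0 Hd] := diff_expands df e0; have [d' d'0 Hd'] := diff_expands dg e0.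
  exists (Num.min d d'); first by rewrite lt_min d0.
  by move=> h; rewrite lt_min => /andP [/Hd h1 /Hd' h2]; apply: nm_pair_le.
have [a u v|v|D E] := @expands_linear_diff R V _ _ x _ (K1 + K2) _ _ EL.
- by rewrite !linearP.
- have v0 := nm_ge0 v; apply: nm_pair_le => /=.
    by apply: le_trans (HK1 v) _; apply: ler_wpM2r => //; lra.
  by apply: le_trans (HK2 v) _; apply: ler_wpM2r => //; lra.
by split=> // v; rewrite E.
Qed.

Lemma dz_near_eq (f g : C -> C) z (d : R) : 0 < d ->
  (forall h, nm h < d -> f (z + h) = g (z + h)) -> differentiable f z ->
  differentiable g z /\ dz g z = dz f z.
Proof.
move=> d0 E /dz_expands H; apply: expands_dz => e e0; have [d' d'0 Hd'] := H e e0.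
exists (Num.min d d'); first by rewrite lt_min d0.
move=> h; rewrite lt_min => /andP [hd /Hd'].
by rewrite E // -[in f z](addr0 z) E ?nm0 // addr0.
Qed.

Lemma deriv_const_line (V : normedModType C) (k : V -> C) (v : V) (d : R) : 0 < d ->
  differentiable k 0 -> (forall x : C, nm x < d -> k (x *: v) = k 0) -> 'd k 0 v = 0.
Proof.
move=> d0 dk Hk.
have dk' : differentiable k (0 + (0 : C) *: v) by rewrite scale0r addr0.
have [D E] := line_diff dk'; rewrite scale0r addr0 in E; rewrite -E.
have c0 : differentiable (fun _ : C => k 0) 0 by exact: fdiff_cst.
have [|_ ->] := @dz_near_eq (fun _ => k 0) (fun w : C => k (0 + w *: v)) 0 d d0 _ c0.
  by move=> h hd; rewrite !add0r Hk.
by rewrite dz_def diff_cst.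
Qed.

Lemma diff_near_id (V : normedModType C) (k : V -> V) (d : R) : 0 < d ->
  (forall x, nm x < d -> k x = x) -> forall v, 'd k 0 v = v.
Proof.
move=> d0 Hk v.
have Ex : expands k 0 id.
  move=> e e0; exists d => // h hd; rewrite add0r !Hk ?nm0 // subr0 subrr nm0.
  by apply: mulr_ge0; [exact: ltW|exact: nm_ge0].
have [||_ ->] := @expands_linear_diff R V V k 0 id 1 _ _ Ex; last by [].
- by [].
- by move=> w; rewrite mul1r.
Qed.

Lemma expands_comp (U V W : normedModType C) (f L : U -> V) (g M : V -> W) x K1 K2 :
  0 < K1 -> 0 < K2 -> (forall u v, M (u - v) = M u - M v) ->
  (forall v, nm (L v) <= K1 * nm v) -> (forall v, nm (M v) <= K2 * nm v) ->
  expands f x L -> expands g (f x) M -> expands (fun y => g (f y)) x (fun v => M (L v)).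
Proof.
move=> K10 K20 linM HK1 HK2 Ef Eg e e0.
pose e' := Num.min 1 (e / (2 * K2)).
have e'0 : 0 < e' by rewrite lt_min ltr01 divr_gt0 // mulr_gt0.
have [m1 m2] : e' <= 1 /\ e' <= e / (2 * K2) by rewrite !ge_min !lexx orbT.
clearbody e'.
have [d1 d10 Hd1] := Ef _ e'0.
have [|d2 d20 Hd2] := Eg (e / (2 * (K1 + 1))).
  by rewrite divr_gt0 // mulr_gt0 //; lra.
exists (Num.min d1 (d2 / (K1 + 1))).
  by rewrite lt_min d10 divr_gt0 //; lra.
move=> w; rewrite lt_min => /andP [/Hd1 h1 w2].
rewrite ltr_pdivlMr in w2; last by lra.
have n0 := nm_ge0 w.
set k := f (x + w) - f x in h1.
have h2 : nm (k - L w) <= nm w.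
  by apply: le_trans h1 _; rewrite -[leRHS]mul1r; apply: ler_wpM2r.
have fw : nm k <= (K1 + 1) * nm w.
  have := nmD (k - L w) (L w); rewrite subrK.
  by have := HK1 w; lra.
have := Hd2 k; rewrite {1}/k [f x + (_ - _)]addrC subrK => h3.
have {}h3 : nm (g (f (x + w)) - g (f x) - M k) <= e / (2 * (K1 + 1)) * nm k by apply: h3; lra.
have -> : g (f (x + w)) - g (f x) - M (L w) =
    (g (f (x + w)) - g (f x) - M k) + M (k - L w).
  by rewrite [M (k - L w)]linM addrA subrK.
apply: le_trans (nmD _ _) _.
have h4 : e / (2 * (K1 + 1)) * nm k <= e / 2 * nm w.
  rewrite (_ : e / 2 * nm w = e / (2 * (K1 + 1)) * ((K1 + 1) * nm w)).
    by apply: ler_wpM2l => //; apply: divr_ge0; lra.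
  by field; rewrite gt_eqF //; lra.
have h5 : nm (M (k - L w)) <= e / 2 * nm w.
  apply: le_trans (HK2 _) _.
  apply: le_trans (_ : K2 * (e / (2 * K2) * nm w) <= _).
    apply: ler_wpM2l; first exact: ltW.
    by apply: le_trans h1 _; apply: ler_wpM2r.
  by rewrite le_eqVlt; apply/orP; left; apply/eqP; field; rewrite gt_eqF.
lra.
Qed.

Lemma comp_near_id (V : normedModType C) (f g L M : V -> V) (d K1 K2 : R) : 0 < d ->
  0 < K1 -> 0 < K2 -> linear L -> linear M ->
  (forall v, nm (L v) <= K1 * nm v) -> (forall v, nm (M v) <= K2 * nm v) ->
  f 0 = 0 -> expands f 0 L -> expands g 0 M ->
  (forall x, nm x < d -> g (f x) = x) -> forall v, M (L v) = v.
Proof.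
move=> d0 K10 K20 linL linM HK1 HK2 f0 Ef Eg H v.
have linM' u w : M (u - w) = M u - M w.
  exact: (linear_sub linM).
have Eg' : expands g (f 0) M by rewrite f0.
have Ex := expands_comp K10 K20 linM' HK1 HK2 Ef Eg'.
have [a u w|w|_ E] := @expands_linear_diff R V V _ 0 (fun v => M (L v)) (K2 * K1) _ _ Ex.
- by rewrite linL linM.
- by apply: le_trans (HK2 _) _; rewrite -mulrA; apply: ler_wpM2l; [exact: ltW|exact: HK1].
by rewrite -[RHS](diff_near_id d0 H v) E.
Qed.

Lemma diff_comp_near_id (V : normedModType C) (f g : V -> V) (d : R) : 0 < d ->
  f 0 = 0 -> differentiable f 0 -> differentiable g 0 ->
  (forall x, nm x < d -> g (f x) = x) -> forall v, 'd g 0 ('d f 0 v) = v.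
Proof.
move=> d0 f0 df dg H.
have [K1 K10 HK1] := continuous_lin_bounded (diff_continuous df).
have [K2 K20 HK2] := continuous_lin_bounded (diff_continuous dg).
have Ef := diff_expands df; have Eg := diff_expands dg.
have L1 : linear ('d f 0) by move=> a u w; rewrite linearP.
have L2 : linear ('d g 0) by move=> a u w; rewrite linearP.
exact: (comp_near_id d0 K10 K20 L1 L2 HK1 HK2 f0 Ef Eg H).
Qed.

(** The derivative of the inverse map inverts the derivative. *)
Lemma biholomorphic_diff (V : normedModType C) (f : V -> V) (U W : set V) :
  U 0 -> f 0 = 0 -> biholomorphic f U W ->
  exists A : V -> V, (forall v, 'd f 0 (A v) = v) /\ (forall v, A ('d f 0 v) = v).
Proof.
move=> U0 f0 [[Uo Uf] [g [[Wo Wg] H1 H2]]].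
have [W0 g0] : W 0 /\ g 0 = 0 by have := H1 0 U0; rewrite f0.
have /nbhs_nm [d d0 Hd] : nbhs (0 : V) U by apply: open_nbhs_nbhs.
have /nbhs_nm [d' d'0 Hd'] : nbhs (0 : V) W by apply: open_nbhs_nbhs.
have df := Uf 0 U0; have dg := Wg 0 W0.
exists ('d g 0); split.
  apply: (diff_comp_near_id d'0) => // x xd.
  by have [] := H2 x (Hd' x _); rewrite ?subr0.
apply: (diff_comp_near_id d0) => // x xd.
by have [] := H1 x (Hd x _); rewrite ?subr0.
Qed.

Lemma invertible_germ_dz (f : C -> C) : invertible_germ f ->
  [/\ f 0 = 0, holomorphic_near f 0 & dz f 0 != 0].
Proof.
move=> [f0 [U [W [U0 bih]]]]; split=> //; first by exists U => //; case: bih.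
have [A [HA _]] := biholomorphic_diff U0 f0 bih.
apply/negP => /eqP d0; have := HA 1; rewrite dz_lin d0 mul0r => /eqP.
by rewrite eq_sym oner_eq0.
Qed.

Variable n : nat.
Local Notation V := ('rV[C]_n * C)%type.

Lemma z1z2Fs_diff (Fs : 'I_n -> V -> C) :
  (forall j : 'I_n, (1 < j)%N -> differentiable (Fs j) 0) ->
  differentiable (z1z2Fs Fs) 0 /\ forall v j, ('d (z1z2Fs Fs) 0 v) 0 j =
    if (j < 2)%N then v 0 j else 'd (Fs j) 0 (v, 0).
Proof.
move=> H.
have Hj j : differentiable (fun z => z1z2Fs Fs z 0 j) 0 /\
   forall v, 'd (fun z => z1z2Fs Fs z 0 j) 0 v = if (j < 2)%N then v 0 j else 'd (Fs j) 0 (v, 0).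
  have -> : (fun z => z1z2Fs Fs z 0 j) = (fun z => if (j < 2)%N then z 0 j else Fs j (z, 0)).
    by apply: funext => z; rewrite mxE.
  case: ltnP => j2.
    have [|||D E] := @coord_diff R 'rV[C]_n 'rV[C]_n id (fun z => z 0 j) 0.
    - by move=> a u v; rewrite !mxE.
    - by move=> w; exact: nm_coord.
    - exact: fdiff_id.
    split=> // v; rewrite E.
    by have := @diff_near_id 'rV[C]_n id 1 ltr01 (fun _ _ => erefl) v => ->.
  have dj := H j j2.
  have [K K0 HK] := continuous_lin_bounded (diff_continuous dj).
  have np (v : 'rV[C]_n) : nm ((v, 0) : V) <= nm v.
    by apply: nm_pair_le => //=; rewrite nm0 nm_ge0.
  have Ex : expands (fun z => Fs j (z, 0)) 0 (fun v => 'd (Fs j) 0 (v, 0)).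
    move=> e e0; have [d d0 Hd] := diff_expands dj e0; exists d => // h hd.
    have := Hd (h, 0) (le_lt_trans (np h) hd); rewrite !add0r => H'.
    by apply: le_trans H' _; apply: ler_wpM2l; [exact: ltW|exact: np].
  have [a u v|v|D E] := @expands_linear_diff R _ _ _ (0 : 'rV[C]_n) (fun v => 'd (Fs j) 0 (v, 0)) K _ _ Ex.
  - rewrite -linearP; congr ('d (Fs j) 0 _); congr pair => /=.
    by rewrite addr0 -[a *: 0]/(a * 0) mulr0.
  - by apply: le_trans (HK _) _; apply: ler_wpM2l; [exact: ltW|exact: np].
  by split=> // v; rewrite E.
have [|D E] := @row_diff 'rV[C]_n n (z1z2Fs Fs) 0; first by move=> j; case: (Hj j).
by split=> // v j; rewrite E; case: (Hj j).
Qed.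

(** Full rank is injectivity of the derivative; this avoids any computation with
    the Jacobian matrix. *)
Lemma rank_at_originP (Fs : 'I_n -> V -> C) :
  rank_at_origin Fs = n <-> forall v, 'd (z1z2Fs Fs) 0 v = 0 -> v = 0.
Proof.
rewrite /rank_at_origin /jacobian; set A := lin1_mx _.
have mA v : v *m A = 'd (z1z2Fs Fs) 0 v by rewrite mul_rV_lin1.
split=> [rk v|H].
  rewrite -mA => vA; have : row_free A by rewrite /row_free rk.
  by move=> /row_free_inj; apply; rewrite vA mul0mx.
by apply/eqP; apply: inj_row_free => v; rewrite mA; exact: H.
Qed.

End Derivatives.

(** * Structure of automorphisms *)

Section Necessity.
Variables (R : realType) (n : nat) (hn : (1 < n)%N).
Local Notation C := (Cplx R).
Local Notation V := ('rV[C]_n * C)%type.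
Local Notation z1 := (z1 (R := R) hn).
Local Notation z2 := (z2 (R := R) hn).
Local Notation e1 := (e1 R hn).
Local Notation e2 := (e2 R hn).

Lemma diff_bounded (U W : normedModType C) (F : U -> W) : differentiable F 0 ->
  exists d B : R, 0 < d /\ forall p, nm p < d -> nm (F p) <= B.
Proof.
move=> dF; have [K K0 HK] := continuous_lin_bounded (diff_continuous dF).
have E := diff_expands dF; move: HK E; set L := 'd F 0 => HK E.
have LK v : nm (L v) <= K * nm v by exact: HK.
have [d d0 Hd] := E 1 ltr01.
clearbody L.
exists d, (nm (F 0) + (K + 1) * d); split=> // p pd.
have := Hd p pd; rewrite add0r mul1r => h.
have q := LK p.
have := nmD (F p - F 0 - L p) (L p); rewrite subrK => h2.
have := nmD (F p - F 0) (F 0); rewrite subrK => h3.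
have : (K + 1) * nm p <= (K + 1) * d by apply: ler_wpM2l; [lra|exact: ltW].
lra.
Qed.

Lemma z1_e1 (x w : C) : z1 (x *: e1, w) = x.
Proof. by rewrite /Defs.z1 /= !mxE !eqxx mulr1. Qed.

Lemma autom_facts (F : V -> V) : local_automorphism (quadric hn) F ->
  F 0 = 0 /\ (exists A : V -> V, (forall v, 'd F 0 (A v) = v) /\ (forall v, A ('d F 0 v) = v)) /\
  exists rho B : R, [/\ 0 < rho,
    forall p, nm p < rho -> differentiable F p,
    forall p, nm p < rho -> nm (F p) <= B &
    forall p, nm p < rho -> quadric hn p -> quadric hn (F p)].
Proof.
move=> [F0 [U [W [U0 bih im]]]]; split=> //; split; first exact: biholomorphic_diff bih.
have [[Uo Uf] _] := bih.
have /nbhs_nm [d d0 Hd] : nbhs (0 : V) U by apply: open_nbhs_nbhs.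
have [d' [B [d'0 HB]]] := diff_bounded (Uf 0 U0).
exists (Num.min d d'), B; split.
- by rewrite lt_min d0.
- by move=> p; rewrite lt_min => /andP [pd _]; apply/Uf/Hd; rewrite subr0.
- by move=> p; rewrite lt_min => /andP [_ /HB].
- move=> p; rewrite lt_min => /andP [pd _] Mp.
  have : (quadric hn `&` W) (F p) by rewrite -im; exists p => //; split=> //; apply: Hd; rewrite subr0.
  by case.
Qed.

(** The derivative of an automorphism is onto, so some direction [u] is sent to
    [e_1]; since [F_1 = f_1 (z_1)], the derivative of [f_1] times [z_1 u] is [1]. *)
Lemma first_factor_dz (F : V -> V) (A : V -> V) (rho d : R) : 0 < rho ->
  (forall p, nm p < rho -> differentiable F p) ->
  0 < d -> (forall p, nm p < d -> z1 (F p) = first_factor hn F (z1 p)) ->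
  (forall v, 'd F 0 (A v) = v) -> dz (first_factor hn F) 0 != 0.
Proof.
move=> r0 dF d0 H1 HA; set f1 := first_factor hn F.
have dF0 : differentiable F 0 by apply: dF; rewrite nm0.
have [D1 E1] := coord_diff (z1_lin hn) (z1_nm hn) dF0.
pose u := A ((e1, 0) : V).
have E2 : 'd (fun p => z1 (F p)) 0 u = 1.
  by rewrite E1 HA -[e1]scale1r z1_e1.
have D1' : differentiable (fun p => z1 (F p)) (0 + (0 : C) *: u) by rewrite scale0r addr0.
have [D3 E3] := line_diff D1'.
rewrite scale0r addr0 E2 in E3.
have df1 : differentiable f1 0.
  have hol1 : hol_ball f1 0 rho by exact: first_factor_hol.
  by apply: hol1; rewrite subr0 nm0.
have df1' : differentiable f1 (0 + (0 : C) *: (z1 u : C^o)) by rewrite scale0r addr0.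
have [D4 E4] := line_diff df1'.
rewrite scale0r addr0 dz_lin in E4.
have u1 : 0 < nm u + 1 by have := nm_ge0 u; lra.
have [||_ E5] := @dz_near_eq R _ (fun w => f1 (0 + w *: (z1 u : C^o))) 0 (d / (nm u + 1)) _ _ D3.
- by rewrite divr_gt0.
- move=> w; rewrite ltr_pdivlMr // => wd.
  rewrite !add0r H1.
    by congr f1; have := z1_lin hn w u 0; rewrite addr0 => ->; rewrite /Defs.z1 mxE addr0.
  rewrite nmZ; apply: le_lt_trans wd; apply: ler_wpM2l; first exact: nm_ge0.
  by rewrite lerDl.
apply/negP => /eqP f10; move: E5; rewrite E3 E4 f10 mul0r => /eqP.
by rewrite eq_sym oner_eq0.
Qed.

Definition small_formulas (F : V -> V) (d : R) :=
  [/\ forall p, nm p < d -> differentiable F p,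
      forall p, nm p < d -> z1 (F p) = first_factor hn F (z1 p) &
      forall (p : V) (t : C), nm p < d -> nm t < d -> t ^+ 2 + t * z2 p = p.2 ->
       z2 (F p) = - (cbar (first_factor hn F) t + cbar (first_factor hn F) (- t - z2 p)) /\
       (F p).2 = - (cbar (first_factor hn F) t * cbar (first_factor hn F) (- t - z2 p))].

Lemma autom_formulas (F : V -> V) : local_automorphism (quadric hn) F ->
  exists2 d : R, 0 < d & small_formulas F d.
Proof.
move=> aF; have [F0 [[A [HA _]] [rho [B [r0 dF bF FM]]]]] := autom_facts aF.
have [d d0 H1] := F1_first_near r0 dF bF FM.
have df1 := first_factor_dz r0 dF d0 H1 HA.
have [d' d'0 H2] := symmetric_formulas r0 dF bF FM df1.
exists (Num.min (Num.min d d') rho); first by rewrite !lt_min d0 d'0.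
split.
- by move=> p; rewrite !lt_min => /andP [_ /dF].
- by move=> p; rewrite !lt_min => /andP [/andP [/H1]].
- move=> p t; rewrite !lt_min => /andP [/andP [_ pd] _] /andP [/andP [_ td] _].
  exact: H2.
Qed.

Lemma quadric_root (p : V) (d : R) : 0 < d -> nm p < (Num.min d 1 / 4) ^+ 2 ->
  exists2 t : C, t ^+ 2 + t * z2 p = p.2 & nm t < d.
Proof.
move=> d0; pose e := Num.min d 1 / 4; rewrite -/e => pd.
have [e0 ed e1] : [/\ 0 < e, 4 * e <= d & 4 * e <= 1].
  have h1 : Num.min d 1 <= d by rewrite ge_min lexx.
  have h2 : Num.min d 1 <= 1 by rewrite ge_min lexx orbT.
  have h3 : 0 < Num.min d 1 by rewrite lt_min d0 ltr01.
  by rewrite /e; split; lra.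
clearbody e.
have e2e : e ^+ 2 <= e by rewrite expr2 ler_piMl //; lra.
have zp := z2_nm hn p; have wp := nm_pair2 p.
have [|||t E tn] := @small_quadratic_root R (z2 p) p.2 e.
- by [].
- lra.
- lra.
by exists t => //; lra.
Qed.

Lemma linear_bounded_diff (U W : normedModType C) (L : U -> W) K x :
  linear L -> (forall v, nm (L v) <= K * nm v) -> differentiable L x.
Proof.
move=> linL HK; have [|//] := @expands_linear_diff R U W L x L K linL HK.
move=> e e0; exists 1 => // h _.
have := linL 1 x h; rewrite !scale1r => ->.
rewrite [L x + _]addrC addrK subrr nm0.
by apply: mulr_ge0; [exact: ltW|exact: nm_ge0].
Qed.

(** A right inverse of [p |-> (z_2, w)]; composing with it turns [F_2] and [G] into
    functions of [z_2] and [w]. *)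
Definition emb (x : C * C) : V := (x.1 *: e2, x.2).

Lemma emb_diff x : differentiable emb x.
Proof.
apply: (@linear_bounded_diff _ _ _ 1) => [a u v|v].
  by rewrite /emb; congr pair => /=; rewrite scalerDl scalerA.
rewrite mul1r; have h2 := nm_pair2 v; apply: nm_pair_le; rewrite /emb /=; last exact: h2.
rewrite nmZ; have := nm_pair1 v.
have : nm v.1 * nm e2 <= nm v.1 * 1 by apply: ler_wpM2l; [exact: nm_ge0|exact: nm_delta].
lra.
Qed.

Lemma emb_nm x : nm (emb x) <= nm x.
Proof.
have h2 := nm_pair2 x; apply: nm_pair_le; rewrite /emb /=; last exact: h2.
rewrite nmZ; have := nm_pair1 x.
have : nm x.1 * nm e2 <= nm x.1 * 1 by apply: ler_wpM2l; [exact: nm_ge0|exact: nm_delta].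
lra.
Qed.

Lemma z2_emb (x : C * C) : z2 (emb x) = x.1.
Proof. by rewrite /Defs.z2 /emb /= !mxE !eqxx mulr1. Qed.

Lemma near2_nm (P : C -> C -> Prop) (d : R) : 0 < d ->
  (forall a b, nm a < d -> nm b < d -> P a b) ->
  \forall a \near (0 : C) & b \near (0 : C), P a b.
Proof.
move=> d0 H; exists ([set a : C | nm a < d], [set a : C | nm a < d]).
  by split; apply/(@nbhs_nm R C 0 (fun a => nm a < d)); exists d => // y; rewrite subr0.
by move=> [a b] /= [ad bd]; exact: H.
Qed.

(** The root formulas give the same values at [p] and at [emb (z_2, w)], as these
    points have the same roots. *)
Lemma autom_shape (F : V -> V) : local_automorphism (quadric hn) F ->
  exists (f1 : C -> C) (f2 g : C * C -> C),
    [/\ holomorphic_near f1 0, holomorphic_near f2 0, holomorphic_near g 0,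
     \forall p \near (0 : V), [/\ z1 (F p) = f1 (z1 p), z2 (F p) = f2 (z2 p, p.2) & (F p).2 = g (z2 p, p.2)] &
     \forall a \near (0 : C) & b \near (0 : C),
            f2 (b, a * b + a ^+ 2) = - (cbar f1 a + cbar f1 (- a - b)) /\
            g (b, a * b + a ^+ 2) = - (cbar f1 a * cbar f1 (- a - b))].
Proof.
move=> /autom_formulas [d d0 [dF H1 H2]].
pose f1 := first_factor hn F.
exists f1, (fun x => z2 (F (emb x))), (fun x => (F (emb x)).2).
have dFe x : nm (x - 0) < d -> differentiable (fun x => F (emb x)) x.
  rewrite subr0 => xd; apply: (fdiff_comp (emb_diff x)); apply: dF.
  exact: le_lt_trans (emb_nm x) xd.
split.
- by apply/holomorphic_nearP; exists d => //; exact: first_factor_hol.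
- apply/holomorphic_nearP; exists d => // x /dFe D.
  by have [] := coord_diff (z2_lin hn) (z2_nm hn) D.
- apply/holomorphic_nearP; exists d => // x /dFe D.
  by have [] := coord_diff (@snd_lin R n) (@nm_pair2 R _ _) D.
- apply/nbhs_nm; exists (Num.min d ((Num.min d 1 / 4) ^+ 2)).
    by rewrite lt_min d0 exprn_gt0 // divr_gt0 // lt_min d0 ltr01.
  move=> p; rewrite subr0 lt_min => /andP [pd /(quadric_root d0) [t E td]].
  have pd' : nm (emb (z2 p, p.2)) < d.
    apply: le_lt_trans (emb_nm _) _; rewrite nm_pairE gt_max /=.
    by rewrite (le_lt_trans (z2_nm hn p) pd) (le_lt_trans (nm_pair2 p) pd).
  have E' : t ^+ 2 + t * z2 (emb (z2 p, p.2)) = (emb (z2 p, p.2)).2 by rewrite z2_emb.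
  have [h1 h2] := H2 p t pd td E; have [h3 h4] := H2 _ t pd' td E'.
  rewrite z2_emb in h3 h4.
  by split; [exact: H1|rewrite h1 h3|rewrite h2 h4].
- have [m0 md m1] : [/\ 0 < Num.min d 1 / 2, 2 * (Num.min d 1 / 2) <= d & 2 * (Num.min d 1 / 2) <= 1].
    have h1 : Num.min d 1 <= d by rewrite ge_min lexx.
    have h2 : Num.min d 1 <= 1 by rewrite ge_min lexx orbT.
    have h3 : 0 < Num.min d 1 by rewrite lt_min d0 ltr01.
    by split; lra.
  apply: (near2_nm m0) => a b; move: (Num.min d 1 / 2) m0 md m1 => m m0 md m1 am bm.
  have := H2 (emb (b, a * b + a ^+ 2)) a; rewrite z2_emb /=; apply.
  + apply: le_lt_trans (emb_nm _) _; rewrite nm_pairE gt_max /=; apply/andP; split; first lra.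
    apply: le_lt_trans (nmD _ _) _; rewrite nmM nmX expr2.
    have a0 := nm_ge0 a; have b0 := nm_ge0 b.
    have : nm a * nm b <= 1 * nm b by apply: ler_wpM2r => //; lra.
    have : nm a * nm a <= 1 * nm a by apply: ler_wpM2r => //; lra.
    lra.
  + lra.
  + by rewrite addrC.
Qed.

(** A vector [v] in the kernel of [(z_1, z_2, F_3, ..., F_n)] has [z_1 = z_2 = 0], and
    [F_1], [F_2], [G] depend on [z_1], [z_2] and [w] only; so the derivative of
    the automorphism kills [(v, 0)]. *)
Lemma autom_rank (F : V -> V) : local_automorphism (quadric hn) F ->
  rank_at_origin (fun j p => (F p).1 0 j) = n.
Proof.
move=> aF; have [d d0 [dF H1 H2]] := autom_formulas aF.
have [F0 [[A [_ HA]] _]] := autom_facts aF.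
have dF0 : differentiable F 0 by apply: dF; rewrite nm0.
have dj (j : 'I_n) : differentiable (fun p => (F p).1 0 j) 0 /\
    forall v, 'd (fun p => (F p).1 0 j) 0 v = ('d F 0 v).1 0 j.
  apply: (@coord_diff R V V F (fun q => q.1 0 j) 0) => //.
    by move=> a u v; rewrite /= !mxE.
  by move=> w; apply: le_trans (nm_coord _ _) (nm_pair1 _).
have [_ dZ] := z1z2Fs_diff (fun j _ => proj1 (dj j)).
apply/rank_at_originP => v vZ.
have v12 (j : 'I_n) : (j < 2)%N -> v 0 j = 0.
  by move=> j2; have := dZ v j; rewrite vZ j2 mxE => <-.
pose d' := d / (nm v + 1).
have v1 : 0 < nm v + 1 by have := nm_ge0 v; lra.
have d'0 : 0 < d' by rewrite divr_gt0.
have small (x : C) : nm x < d' -> nm (x *: ((v, 0) : V)) < d.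
  rewrite ltr_pdivlMr // nmZ => xd; apply: le_lt_trans xd; apply: ler_wpM2l; first exact: nm_ge0.
  by apply: nm_pair_le => /=; rewrite ?nm0; lra.
have zz1 (x : C) : z1 (x *: ((v, 0) : V)) = 0 by rewrite /Defs.z1 /= mxE v12 // mulr0.
have zz2 (x : C) : z2 (x *: ((v, 0) : V)) = 0 by rewrite /Defs.z2 /= mxE v12 // mulr0.
have ww (x : C) : (x *: ((v, 0) : V)).2 = 0 by rewrite /= -[x *: 0]/(x * 0) mulr0.
have dd : nm (0 : C) < d by rewrite nm0.
have for2 (x : C) : nm x < d' -> _ := fun xd => H2 _ 0 (small x xd) dd.
have form (x : C) : nm x < d' ->
    z2 (F (x *: ((v, 0) : V))) = - (cbar (first_factor hn F) 0 + cbar (first_factor hn F) (- 0 - 0)) /\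
    (F (x *: ((v, 0) : V))).2 = - (cbar (first_factor hn F) 0 * cbar (first_factor hn F) (- 0 - 0)).
  by move=> /for2; rewrite zz2 ww mul0r expr0n addr0; apply.
have z00 : nm (0 : C) < d' by rewrite nm0.
have s0 : (0 : C) *: ((v, 0) : V) = 0 by rewrite scale0r.
have k1 : z1 ('d F 0 (v, 0)) = 0.
  have [D E] := coord_diff (z1_lin hn) (z1_nm hn) dF0; rewrite -E.
  apply: (deriv_const_line d'0 D) => x xd.
  by rewrite H1 ?small // zz1 -s0 H1 ?small // zz1.
have k2 : z2 ('d F 0 (v, 0)) = 0.
  have [D E] := coord_diff (z2_lin hn) (z2_nm hn) dF0; rewrite -E.
  apply: (deriv_const_line d'0 D) => x xd.
  by have [-> _] := form x xd; rewrite -s0; have [-> _] := form 0 z00.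
have k3 : ('d F 0 (v, 0)).2 = 0.
  have [D E] := coord_diff (@snd_lin R n) (@nm_pair2 R _ _) dF0; rewrite -E.
  apply: (deriv_const_line d'0 D) => x xd.
  by have [_ ->] := form x xd; rewrite -s0; have [_ ->] := form 0 z00.
have zero : 'd F 0 (v, 0) = 0.
  rewrite [LHS]surjective_pairing k3; congr pair; apply/rowP => j; rewrite [RHS]mxE.
  case: (ltnP j 2) => j2.
    case: j j2 => -[|[|//]] jn _.
      have -> : Ordinal jn = idx1 hn by apply: val_inj.
      exact: k1.
    have -> : Ordinal jn = idx2 hn by apply: val_inj.
    exact: k2.
  have [_ dj2] := dj j; rewrite -dj2.
  by have := dZ v j; rewrite vZ mxE ltnNge j2 /= => e0; rewrite -e0.
have : A 0 = 0 by have := HA 0; rewrite linear0.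
by have := HA (v, 0); rewrite zero => -> [].
Qed.

(** Both sides of the conclusion are given by the root formulas, which involve the
    first component only. *)
Lemma autom_determined (F F' : V -> V) :
  local_automorphism (quadric hn) F -> local_automorphism (quadric hn) F' ->
  (\forall p \near (0 : V), z1 (F p) = z1 (F' p)) ->
  \forall p \near (0 : V), z2 (F p) = z2 (F' p) /\ (F p).2 = (F' p).2.
Proof.
move=> /autom_formulas [d d0 [_ _ H]] /autom_formulas [d' d'0 [_ _ H']] /nbhs_nm [r r0 Hr].
pose m := Num.min (Num.min d d') (r / 2).
have m0 : 0 < m by rewrite !lt_min d0 d'0 divr_gt0.
have [md md' mr] : [/\ m <= d, m <= d' & 2 * m <= r].
  have h1 : m <= d by rewrite !ge_min lexx.
  have h2 : m <= d' by rewrite !ge_min lexx !orbT.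
  have h3 : m <= r / 2 by rewrite !ge_min lexx !orbT.
  by split; lra.
clearbody m.
have E (x : C) : nm x < 2 * m -> first_factor hn F x = first_factor hn F' x.
  move=> xm; apply: Hr; rewrite subr0.
  rewrite nm_pairE gt_max /= nm0 r0 andbT nmZ.
  have : nm x * nm e1 <= nm x * 1 by apply: ler_wpM2l; [exact: nm_ge0|exact: nm_delta].
  lra.
apply/nbhs_nm; exists (Num.min m ((Num.min m 1 / 4) ^+ 2)).
  by rewrite lt_min m0 exprn_gt0 // divr_gt0 // lt_min m0 ltr01.
move=> p; rewrite subr0 lt_min => /andP [pm /(quadric_root m0) [t Et tm]].
have [||-> ->] := H p t _ _ Et; [lra|lra|].
have [||-> ->] := H' p t _ _ Et; [lra|lra|].
have zm := z2_nm hn p.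
rewrite /cbar !E ?nm_conj; [by []| |lra].
by have := nmB (- t) (z2 p); rewrite nmN; lra.
Qed.

End Necessity.

(** * The inverse function theorem *)

(** Rearrangements of differences in an arbitrary additive group, where [ring] does
    not apply. *)
Lemma zmod_shuffle (V : zmodType) (y a b c e : V) :
  y - (a - b) - (y - (c - e)) = - (a - c - (b - e)).
Proof.
rewrite [in RHS]opprB [in RHS]opprB [- (y - _)]opprB [in LHS]addrC addrA subrK opprB.
by rewrite addrACA [RHS]addrACA [c + b]addrC.
Qed.

Lemma subr_via (V : zmodType) (w u v : V) : u - v = (w - v) - (w - u).
Proof. by rewrite opprB [RHS]addrC [RHS]addrA subrK. Qed.

Section InverseFunction.
Variable R : realType.
Local Notation C := (Cplx R).

Definition strict_diff (V W : normedModType C) (f A : V -> W) :=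
  forall e : R, 0 < e -> exists2 d : R, 0 < d & forall x y, nm x < d -> nm y < d ->
    nm (f x - f y - A (x - y)) <= e * nm (x - y).

(** Differentiability at [0] makes the remainder [g = f - 'd f 0] small compared
    with the radius [m] of a ball; Cauchy's estimate on the complex line through
    [x] and [y], of which the ball contains a disc of radius about
    [m / |x - y|], then bounds [g x - g y] by a small multiple of [|x - y|]. *)
Lemma strict_scalar (V : normedModType C) (f : V -> C) (r : R) : 0 < r ->
  (forall p, nm p < r -> differentiable f p) -> strict_diff f ('d f 0).
Proof.
move=> r0 df e e0.
have df0 : differentiable f 0 by apply: df; rewrite nm0.
have [K K0 HK] := continuous_lin_bounded (diff_continuous df0).
have lin : linear ('d f 0 : V -> C^o) by move=> a u v; rewrite linearP.
have Ef := diff_expands df0.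
move: HK lin Ef; set A : V -> C := 'd f 0 => HK lin Ef.
have HA v : nm (A v) <= K * nm v by exact: HK.
clearbody A.
have AB u v : A (u - v) = A u - A v.
  exact: (linear_sub lin).
have A0 : A 0 = 0 by rewrite -(subrr 0) AB subrr.
have dA p : differentiable A p.
  by apply: (@linear_bounded_diff R V C A K p) => [a u v|//]; rewrite lin.
have [|d d0 Hd] := Ef (e / 48); first by lra.
pose m := Num.min d r.
have [md mr m0] : [/\ m <= d, m <= r & 0 < m].
  by rewrite /m lt_min d0 r0 !ge_min !lexx orbT.
clearbody m.
pose g p := f p - A p.
have dg p : nm p < m -> differentiable g p.
  by move=> pm; apply: fdiffB; [apply: df; lra|exact: dA].
have gb p : nm p < m -> nm (g p - g 0) <= e / 48 * m.
  move=> pm; have := Hd p; rewrite add0r => h.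
  have {}h : nm (f p - f 0 - A p) <= e / 48 * nm p by apply: h; lra.
  have -> : g p - g 0 = f p - f 0 - A p.
    have -> : A p = A p - A 0 by rewrite -AB subr0.
    by rewrite /g; ring.
  apply: le_trans h _; apply: ler_wpM2l; lra.
exists (m / 10); first by lra.
move=> x y xm ym.
have [->|xy] := eqVneq x y; first by rewrite !subrr A0 subrr !nm0 mulr0.
have s0 : 0 < nm (x - y) by rewrite nm_gt0 subr_eq0.
set s := nm (x - y) in s0 *.
have sm : s < m / 5 by have := nmB x y; rewrite -/s; lra.
pose Rr := m / (2 * s).
have R0 : 0 < Rr by rewrite divr_gt0 // mulr_gt0.
have near (z : C) : nm z < Rr -> nm (y + z *: (x - y)) < m.
  rewrite /Rr ltr_pdivlMr ?mulr_gt0 // => h.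
  have := nmD y (z *: (x - y)); rewrite nmZ -/s; lra.
pose psi (z : C) := g (y + z *: (x - y)).
have hol z : nm z < Rr -> differentiable psi z.
  by move=> /near /dg D; have [] := line_diff D.
have R1 : 1 < Rr / 2.
  rewrite /Rr ltr_pdivlMr // mul1r ltr_pdivlMr ?mulr_gt0 //; lra.
have E : f x - f y - A (x - y) = psi 1 - psi 0.
  rewrite /psi scale1r scale0r addr0 [y + (x - y)]addrC subrK /g AB; ring.
have := @mean_value_bound R psi 0 (Rr / 2) (e * s).
move=> M; have := M _ _ 0 1; rewrite !subr0 nm0 nm1 mulr1 -E => {}M.
apply: M; [by move=> z; rewrite subr0 => zr; apply: hol; lra| |lra|exact: R1].
move=> z; rewrite subr0 => zr.
have nz w : nm (w - z) < Rr / 2 -> nm w < Rr by have := nmD (w - z) z; rewrite subrK; lra.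
rewrite (_ : e * s = 6 * (2 * (e / 48 * m)) / (Rr / 2)); last first.
  by rewrite /Rr; field; rewrite ?gt_eqF.
apply: cauchy_ball; first lra.
  by move=> w /nz /hol.
move=> w /nz wr; have h1 := gb _ (near w wr).
have zr' : nm z < Rr by lra.
have h2 := gb _ (near z zr').
have := nm_split (g 0) (psi w) (psi z); rewrite [nm (g 0 - _)]nmBC; rewrite /psi; lra.
Qed.

(** Picard iteration of [x |-> y - (T x - x)], a contraction of ratio [1 / 3]. *)
Lemma near_identity_onto (V : normedModType C) (T : V -> V) (d : R) :
  nested_complete V -> 0 < d -> T 0 = 0 ->
  (forall x y, nm x < d -> nm y < d -> nm (T x - T y - (x - y)) <= 3^-1 * nm (x - y)) ->
  forall y, nm y < d / 4 -> exists2 x, nm x < d & T x = y.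
Proof.
move=> cV d0 T0 HT y yd; have y0 := nm_ge0 y.
pose phi x := y - (T x - x).
have Hphi x x' : nm x < d -> nm x' < d -> nm (phi x - phi x') <= 3^-1 * nm (x - x').
  move=> xd xd'; suff -> : phi x - phi x' = - (T x - T x' - (x - x')) by rewrite nmN HT.
  exact: zmod_shuffle.
have q0 k : 0 <= (3^-1 : R) ^+ k by rewrite exprn_ge0.
pose u k := iter k phi 0.
have step k : nm (u k) < d /\ nm (u k.+1 - u k) <= 3^-1 ^+ k * nm y /\
    nm (u k) <= 3 / 2 * (1 - 3^-1 ^+ k) * nm y.
  elim: k => [|k [IH1 [IH2 IH3]]].
    rewrite /u /= nm0 expr0 mul1r subrr mulr0 mul0r lexx d0; split=> //; split=> //.
    by rewrite /phi T0 subrr !subr0.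
  have b : nm (u k.+1) <= 3 / 2 * (1 - 3^-1 ^+ k.+1) * nm y.
    have := nmD (u k.+1 - u k) (u k); rewrite subrK => h.
    have -> : 3 / 2 * (1 - 3^-1 ^+ k.+1) * nm y = 3^-1 ^+ k * nm y + 3 / 2 * (1 - 3^-1 ^+ k) * nm y.
      by rewrite exprS; field.
    lra.
  have bd : nm (u k.+1) < d.
    apply: le_lt_trans b _.
    have := mulr_ge0 (q0 k.+1) y0; lra.
  split=> //; split=> //.
  rewrite exprS -mulrA; apply: le_trans (Hphi _ _ bd IH1) _.
  by apply: ler_wpM2l.
have [|l Hl] := cV u (fun m => 3 / 2 * 3^-1 ^+ m * nm y).
  move=> m k mk; rewrite -(subnK mk); move: (k - m)%N => {mk}k.
  suff : nm (u (k + m)%N - u m) <= 3 / 2 * (3^-1 ^+ m - 3^-1 ^+ (k + m)) * nm y.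
    move=> h; apply: le_trans h _; apply: ler_wpM2r => //.
    have := q0 (k + m)%N; lra.
  elim: k => [|k IH]; first by rewrite add0n !subrr nm0 mulr0 mul0r.
  have [_ [h _]] := step (k + m)%N.
  have := nm_split (u (k + m)%N) (u (k + m).+1) (u m).
  rewrite addSn exprS.
  have -> : 3 / 2 * (3^-1 ^+ m - 3^-1 * 3^-1 ^+ (k + m)) * nm y =
     3^-1 ^+ (k + m) * nm y + 3 / 2 * (3^-1 ^+ m - 3^-1 ^+ (k + m)) * nm y by field.
  lra.
have ld : nm l < d.
  by have := Hl 0%N; rewrite /u /= sub0r nmN expr0 mulr1; lra.
exists l => //.
suff : nm (phi l - l) = 0.
  move/eqP; rewrite nm_eq0 subr_eq0 /phi => /eqP E.
  by move/eqP: E; rewrite subr_eq addrC subrK => /eqP ->.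
apply/le_anti; rewrite nm_ge0 andbT leNgt; apply/negP => p0.
have y1 : 0 < nm y + 1 by lra.
have [m Hm] : exists m, 3^-1 ^+ m < nm (phi l - l) / (6 * (nm y + 1)).
  by apply: triadic_pow_small; rewrite divr_gt0 // mulr_gt0.
have {}Hm : 6 * (3^-1 ^+ m * nm y) < nm (phi l - l).
  move: Hm; rewrite ltr_pdivlMr ?mulr_gt0 // => Hm; apply: le_lt_trans Hm.
  have := q0 m; lra.
have [um _] := step m.
have h1 := Hl m; have h2 := Hl m.+1; rewrite exprS in h2.
have h3 := Hphi l (u m) ld um.
have := nm_split (u m.+1) (phi l) l; rewrite -/(phi (u m)) -[u m.+1]/(phi (u m)).
rewrite [nm (l - u m)]nmBC in h3; rewrite -[u m.+1]/(phi (u m)) in h2.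
have := mulr_ge0 (q0 m) y0; lra.
Qed.

Lemma linear_perturbation_onto (V : normedModType C) (D : V -> V) :
  nested_complete V -> linear D -> (forall v, nm (D v - v) <= 3^-1 * nm v) ->
  forall y, exists x, D x = y.
Proof.
move=> cV linD HD y.
have DB u v : D (u - v) = D u - D v.
  exact: (linear_sub linD).
have D0 : D 0 = 0 by have := DB 0 0; rewrite !subrr.
have y0 := nm_ge0 y.
have [|a b _ _||x _ <-] := @near_identity_onto V D (4 * nm y + 4) cV _ D0 _ y; last by exists x.
- lra.
- by rewrite -DB HD.
- lra.
Qed.

(** Apply [near_identity_onto] to [T = B \o f]. The inverse is differentiable at
    the image of a point [x] because [B \o 'd f x] is still a perturbation of the
    identity, hence invertible, and because [f] is expanding near [0]. *)
Lemma inverse_function (V : normedModType C) (f A B : V -> V) (r K : R) :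
  nested_complete V -> 0 < r -> f 0 = 0 ->
  (forall p, nm p < r -> differentiable f p) ->
  strict_diff f A -> linear A -> linear B -> 0 < K -> (forall v, nm (B v) <= K * nm v) ->
  (forall v, B (A v) = v) -> (forall v, A (B v) = v) ->
  forall r', 0 < r' -> exists U W : set V,
    [/\ U 0, (forall p, U p -> nm p < r') & biholomorphic f U W].
Proof.
move=> cV r0 f0 df sf linA linB K0 HK BA AB r' r'0.
have [|d1 d10 Hd1] := sf (3^-1 / K); first by rewrite divr_gt0.
pose d := Num.min (Num.min d1 r) r'.
have [d0 dd1 dr dr'] : [/\ 0 < d, d <= d1, d <= r & d <= r'].
  by split; rewrite ?lt_min ?d10 ?r0 // !ge_min lexx ?orbT.
clearbody d.
have BB u v : B (u - v) = B u - B v.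
  exact: (linear_sub linB).
have B0 : B 0 = 0 by have := BB 0 0; rewrite !subrr.
pose T x := B (f x).
have T0 : T 0 = 0 by rewrite /T f0.
have HT x y : nm x < d -> nm y < d -> nm (T x - T y - (x - y)) <= 3^-1 * nm (x - y).
  move=> xd yd; rewrite /T -BB -[x - y in X in X <= _]BA -BB.
  apply: le_trans (HK _) _.
  have h : nm (f x - f y - A (x - y)) <= 3^-1 / K * nm (x - y) by apply: Hd1; lra.
  have := ler_wpM2l (ltW K0) h.
  by rewrite (_ : K * (3^-1 / K * nm (x - y)) = 3^-1 * nm (x - y)) //; field; rewrite gt_eqF.
have Tlow x y : nm x < d -> nm y < d -> nm (x - y) <= 2 * nm (T x - T y).
  move=> xd yd; have h := HT x y xd yd.
  have := nmB (T x - T y) (T x - T y - (x - y)); rewrite opprB addrC subrK.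
  have := nm_ge0 (T x - T y); lra.
have Tinj x y : nm x < d -> nm y < d -> T x = T y -> x = y.
  move=> xd yd E; have := Tlow x y xd yd; rewrite E subrr nm0 mulr0 => h.
  apply/eqP; rewrite -subr_eq0 -nm_eq0; apply/eqP/le_anti; rewrite h; exact: nm_ge0.
have onto y : nm y < d / 4 -> exists2 x, nm x < d & T x = y.
  exact: near_identity_onto.
have Binj u v : B u = B v -> u = v by move=> E; rewrite -(AB u) E AB.
pose U := [set x | nm x < d /\ nm (T x) < d / 4].
pose W := [set y | nm (B y) < d / 4].
have /choice [g Hg] : forall y, exists x, W y -> U x /\ f x = y.
  move=> y; have [Wy|nW] := pselect (W y); last by exists 0.
  have [x xd Tx] := onto _ Wy; exists x => _; split; last exact: Binj.
  by split=> //; rewrite Tx.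
have dB y : differentiable B y by exact: (linear_bounded_diff y linB HK).
have lowT x y : U x -> U y -> nm (x - y) <= 2 * K * nm (f x - f y).
  move=> [xd _] [yd _]; apply: le_trans (Tlow x y xd yd) _.
  by rewrite /T -BB -mulrA; apply: ler_wpM2l.
have openW : open W.
  rewrite openE => y Wy; apply/nbhs_nm; exists ((d / 4 - nm (B y)) / K).
    by rewrite divr_gt0 // subr_gt0.
  move=> z; rewrite ltr_pdivlMr // => zy.
  have h := HK (z - y); rewrite BB in h; have h2 := nmD (B z - B y) (B y); rewrite subrK in h2.
  apply: le_lt_trans h2 _; rewrite -ltrBrDr; apply: le_lt_trans h _.
  by rewrite mulrC.
have openU : open U.
  rewrite openE => x [xd Tx].
  apply/nbhs_nm; exists (Num.min (d - nm x) ((d / 4 - nm (T x)) / 2)).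
    by rewrite lt_min subr_gt0 xd divr_gt0 // subr_gt0.
  move=> z; rewrite lt_min => /andP [h1 h2].
  have zd : nm z < d by have := nmD (z - x) x; rewrite subrK; lra.
  split=> //; have := HT z x zd xd => h3.
  have := nmD (T z - T x - (z - x)) (z - x); rewrite subrK => h4.
  have := nmD (T z - T x) (T x); rewrite subrK; lra.
exists U, W; split.
- by split; rewrite ?T0 nm0 //; lra.
- by move=> p [pd _]; lra.
split; first by split=> // x [xd _]; apply: df; lra.
exists g; split; last first.
- by move=> y /Hg.
- move=> x Ux; have Wx : W (f x) by case: Ux.
  split=> //; have [[gd _] E] := Hg _ Wx.
  by apply: Tinj => //; [case: Ux|rewrite /T E].
split=> // y Wy; have [Ux Ex] := Hg _ Wy; set x := g y in Ux Ex.
have dfx : differentiable f x by apply: df; case: Ux => xd _; lra.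
have linD : linear ('d f x) by move=> a u v; rewrite linearP.
have [K1 K10 HK1] := continuous_lin_bounded (diff_continuous dfx).
have := diff_expands dfx; move: linD HK1; set D : V -> V := 'd f x => linD HK1 ED.
have {}HK1 v : nm (D v) <= K1 * nm v by exact: HK1.
clearbody D.
have DZ a v : D (a *: v) = a *: D v.
  have DB0 : D 0 = 0.
    by have := linD (-1) 0 0; rewrite !scaleN1r !addNr.
  by have := linD a v 0; rewrite !addr0 DB0 addr0.
have DD u v : D (u + v) = D u + D v by have := linD 1 u v; rewrite !scale1r.
have BZ a v : B (a *: v) = a *: B v by have := linB a v 0; rewrite !addr0 B0 addr0.
(* the derivative at [x] inherits the closeness to [A] *)
have BD v : nm (B (D v) - v) <= 3^-1 * nm v.
  have [->|v0] := eqVneq v 0.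
    have D0 : D 0 = 0 by have := DZ 0 0; rewrite !scale0r.
    by rewrite D0 B0 subrr nm0 mulr0.
  have nv : 0 < nm v by rewrite nm_gt0.
  case: (lerP (nm (B (D v) - v)) (3^-1 * nm v)) => // bad.
  pose e := (nm (B (D v) - v) - 3^-1 * nm v) / (2 * K * nm v).
  have e0 : 0 < e by rewrite divr_gt0 ?subr_gt0 // !mulr_gt0.
  have [s s0 Hs] := ED e e0.
  have [xd _] := Ux.
  pose m := Num.min (s / (2 * nm v)) ((d - nm x) / (2 * nm v)).
  have [m0 ms mx] : [/\ 0 < m, m <= s / (2 * nm v) & m <= (d - nm x) / (2 * nm v)].
    by split; rewrite ?lt_min ?divr_gt0 ?mulr_gt0 ?subr_gt0 // ge_min lexx ?orbT.
  clearbody m.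
  have nmv : nm (toC m *: v) = m * nm v by rewrite nmZ nm_toC gtr0_norm.
  have ms' : m * nm v < s.
    by move: ms; rewrite ler_pdivlMr ?mulr_gt0 //; lra.
  have mx' : m * nm v < d - nm x.
    by move: mx; rewrite ler_pdivlMr ?mulr_gt0 //; lra.
  have h1 := Hs (toC m *: v); rewrite nmv in h1; have {}h1 := h1 ms'.
  have xd' : nm (x + toC m *: v) < d by have := nmD x (toC m *: v); rewrite nmv; lra.
  have h2 := HT _ _ xd' xd; rewrite [x + _ - x]addrC addKr nmv in h2.
  have E : toC m *: (B (D v) - v) = (T (x + toC m *: v) - T x - toC m *: v) -
      B (f (x + toC m *: v) - f x - D (toC m *: v)).
    rewrite [B (_ - D _)]BB [B (f _ - _)]BB DZ BZ scalerBr /T; exact: subr_via.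
  have : m * nm (B (D v) - v) <= 3^-1 * (m * nm v) + K * (e * (m * nm v)).
    rewrite -[X in X * nm _ <= _](gtr0_norm m0) -nm_toC -nmZ E.
    apply: le_trans (nmB _ _) _; apply: lerD => //.
    by apply: le_trans (HK _) _; apply: ler_wpM2l => //; exact: ltW.
  rewrite (_ : K * (e * (m * nm v)) = m * (nm (B (D v) - v) - 3^-1 * nm v) / 2); last first.
    by rewrite /e; field; rewrite !gt_eqF.
  have : m * (3^-1 * nm v) < m * nm (B (D v) - v) by rewrite ltr_pM2l.
  lra.
have linBD : linear (fun v => B (D v)) by move=> a u v; rewrite linD linB.
have Donto z : exists v, D v = z.
  have [v Ev] := linear_perturbation_onto cV linBD BD (B z).
  by exists v; exact: Binj.
have Dlow v : nm v <= 2 * K * nm (D v).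
  have h := BD v; have h2 := HK (D v).
  have := nmB (B (D v)) (B (D v) - v); rewrite opprB addrC subrK.
  have := nm_ge0 v; lra.
have /choice [E HE] := Donto.
have Dinj u v : D u = D v -> u = v.
  move=> Euv; have := Dlow (u - v).
  have -> : D (u - v) = 0 by rewrite -scaleN1r DD DZ scaleN1r Euv subrr.
  rewrite nm0 mulr0 => h; apply/eqP; rewrite -subr_eq0 -nm_eq0; apply/eqP/le_anti; rewrite h; exact: nm_ge0.
have linE : linear E.
  by move=> a u v; apply: Dinj; rewrite DD DZ !HE.
have HKE v : nm (E v) <= 2 * K * nm v by have := Dlow (E v); rewrite HE.
have [|//] := @expands_linear_diff R V V g y E (2 * K) linE HKE.
move=> e e0.
have K2 : 0 < 2 * K by rewrite mulr_gt0.
have [|s s0 Hs] := ED (e / (2 * K) / (2 * K)); first by rewrite !divr_gt0.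
have /nbhs_nm [w w0 Hw] : nbhs y W by apply: open_nbhs_nbhs.
exists (Num.min w (s / (2 * K))); first by rewrite lt_min w0 divr_gt0.
move=> k; rewrite lt_min => /andP [kw].
rewrite ltr_pdivlMr // => ks.
have Wk : W (y + k) by apply: Hw; rewrite addrC addKr.
have [Ux' Ex'] := Hg _ Wk; set x' := g (y + k) in Ux' Ex'.
have yk : y + k - y = k by rewrite addrC addKr.
have hk : nm (x' - x) <= 2 * K * nm k.
  by have := lowT x' x Ux' Ux; rewrite Ex' Ex yk.
have h := Hs (x' - x); rewrite [x + _]addrC subrK Ex' Ex yk in h.
have {}h : nm (k - D (x' - x)) <= e / (2 * K) / (2 * K) * nm (x' - x).
  by apply: h; lra.
rewrite -/x' -/x.
have -> : x' - x - E k = - E (k - D (x' - x)).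
  have DN v : D (- v) = - D v by rewrite -scaleN1r DZ scaleN1r.
  by apply: Dinj; rewrite DN HE opprB DD DN HE.
rewrite nmN; apply: le_trans (HKE _) _.
have := ler_wpM2l (ltW K2) h.
have : 2 * K * (e / (2 * K) / (2 * K) * nm (x' - x)) <= e * nm k.
  rewrite (_ : 2 * K * _ = e / (2 * K) * nm (x' - x)); last by field; rewrite gt_eqF.
  rewrite mulrAC ler_pdivrMr // -mulrA; apply: ler_wpM2l; first exact: ltW.
  by rewrite mulrC.
lra.
Qed.

End InverseFunction.

(** * Symmetric functions of the roots of a quadratic equation *)

Section SymmetricFunctions.
Variable R : realType.
Local Notation C := (Cplx R).

Lemma scaleCE (u v : C) : u *: v = u * v. Proof. by []. Qed.

(** The sum [k (c + d) + k (c - d)] is even in [d], hence a function of [c] and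
    [s = d ^ 2]; [sqrtC] picks one of the two square roots. *)
Definition evenpart (k : C -> C) (x : C * C) : C :=
  k (x.1 + sqrtC x.2) + k (x.1 - sqrtC x.2).

Lemma evenpart_sqr k (c d : C) : evenpart k (c, d ^+ 2) = k (c + d) + k (c - d).
Proof.
rewrite /evenpart /=; have := sqrtCK (d ^+ 2) => /eqP.
by rewrite eqf_sqr => /orP [] /eqP -> //; rewrite opprK addrC.
Qed.

(** At a double root the second-order Taylor expansion of [k] makes the
    dependence on [s] linear up to a remainder of order [|s| ^ (3 / 2)]. *)
Lemma evenpart_diff0 k r (c : C) : 0 < r -> hol_ball k c r ->
  differentiable (evenpart k) (c, 0).
Proof.
move=> r0 Hk; have [A [K [d [d0 K0 HT]]]] := taylor2 r0 Hk.
pose L (h : C * C) : C := 2%:R * dz k c * h.1 + 2%:R * A * h.2.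
have [u v w|v|e e0|//] := @expands_linear_diff R _ _ (evenpart k) (c, 0) L
   (nm (2%:R * dz k c) + nm (2%:R * A)).
- by rewrite /L /= !scaleCE; ring.
- rewrite /L; apply: le_trans (nmD _ _) _.
  rewrite [nm (_ * v.1)]nmM [nm (_ * v.2)]nmM [leRHS]mulrDl.
  by apply: lerD; apply: ler_wpM2l; [exact: nm_ge0|exact: nm_pair1|exact: nm_ge0|exact: nm_pair2].
pose M := 2 * nm A + 16 * K + 1.
have M0 : 0 < M by have := nm_ge0 A; rewrite /M; lra.
pose q := Num.min (Num.min 1 (d / 2)) (e / M).
have [q0 q1 qd qe] : [/\ 0 < q, q <= 1, q <= d / 2 & q <= e / M].
  by split; rewrite ?lt_min ?ltr01 ?divr_gt0 // !ge_min lexx ?orbT.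
clearbody q.
exists (q ^+ 2); first by rewrite exprn_gt0.
move=> h hq; set m := nm h in hq *.
have m0 : 0 <= m by exact: nm_ge0.
pose s := Num.sqrt m.
have s2 : s ^+ 2 = m by rewrite sqr_sqrtr.
have s0 : 0 <= s by exact: sqrtr_ge0.
have sq : s < q by rewrite -(@ltr_pXn2r _ 2) ?nnegrE ?s2 // ltW.
clearbody s.
pose dl := sqrtC h.2.
have dl2 : dl ^+ 2 = h.2 by exact: sqrtCK.
have ndl : nm dl <= s.
  by rewrite -(@ler_pXn2r _ 2) ?nnegrE ?nm_ge0 // -nmX dl2 s2; exact: nm_pair2.
have nh1 : nm h.1 <= s ^+ 2 by rewrite s2; exact: nm_pair1.
have nh1s : nm h.1 <= s.
  by apply: le_trans nh1 _; rewrite expr2 ler_piMl //; lra.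
have T (u : C) : nm u <= 2 * s -> nm (k (c + u) - k c - dz k c * u - A * u ^+ 2) <= 8 * K * s * m.
  move=> us; apply: le_trans (HT u _) _; first lra.
  have : nm u ^+ 3 <= (2 * s) ^+ 3 by rewrite lerXn2r ?nnegrE ?nm_ge0 //; lra.
  move=> h3; have := ler_wpM2l K0 h3.
  by rewrite (_ : K * (2 * s) ^+ 3 = 8 * K * s * m) // -s2; ring.
have T1 := T (h.1 + dl); have T2 := T (h.1 - dl).
have {}T1 := T1 (le_trans (nmD _ _) (_ : nm h.1 + nm dl <= 2 * s)).
have {}T1 := T1 (ltac:(lra)).
have {}T2 := T2 (le_trans (nmB _ _) (_ : nm h.1 + nm dl <= 2 * s)).
have {}T2 := T2 (ltac:(lra)).
have -> : evenpart k ((c, 0) + h) - evenpart k (c, 0) - L h =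
  (k (c + (h.1 + dl)) - k c - dz k c * (h.1 + dl) - A * (h.1 + dl) ^+ 2) +
  (k (c + (h.1 - dl)) - k c - dz k c * (h.1 - dl) - A * (h.1 - dl) ^+ 2) +
  2%:R * A * h.1 ^+ 2.
  have -> : (c, 0) + h = (c + h.1, dl ^+ 2) by rewrite dl2; congr pair; rewrite /= add0r.
  have -> : (c, 0) = (c, 0 ^+ 2) :> C * C by rewrite expr0n.
  rewrite !evenpart_sqr /L -dl2 !addrA addr0 subr0; ring.
apply: le_trans (nmD _ _) _; apply: le_trans (lerD (nmD _ _) (lexx _)) _.
have A0 := nm_ge0 A.
have h2 : nm (2%:R * A * h.1 ^+ 2) <= 2 * nm A * s * m.
  rewrite nmM nmX [nm (2%:R * A)]nmM nm_nat.
  rewrite -!mulrA; apply: ler_wpM2l => //; apply: ler_wpM2l => //.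
  by rewrite expr2; apply: ler_pM; rewrite ?nm_ge0 //; exact: nm_pair1.
have : (2 * nm A + 16 * K) * s * m <= e * m.
  apply: ler_wpM2r => //; apply: le_trans (_ : M * (e / M) <= _).
    by apply: ler_pM => //; rewrite /M; lra.
  by rewrite mulrC divfK // gt_eqF.
lra.
Qed.

(** Away from [s = 0] a branch of the square root is differentiable, with derivative
    [1 / (2 d)]. *)
Lemma evenpart_diff1 k (c d : C) : d != 0 ->
  differentiable k (c + d) -> differentiable k (c - d) ->
  differentiable (evenpart k) (c, d ^+ 2).
Proof.
move=> dn0 /dz_expands E1 /dz_expands E2.
have nd : 0 < nm d by rewrite nm_gt0.
set a := dz k (c + d) in E1; set b := dz k (c - d) in E2.
have d20 : 2%:R * d != 0 by rewrite mulf_neq0 // pnatr_eq0.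
pose L (h : C * C) : C := a * (h.1 + h.2 / (2%:R * d)) + b * (h.1 - h.2 / (2%:R * d)).
have n2 : nm (2%:R : C) = 2.
  exact: nm_nat.
have n2d : nm (2%:R * d)^-1 = (2 * nm d)^-1 by rewrite nmV nmM n2.
pose D := nm d + (nm d)^-1 + 1.
have id0 : 0 < (nm d)^-1 by rewrite invr_gt0.
have [u v w|v|e e0|//] := @expands_linear_diff R _ _ (evenpart k) (c, d ^+ 2) L
   ((nm a + nm b) * (1 + (nm d)^-1)).
- by rewrite /L /= !scaleCE; field.
- rewrite /L; apply: le_trans (nmD _ _) _; rewrite [nm (a * _)]nmM [nm (b * _)]nmM.
  have v0 := nm_ge0 v.
  have hd : nm (v.2 / (2%:R * d)) <= (nm d)^-1 * nm v.
    rewrite nmM n2d invfM mulrC; apply: ler_pM => //; rewrite ?nm_ge0 //.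
    - by rewrite mulr_ge0 // ltW.
    - by rewrite ler_piMl ?ltW //; lra.
    - exact: nm_pair2.
  have h1 := nmD v.1 (v.2 / (2%:R * d)); have h2 := nmB v.1 (v.2 / (2%:R * d)).
  have h3 := nm_pair1 v.
  have q1 : nm (v.1 + v.2 / (2%:R * d)) <= (1 + (nm d)^-1) * nm v by lra.
  have q2 : nm (v.1 - v.2 / (2%:R * d)) <= (1 + (nm d)^-1) * nm v by lra.
  have := ler_wpM2l (nm_ge0 a) q1; have := ler_wpM2l (nm_ge0 b) q2; lra.
(* [et] is the increment of the square root nearest to [d] *)
pose N := 1 + (nm d)^-1.
have N0 : 0 < N by rewrite /N; lra.
pose e1 := e / (4 * N).
have e10 : 0 < e1 by rewrite divr_gt0 // mulr_gt0.
have [s1 s10 Hs1] := E1 e1 e10.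
have [s2 s20 Hs2] := E2 e1 e10.
pose Q := (nm a + nm b) * (nm d)^-1 ^+ 3 + 1.
have Q0 : 0 < Q.
  have := mulr_ge0 (addr_ge0 (nm_ge0 a) (nm_ge0 b)) (exprn_ge0 3 (ltW id0)).
  by rewrite /Q; lra.
pose s := Num.min (Num.min (s1 / N) (s2 / N)) (e / (2 * Q)).
have [s0 ss1 ss2 se] : [/\ 0 < s, s <= s1 / N, s <= s2 / N & s <= e / (2 * Q)].
  by split; rewrite ?lt_min ?divr_gt0 ?mulr_gt0 // !ge_min lexx ?orbT.
clearbody s.
exists s => // h hs.
have m0 := nm_ge0 h; have h1n := nm_pair1 h; have h2n := nm_pair2 h.
have [dl dl2 near] : exists2 dl : C, dl ^+ 2 = d ^+ 2 + h.2 & nm (dl - d) <= nm (dl + d).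
  have E := sqrtCK (d ^+ 2 + h.2).
  case: (lerP (nm (sqrtC (d ^+ 2 + h.2) - d)) (nm (sqrtC (d ^+ 2 + h.2) + d))) => hh.
    by exists (sqrtC (d ^+ 2 + h.2)).
  exists (- sqrtC (d ^+ 2 + h.2)); first by rewrite sqrrN.
  by rewrite -opprD nmN [- _ + d]addrC [leRHS]nmBC; apply: ltW.
pose et := dl - d.
have etd : 2%:R * d * et + et ^+ 2 = h.2.
  by rewrite (_ : _ + _ = dl ^+ 2 - d ^+ 2); [rewrite dl2; ring|rewrite /et; ring].
have low : nm d <= nm (dl + d).
  have := nmB (dl + d) (dl - d); rewrite (_ : dl + d - (dl - d) = 2%:R * d); last by ring.
  by rewrite nmM n2; lra.
have net : nm et <= (nm d)^-1 * nm h.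
  rewrite mulrC ler_pdivlMr //; apply: le_trans (_ : nm et * nm (dl + d) <= _).
    by apply: ler_wpM2l => //; exact: nm_ge0.
  by rewrite -nmM (_ : et * (dl + d) = h.2) // -etd /et; ring.
have u1 : nm (h.1 + et) <= N * nm h by have := nmD h.1 et; rewrite /N; lra.
have u2 : nm (h.1 - et) <= N * nm h by have := nmB h.1 et; rewrite /N; lra.
have Nh : N * nm h < N * s by rewrite ltr_pM2l.
have Ns1 : N * s <= s1 by rewrite mulrC -ler_pdivlMr.
have Ns2 : N * s <= s2 by rewrite mulrC -ler_pdivlMr.
have T1 : nm (k (c + d + (h.1 + et)) - k (c + d) - a * (h.1 + et)) <= e1 * nm (h.1 + et).
  by apply: Hs1; lra.
have T2 : nm (k (c - d + (h.1 - et)) - k (c - d) - b * (h.1 - et)) <= e1 * nm (h.1 - et).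
  by apply: Hs2; lra.
have -> : evenpart k ((c, d ^+ 2) + h) - evenpart k (c, d ^+ 2) - L h =
  (k (c + d + (h.1 + et)) - k (c + d) - a * (h.1 + et)) +
  (k (c - d + (h.1 - et)) - k (c - d) - b * (h.1 - et)) +
  (b - a) * (et ^+ 2 / (2%:R * d)).
  have -> : (c, d ^+ 2) + h = (c + h.1, dl ^+ 2) by rewrite dl2; case: (h).
  rewrite !evenpart_sqr /L.
  have -> : h.2 / (2%:R * d) = et + et ^+ 2 / (2%:R * d) by rewrite -etd; field.
  have -> : c + h.1 + dl = c + d + (h.1 + et) by rewrite /et; ring.
  have -> : c + h.1 - dl = c - d + (h.1 - et) by rewrite /et; ring.
  ring.
apply: le_trans (nmD _ _) _; apply: le_trans (lerD (nmD _ _) (lexx _)) _.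
have T3 : nm ((b - a) * (et ^+ 2 / (2%:R * d))) <= Q * (s * nm h).
  rewrite nmM nmM nmX n2d.
  have g1 : nm (b - a) <= nm a + nm b by have := nmB b a; lra.
  have g2 : nm et ^+ 2 <= (nm d)^-1 ^+ 2 * (s * nm h).
    apply: le_trans (_ : ((nm d)^-1 * nm h) ^+ 2 <= _).
      by rewrite lerXn2r ?nnegrE ?nm_ge0 // mulr_ge0 // ltW.
    rewrite exprMn; apply: ler_wpM2l; first by rewrite exprn_ge0 // ltW.
    by rewrite expr2; apply: ler_wpM2r => //; exact: ltW.
  have g3 : (2 * nm d)^-1 <= (nm d)^-1 by rewrite invfM ler_piMl ?ltW //; lra.
  have sh : 0 <= s * nm h by rewrite mulr_ge0 // ltW.
  apply: le_trans (_ : (nm a + nm b) * ((nm d)^-1 ^+ 2 * (s * nm h) * (nm d)^-1) <= _).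
    apply: ler_pM => //; rewrite ?nm_ge0 //.
      by rewrite mulr_ge0 ?exprn_ge0 ?nm_ge0 // invr_ge0 mulr_ge0 // ltW.
    by apply: ler_pM => //; rewrite ?exprn_ge0 ?nm_ge0 // invr_ge0 mulr_ge0 // ltW.
  rewrite (_ : (nm a + nm b) * _ = (nm a + nm b) * (nm d)^-1 ^+ 3 * (s * nm h)); last by ring.
  by apply: ler_wpM2r => //; rewrite /Q lerDl.
have T4 : Q * (s * nm h) <= e / 2 * nm h.
  rewrite mulrA; apply: ler_wpM2r => //.
  apply: le_trans (_ : Q * (e / (2 * Q)) <= _); first by rewrite ler_pM2l.
  by rewrite le_eqVlt; apply/orP; left; apply/eqP; field; rewrite gt_eqF.
have T5 u : u <= N * nm h -> e1 * u <= e / 4 * nm h.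
  move=> uN; apply: le_trans (_ : e1 * (N * nm h) <= _); first by rewrite ler_pM2l.
  by rewrite /e1 le_eqVlt; apply/orP; left; apply/eqP; field; rewrite gt_eqF.
have := T5 _ u1; have := T5 _ u2; lra.
Qed.

(** The sum of [k] over the two roots of [t ^ 2 + t b = w], which are
    [c + d] and [c - d] for [c = - b / 2] and [d ^ 2 = b ^ 2 / 4 + w]. *)
Definition rootsum (k : C -> C) (x : C * C) : C :=
  evenpart k (- x.1 / 2, x.1 ^+ 2 / 4 + x.2).

Lemma rootsumE k (b w t : C) : t ^+ 2 + t * b = w -> rootsum k (b, w) = k t + k (- t - b).
Proof.
move=> <-; rewrite /rootsum /=.
have -> : b ^+ 2 / 4 + (t ^+ 2 + t * b) = (t + b / 2) ^+ 2 by field.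
by rewrite evenpart_sqr; congr (k _ + k _); field.
Qed.

Lemma rootsum_diff k r : 0 < r -> hol_ball k 0 r ->
  exists2 d : R, 0 < d & forall x, nm x < d -> differentiable (rootsum k) x.
Proof.
move=> r0 Hk; pose m := Num.min r 1.
have [m0 mr m1] : [/\ 0 < m, m <= r & m <= 1].
  by split; rewrite ?lt_min ?r0 ?ltr01 // ge_min lexx ?orbT.
clearbody m.
have n2 : nm (2^-1 : C) = 2^-1.
  by rewrite nmV nm_nat.
have n4 : nm (4^-1 : C) = 4^-1.
  by rewrite nmV nm_nat.
have m2m : m ^+ 2 <= m by rewrite expr2 ler_piMl //; lra.
have m20 : 0 < m ^+ 2 by rewrite exprn_gt0.
exists (m ^+ 2 / 8); first by lra.
move=> x xm.
have x1 := nm_pair1 x; have x2 := nm_pair2 x.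
pose P (x : C * C) : C * C := (- x.1 / 2, x.1 ^+ 2 / 4 + x.2).
have dP : differentiable P x.
  pose L (h : C * C) : C * C := (- h.1 / 2, x.1 * h.1 / 2 + h.2).
  have [u v w|v|e e0|//] := @expands_linear_diff R _ _ P x L (1 + nm x.1).
  - by rewrite /L; congr pair; rewrite /= !scaleCE; field.
  - have v1 := nm_pair1 v; have v2 := nm_pair2 v; have v0 := nm_ge0 v; have g := nm_ge0 x.1.
    have gv := mulr_ge0 g v0.
    apply: nm_pair_le => /=.
      by rewrite nmM nmN n2; have := nm_ge0 v.1; lra.
    apply: le_trans (nmD _ _) _; rewrite !nmM n2.
    have := ler_wpM2l g v1; lra.
  exists e => // h he.
  have -> : P (x + h) - P x - L h = (0, h.1 ^+ 2 / 4).
    by rewrite /P /L; congr pair; rewrite /=; field.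
  have h1 := nm_pair1 h; have h0 := nm_ge0 h.
  apply: nm_pair_le => /=; first by rewrite nm0 mulr_ge0 // ltW.
  rewrite nmM nmX n4; have : nm h.1 ^+ 2 <= e * nm h.
    by rewrite expr2; apply: ler_pM => //; rewrite ?nm_ge0 //; lra.
  by have := mulr_ge0 (ltW e0) h0; lra.
apply: (@fdiff_comp R _ _ _ P (evenpart k) x dP).
pose d := sqrtC (x.1 ^+ 2 / 4 + x.2).
have d2 : d ^+ 2 = x.1 ^+ 2 / 4 + x.2 by exact: sqrtCK.
have nd : nm d < m / 2.
  rewrite -(@ltr_pXn2r _ 2) ?nnegrE ?nm_ge0 //; last by lra.
  rewrite -nmX d2; apply: le_lt_trans (nmD _ _) _; rewrite nmM nmX n4.
  have : nm x.1 ^+ 2 <= nm x.1 by rewrite expr2 ler_piMl ?nm_ge0 //; lra.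
  have -> : (m / 2) ^+ 2 = m ^+ 2 / 4 by field.
  lra.
have nc : nm (- x.1 / 2) < m / 2 by rewrite nmM nmN n2; lra.
rewrite /P -d2; have [dz0|dn0] := eqVneq d 0.
  rewrite dz0 expr0n /=; apply: (@evenpart_diff0 k (r / 2)); first lra.
  move=> z zr; apply: Hk; rewrite subr0.
  by have := nmD (z - - x.1 / 2) (- x.1 / 2); rewrite subrK; lra.
apply: evenpart_diff1 => //; apply: Hk; rewrite subr0.
  by have := nmD (- x.1 / 2) d; lra.
by have := nmB (- x.1 / 2) d; lra.
Qed.

End SymmetricFunctions.

(** * Second and last components built from the first *)

Section CompletionByRoots.
Variable R : realType.
Local Notation C := (Cplx R).

Lemma min_radius n (d : 'I_n -> R) : (forall j, 0 < d j) ->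
  exists2 m, 0 < m & forall j, m <= d j.
Proof.
move=> d0; exists (\big[Num.min/1]_j d j) => [|j]; last exact: bigmin_le_cond.
by elim/big_ind: _ => // a b a0 b0; rewrite lt_min a0.
Qed.

(** Strict differentiability of a row follows from that of its entries, as the norm
    is the maximum norm. *)
Lemma strict_row (V : normedModType C) n (f A : V -> 'rV[C]_n) :
  (forall j, strict_diff (fun y => f y 0 j) (fun v => A v 0 j)) -> strict_diff f A.
Proof.
move=> H e e0.
have /choice [d Hd] : forall j, exists d : R, 0 < d /\ forall x y, nm x < d -> nm y < d ->
    nm (f x 0 j - f y 0 j - A (x - y) 0 j) <= e * nm (x - y).
  by move=> j; have [d d0 Hd] := H j e e0; exists d.
have [m m0 Hm] := @min_radius n d (fun j => proj1 (Hd j)).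
exists m => // x y xm ym; apply: nm_rV_le => [|j].
  by apply: mulr_ge0; [exact: ltW|exact: nm_ge0].
by have [_ Hj] := Hd j; have mj := Hm j; rewrite !mxE; apply: Hj; apply: lt_le_trans mj.
Qed.

Lemma strict_pair (V W1 W2 : normedModType C) (f A : V -> W1) (g B : V -> W2) :
  strict_diff f A -> strict_diff g B ->
  strict_diff (fun p => (f p, g p)) (fun v => (A v, B v)).
Proof.
move=> H1 H2 e e0; have [d d0 Hd] := H1 e e0; have [d' d'0 Hd'] := H2 e e0.
exists (Num.min d d'); first by rewrite lt_min d0.
move=> x y; rewrite !lt_min => /andP [x1 x2] /andP [y1 y2].
by apply: nm_pair_le; [exact: Hd|exact: Hd'].
Qed.

Lemma diff_comp_lin (U V W : normedModType C) (P : U -> V) (f : V -> W) (K : R) :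
  linear P -> 0 < K -> (forall v, nm (P v) <= K * nm v) -> differentiable f 0 ->
  differentiable (fun p => f (P p)) 0 /\
  forall v, 'd (fun p => f (P p)) 0 v = 'd f 0 (P v).
Proof.
move=> linP K0 HK df.
have P0 : P 0 = 0.
  by have := linP (-1) 0 0; rewrite !scaleN1r !addNr.
have EP : expands P 0 P.
  move=> e e0; exists 1 => // h _; rewrite add0r P0 subr0 subrr nm0.
  by apply: mulr_ge0; [exact: ltW|exact: nm_ge0].
have [K2 K20 HK2] := continuous_lin_bounded (diff_continuous df).
have lin : linear ('d f 0) by move=> a u v; rewrite linearP.
have := diff_expands df; move: lin HK2; set M : V -> W := 'd f 0 => lin HK2 EM.
have {}HK2 v : nm (M v) <= K2 * nm v by exact: HK2.
clearbody M.
have MB u v : M (u - v) = M u - M v.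
  exact: (linear_sub lin).
have EM' : expands f (P 0) M by rewrite P0.
have Ex := expands_comp K0 K20 MB HK HK2 EP EM'.
have [a u v|v|D E] := @expands_linear_diff R U W _ 0 (fun v => M (P v)) (K2 * K) _ _ Ex.
- by rewrite linP lin.
- by apply: le_trans (HK2 _) _; rewrite -mulrA; apply: ler_wpM2l; [exact: ltW|exact: HK].
by split=> // v; rewrite E.
Qed.

(** Derivatives of [F_2] and [G] at the origin are bounded below through
    [locally_expanding], which avoids computing them. *)
Lemma deriv_nonzero (V : normedModType C) (k : V -> C) (u : V) (c d : R) : 0 < c -> 0 < d ->
  differentiable k 0 -> k 0 = 0 ->
  (forall x : C, nm x < d -> c * nm x <= nm (k (x *: u))) -> 'd k 0 u != 0.
Proof.
move=> c0 d0 dk k0 H; apply/negP => /eqP du.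
have dk' : differentiable k (0 + (0 : C) *: u) by rewrite scale0r addr0.
have [D E] := line_diff dk'; rewrite scale0r addr0 du in E.
have [|s s0 Hs] := dz_expands D (_ : 0 < c / 2); first by lra.
pose x := Num.min (d / 2) (s / 2).
have [x0 xd xs] : [/\ 0 < x, x <= d / 2 & x <= s / 2].
  by split; rewrite ?lt_min ?divr_gt0 // ge_min lexx ?orbT.
clearbody x.
have nx : nm (toC x) = x by rewrite nm_toC gtr0_norm.
have h1 := Hs (toC x); rewrite nx E mul0r subr0 !add0r scale0r k0 subr0 in h1.
have {}h1 := h1 (ltac:(lra)).
have h2 := H (toC x); rewrite nx in h2; have {}h2 := h2 (ltac:(lra)).
have := mulr_gt0 c0 x0; lra.
Qed.

Lemma fin_dim_bounded n (W : normedModType C) (L : 'rV[C]_n * C -> W) : linear L ->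
  exists2 K : R, 0 < K & forall v, nm (L v) <= K * nm v.
Proof.
move=> linL.
pose L' : {linear ('rV[C]_n * C)%type -> W} :=
  HB.pack_for {linear ('rV[C]_n * C)%type -> W} L (GRing.isLinear.Build _ _ W *:%R L linL).
have LE v : L v = L' v by [].
pose b j : ('rV[C]_n * C)%type := (delta_mx 0 j, 0).
have dec (v : 'rV[C]_n * C) : v = \sum_j v.1 0 j *: b j + v.2 *: (0, 1).
  have S1 : \sum_j v.1 0 j *: b j = (v.1, 0).
    rewrite [in RHS](row_sum_delta v.1).
    elim/big_rec2: _ => // j y z _ ->; rewrite /b; congr pair; rewrite /= addr0.
    by rewrite -[_ *: 0]/(_ * 0) mulr0.
  rewrite S1; case: (v) => z w; congr pair; rewrite /=.
    by rewrite scaler0 addr0.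
  by rewrite add0r -[w *: 1]/(w * 1) mulr1.
pose K := \sum_j nm (L (b j)) + nm (L (0, 1)) + 1.
have s0 : 0 <= \sum_j nm (L (b j)) by apply: sumr_ge0 => j _; exact: nm_ge0.
exists K; first by have := nm_ge0 (L (0, 1)); rewrite /K; lra.
move=> v; rewrite {1}(dec v) LE linearD linear_sum /=.
have v0 := nm_ge0 v.
apply: le_trans (nmD _ _) _.
have h1 : nm (\sum_j L' (v.1 0 j *: b j)) <= \sum_j nm (L (b j)) * nm v.
  elim/big_rec2: _ => [|j y z _ IH]; first by rewrite nm0.
  apply: le_trans (nmD _ _) _; apply: lerD => //.
  rewrite linearZ /= nmZ mulrC; apply: ler_wpM2l; first exact: nm_ge0.
  exact: le_trans (nm_coord _ _) (nm_pair1 v).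
have h2 : nm (L' (v.2 *: (0, 1))) <= nm (L (0, 1)) * nm v.
  by rewrite linearZ /= nmZ mulrC; apply: ler_wpM2l; [exact: nm_ge0|exact: nm_pair2].
rewrite -mulr_suml in h1; rewrite /K !mulrDl mul1r; lra.
Qed.

Variables (n : nat) (hn : (1 < n)%N).
Local Notation V := ('rV[C]_n * C)%type.
Local Notation z1 := (z1 (R := R) hn).
Local Notation z2 := (z2 (R := R) hn).
Local Notation i1 := (idx1 hn).
Local Notation i2 := (idx2 hn).

Definition z2w (p : V) : C * C := (z2 p, p.2).

Lemma z2w_lin : linear z2w.
Proof. by move=> a u v; rewrite /z2w; congr pair; exact: (z2_lin hn). Qed.

Lemma z2w_nm p : nm (z2w p) <= 1 * nm p.
Proof.
rewrite mul1r; have h2 := nm_pair2 p.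
by apply: nm_pair_le; rewrite /z2w /=; [exact: z2_nm|exact: h2].
Qed.

Variable h : C -> C.

(** Vieta's formulas for roots [h t] and [h t'], where [t] and [t'] are the roots
    of [t ^ 2 + t z_2 = w]. The product is recovered from the power sums [h t + h t']
    and [(h t) ^ 2 + (h t') ^ 2], to which [rootsum] applies. *)
Definition F2c (x : C * C) : C := - rootsum h x.
Definition Gc (x : C * C) : C :=
  - (2^-1 * (rootsum h x * rootsum h x - rootsum (fun z => h z * h z) x)).

Lemma F2c_root b w t : t ^+ 2 + t * b = w -> F2c (b, w) = - (h t + h (- t - b)).
Proof. by move=> E; rewrite /F2c (rootsumE _ E). Qed.

Lemma Gc_root b w t : t ^+ 2 + t * b = w -> Gc (b, w) = - (h t * h (- t - b)).
Proof. by move=> E; rewrite /Gc !(rootsumE _ E); field. Qed.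

Variable r : R.
Hypothesis r0 : 0 < r.
Hypothesis hol_h : hol_ball h 0 r.
Hypothesis h0 : h 0 = 0.
Hypothesis dh0 : dz h 0 != 0.

Lemma F2c_Gc_diff : exists2 d : R, 0 < d & forall x, nm x < d ->
  differentiable F2c x /\ differentiable Gc x.
Proof.
have hol_hh : hol_ball (fun z => h z * h z) 0 r.
  by move=> z zr; apply: fdiffM; exact: hol_h.
have [d d0 Hd] := rootsum_diff r0 hol_h; have [d' d'0 Hd'] := rootsum_diff r0 hol_hh.
exists (Num.min d d'); first by rewrite lt_min d0.
move=> x; rewrite lt_min => /andP [/Hd D1 /Hd' D2].
have neg (k : C * C -> C) : differentiable k x -> differentiable (fun y => - k y) x.
  move=> D; have := fdiffB (fdiff_cst (0 : C) x) D; congr (differentiable _ _).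
  by apply: funext => y; rewrite sub0r.
split; [exact: (neg _ D1)|apply: neg].
exact: fdiffM (fdiff_cst _ _) (fdiffB (fdiffM D1 D1) D2).
Qed.

Lemma root00 (x : C) : 0 ^+ 2 + 0 * x = 0 :> C.
Proof. by rewrite expr0n mul0r addr0. Qed.

Lemma F2c_Gc0 : F2c 0 = 0 /\ Gc 0 = 0.
Proof.
by split; [rewrite (F2c_root (root00 0))|rewrite (Gc_root (root00 0))];
rewrite !oppr0 addr0 h0 ?addr0 ?mulr0 oppr0.
Qed.

(** For [w = 0] the roots are [0] and [- z_2]. *)
Lemma F2c_dz2 : 'd F2c 0 (1, 0) != 0.
Proof.
have [d d0 Hd] := F2c_Gc_diff; have [|D _] := Hd 0; first by rewrite nm0.
have [F0 _] := F2c_Gc0.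
have [s s0 Hs] := locally_expanding r0 hol_h dh0.
apply: (@deriv_nonzero _ F2c (1, 0) (nm (dz h 0) / 2) s) => //.
  by rewrite divr_gt0 // nm_gt0.
move=> x xs; have -> : x *: ((1, 0) : C * C) = (x, 0).
  by congr pair; rewrite /= scaleCE ?mulr1 ?mulr0.
rewrite (F2c_root (root00 x)) h0 add0r nmN oppr0 sub0r.
have := Hs (- x) 0; rewrite h0 !subr0 nm0 nmN; exact.
Qed.

Lemma Gc_dz2 : 'd Gc 0 (1, 0) = 0.
Proof.
have [d d0 Hd] := F2c_Gc_diff; have [|_ D] := Hd 0; first by rewrite nm0.
have [_ G0] := F2c_Gc0.
apply: (deriv_const_line ltr01 D) => x _; have -> : x *: ((1, 0) : C * C) = (x, 0).
  by congr pair; rewrite /= scaleCE ?mulr1 ?mulr0.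
by rewrite G0 (Gc_root (root00 x)) h0 mul0r oppr0.
Qed.

(** For [z_2 = 0] the roots are [t] and [- t] with [t ^ 2 = w], so
    [|G| = |h t| |h (- t)|] is comparable to [|t| ^ 2 = |w|]. *)
Lemma Gc_dw : 'd Gc 0 (0, 1) != 0.
Proof.
have [d d0 Hd] := F2c_Gc_diff; have [|_ D] := Hd 0; first by rewrite nm0.
have [_ G0] := F2c_Gc0.
have [s s0 Hs] := locally_expanding r0 hol_h dh0.
have c0 : 0 < nm (dz h 0) / 2 by rewrite divr_gt0 // nm_gt0.
apply: (@deriv_nonzero _ Gc (0, 1) ((nm (dz h 0) / 2) ^+ 2) (s ^+ 2)) => //.
- by rewrite exprn_gt0.
- by rewrite exprn_gt0.
move=> x xs; have -> : x *: ((0, 1) : C * C) = (0, x).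
  by congr pair; rewrite /= scaleCE ?mulr1 ?mulr0.
have t2 := sqrtCK x; set t := sqrtC x in t2.
have ts : nm t < s by rewrite -(@ltr_pXn2r _ 2) ?nnegrE ?nm_ge0 ?ltW // -nmX t2.
have E : t ^+ 2 + t * 0 = x by rewrite mulr0 addr0.
rewrite (Gc_root E) nmN nmM subr0 -t2 nmX expr2 [nm t ^+ 2]expr2 mulrACA.
have z0 : nm (0 : C) < s by rewrite nm0.
have h1 := Hs t 0 ts z0; rewrite h0 !subr0 in h1.
have nts : nm (- t) < s by rewrite nmN.
have h2 := Hs (- t) 0 nts z0; rewrite h0 !subr0 nmN in h2.
by apply: ler_pM => //; rewrite mulr_ge0 ?nm_ge0 // ltW.
Qed.

End CompletionByRoots.

(** * Local invertibility of the completed map *)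

Section LocalInvertibility.
Variable R : realType.
Local Notation C := (Cplx R).

Lemma holomorphic_strict n (F : ('rV[C]_n * C)%type -> ('rV[C]_n * C)%type) (r : R) : 0 < r ->
  (forall j p, nm p < r -> differentiable (fun p => (F p).1 0 j) p) ->
  (forall p, nm p < r -> differentiable (fun p => (F p).2) p) ->
  (forall p, nm p < r -> differentiable F p) /\
  strict_diff F (fun v => (\row_j 'd (fun p => (F p).1 0 j) 0 v, 'd (fun p => (F p).2) 0 v)).
Proof.
move=> r0 D1 D2.
have EF : F = (fun p => ((F p).1, (F p).2)) by apply: funext => p; case: (F p).
split=> [p pr|].
  have [D1p _] := row_diff (fun j => D1 j p pr).
  by rewrite EF; have [] := pair_diff D1p (D2 p pr).
rewrite [F in strict_diff F]EF; apply: (strict_pair (A := fun v => \row_j _)); last exact: (strict_scalar r0 D2).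
apply: strict_row => j.
have := strict_scalar r0 (D1 j); congr strict_diff.
by apply: funext => v; rewrite mxE.
Qed.

Lemma inj_linear_onto n (Z : 'rV[C]_n -> 'rV[C]_n) : linear Z ->
  (forall v, Z v = 0 -> v = 0) -> forall u, exists v, Z v = u.
Proof.
move=> linZ H u.
pose Z' : {linear 'rV[C]_n -> 'rV[C]_n} :=
  HB.pack_for {linear 'rV[C]_n -> 'rV[C]_n} Z (GRing.isLinear.Build _ _ 'rV[C]_n *:%R Z linZ).
pose M := lin1_mx Z'.
have ME v : v *m M = Z v by rewrite mul_rV_lin1.
have : row_free M by apply: inj_row_free => v; rewrite ME; exact: H.
rewrite row_free_unit => uM; exists (u *m invmx M).
by rewrite -ME mulmxKV.
Qed.

Lemma linear_bijection_inverse n (A : ('rV[C]_n * C)%type -> ('rV[C]_n * C)%type) : linear A ->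
  (forall v, A v = 0 -> v = 0) -> (forall u, exists v, A v = u) ->
  exists (B : ('rV[C]_n * C)%type -> ('rV[C]_n * C)%type) (K : R),
  [/\ linear B, 0 < K, forall v, nm (B v) <= K * nm v,
      forall v, B (A v) = v & forall v, A (B v) = v].
Proof.
move=> linA injA /choice [B AB].
have inj u v : A u = A v -> u = v.
  move=> E; apply/eqP; rewrite -subr_eq0; apply/eqP/injA.
  by rewrite (linear_sub linA) E subrr.
have linB : linear B by move=> a u v; apply: inj; rewrite linA !AB.
have [K K0 HK] := fin_dim_bounded linB.
by exists B, K; split=> // v; apply: inj; rewrite AB.
Qed.

Variables (n : nat) (hn : (1 < n)%N).
Local Notation V := ('rV[C]_n * C)%type.
Local Notation z1 := (z1 (R := R) hn).
Local Notation z2 := (z2 (R := R) hn).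
Local Notation i1 := (idx1 hn).
Local Notation i2 := (idx2 hn).

Lemma idx_gt1 (j : 'I_n) : j != i1 -> j != i2 -> (1 < j)%N.
Proof. by case: j => -[|[|j]]. Qed.

(** [A] is block triangular: its blocks are [k] on [w] and, on [z], a map that is
    injective by the kernel hypothesis and hence onto. *)
Lemma triangular_inverse (a b c k : C) (D : 'I_n -> V -> C) (A : V -> V) :
  a != 0 -> b != 0 -> k != 0 ->
  (forall j : 'I_n, (1 < j)%N -> linear (D j : V -> C^o)) ->
  (forall z : 'rV[C]_n, z 0 i1 = 0 -> z 0 i2 = 0 ->
     (forall j : 'I_n, (1 < j)%N -> D j (z, 0) = 0) -> z = 0) ->
  (forall v, A v = (\row_j (if j == i1 then a * z1 v else
      if j == i2 then b * z2 v + c * v.2 else D j v), k * v.2)) ->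
  linear A /\
  exists (B : V -> V) (K : R),
  [/\ linear B, 0 < K, forall v, nm (B v) <= K * nm v,
      forall v, B (A v) = v & forall v, A (B v) = v].
Proof.
move=> a0 b0 k0 linD ker AE.
have i21 : (i2 == i1) = false by [].
have linA : linear A.
  move=> x u v; rewrite !AE; congr pair; last first.
    by rewrite -[LHS]/(k * (x * u.2 + v.2)) -[RHS]/(x * (k * u.2) + k * v.2) mulrDr mulrCA.
  apply/rowP => j; rewrite !mxE.
  case: eqVneq => [_|j1]; first by rewrite /Defs.z1 /= !mxE mulrDr mulrCA.
  case: eqVneq => [_|j2].
    by rewrite -[(x *: u + v).2]/(x * u.2 + v.2) /Defs.z2 /= !mxE !mulrDr !(mulrCA _ x) addrACA.
  by rewrite linD // idx_gt1.
split=> //; apply: (linear_bijection_inverse linA).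
  move=> [z w] E; rewrite AE in E; case: E => /rowP E1 /eqP.
  rewrite mulf_eq0 (negbTE k0) /= => /eqP w0; rewrite w0; congr pair.
  have zz1 : z 0 i1 = 0.
    have := E1 i1; rewrite !mxE eqxx /Defs.z1 /= => /eqP.
    by rewrite mulf_eq0 (negbTE a0) /= => /eqP.
  have zz2 : z 0 i2 = 0.
    have := E1 i2; rewrite !mxE i21 eqxx /Defs.z2 /= w0 mulr0 addr0 => /eqP.
    by rewrite mulf_eq0 (negbTE b0) /= => /eqP.
  apply: ker => // j j1; have := E1 j; rewrite !mxE w0.
  have -> : (j == i1) = false by case: eqVneq j1 => // ->.
  by have -> : (j == i2) = false by case: eqVneq j1 => // ->.
move=> [u w].
pose y : C := w / k.
pose Z (z : 'rV[C]_n) : 'rV[C]_n :=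
  \row_j (if j == i1 then z 0 j else if j == i2 then z 0 j else D j (z, 0)).
have linZ : linear Z.
  move=> x z z'; apply/rowP => j; rewrite !mxE.
  case: eqVneq => [//|j1]; case: eqVneq => [//|j2].
  rewrite -linD ?idx_gt1 //; congr (D j _); congr pair => /=.
  by rewrite addr0 -[x *: 0]/(x * 0) mulr0.
have injZ z : Z z = 0 -> z = 0.
  move=> /rowP E; apply: ker => [||j j1].
  - by have := E i1; rewrite !mxE eqxx.
  - by have := E i2; rewrite !mxE i21 eqxx.
  have := E j; rewrite !mxE.
  have -> : (j == i1) = false by case: eqVneq j1 => // ->.
  by have -> : (j == i2) = false by case: eqVneq j1 => // ->.
have [z Ez] := inj_linear_onto linZ injZ
  (\row_j (if j == i1 then u 0 j / a else if j == i2 then (u 0 j - c * y) / b else u 0 j - D j (0, y))).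
exists (z, y); rewrite AE; congr pair; last by rewrite /= /y mulrC divfK.
move/rowP: Ez => Ez.
apply/rowP => j; rewrite mxE; have := Ez j; rewrite !mxE.
case: eqVneq => [-> E|j1]; first by rewrite /Defs.z1 /= E mulrC divfK.
case: eqVneq => [-> E|j2 E]; first by rewrite /Defs.z2 /= E; field.
have -> : (z, y) = 1 *: (z, 0) + (0, y) :> V.
  by rewrite scale1r; congr pair; rewrite /= ?addr0 ?add0r.
rewrite linD ?idx_gt1 // scale1r E subrK //.
Qed.

Lemma assemble_z1 f1 F2 Fs G (p : V) : z1 (assemble hn f1 F2 Fs G p) = f1 (z1 p).
Proof. by rewrite {1}/Defs.z1 mxE eqxx. Qed.

Lemma assemble_z2 f1 F2 Fs G (p : V) : z2 (assemble hn f1 F2 Fs G p) = F2 p.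
Proof. by rewrite {1}/Defs.z2 mxE eqxx. Qed.

(** With [a = conj z_1] and [t], [t'] the two roots, [p] lies on the quadric iff
    [(a - t) (a - t') = 0], and its image does iff [(h a - h t) (h a - h t') = 0];
    these are equivalent as [h] is locally injective. An equivalence is needed
    because the image of the quadric must fill a neighbourhood in it. *)
Lemma quadric_equiv (f1 : C -> C) (Fs : 'I_n -> V -> C) (r : R) : 0 < r ->
  hol_ball (cbar f1) 0 r -> dz (cbar f1) 0 != 0 ->
  exists2 d : R, 0 < d & forall p : V, nm p < d ->
    (quadric hn p <-> quadric hn (assemble hn f1 (fun p => F2c (cbar f1) (z2w hn p)) Fs
       (fun p => Gc (cbar f1) (z2w hn p)) p)).
Proof.
move=> r0 hol_h dh0; set h := cbar f1 in hol_h dh0 *.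
have [s s0 Hs] := locally_expanding r0 hol_h dh0.
have c0 : 0 < nm (dz h 0) / 2 by rewrite divr_gt0 // nm_gt0.
have inj x y : nm x < s -> nm y < s -> h x = h y -> x = y.
  move=> xs ys E; have := Hs x y xs ys; rewrite E subrr nm0 => le0.
  apply/eqP; rewrite -subr_eq0 -nm_eq0; apply/eqP/le_anti; rewrite nm_ge0 andbT.
  by rewrite -(ler_pM2l c0) mulr0.
have s2 : 0 < s / 2 by lra.
exists (Num.min (s / 2) ((Num.min (s / 2) 1 / 4) ^+ 2)).
  by rewrite lt_min s2 exprn_gt0 // divr_gt0 // lt_min s2 ltr01.
move=> p; rewrite lt_min => /andP [ps /(quadric_root hn s2) [t Et ts]].
have z1s := z1_nm hn p; have z2s := z2_nm hn p.
pose t' := - t - z2 p.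
have t's : nm t' < s by have := nmB (- t) (z2 p); rewrite nmN /t'; lra.
pose a := (z1 p)^*; have as_ : nm a < s by rewrite nm_conj; lra.
have ha : (f1 (z1 p))^* = h a by rewrite /h /cbar /a conjCK.
have E1 : (z1 p)^* * z2 p + (z1 p)^* ^+ 2 - p.2 = (a - t) * (a - t').
  by rewrite -Et /t' -/a; ring.
have E2 : h a * F2c h (z2w hn p) + h a ^+ 2 - Gc h (z2w hn p) = (h a - h t) * (h a - h t').
  by rewrite /z2w (F2c_root _ Et) (Gc_root _ Et) -/t'; ring.
rewrite /quadric /= assemble_z1 assemble_z2 ha.
have -> : (p.2 = (z1 p)^* * z2 p + (z1 p)^* ^+ 2) <-> (a - t) * (a - t') = 0.
  by rewrite -E1; split=> [<-|/eqP]; rewrite ?subrr // subr_eq0 => /eqP.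
have -> : (Gc h (z2w hn p) = h a * F2c h (z2w hn p) + h a ^+ 2) <->
    (h a - h t) * (h a - h t') = 0.
  by rewrite -E2; split=> [<-|/eqP]; rewrite ?subrr // subr_eq0 => /eqP.
split=> /eqP; rewrite mulf_eq0 !subr_eq0 => /orP [] /eqP.
- by move=> ->; rewrite subrr mul0r.
- by move=> ->; rewrite subrr mulr0.
- by move=> /inj ->; rewrite ?subrr ?mul0r //; lra.
- by move=> /inj ->; rewrite ?subrr ?mulr0 //; lra.
Qed.

End LocalInvertibility.

(** * Completing a given first component to an automorphism *)

Section ExistenceOfCompletion.
Variables (R : realType) (n : nat) (hn : (1 < n)%N).
Local Notation C := (Cplx R).
Local Notation V := ('rV[C]_n * C)%type.
Local Notation z1 := (z1 (R := R) hn).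
Local Notation z2 := (z2 (R := R) hn).
Local Notation i1 := (idx1 hn).
Local Notation i2 := (idx2 hn).

Lemma z2w_diff (k : C * C -> C) : differentiable k 0 ->
  forall v, 'd (fun p => k (z2w hn p)) 0 v = 'd k 0 (1, 0) * z2 v + 'd k 0 (0, 1) * v.2.
Proof.
move=> dk v; have [_ ->] := diff_comp_lin (@z2w_lin R n hn) ltr01 (@z2w_nm R n hn) dk.
have -> : z2w hn v = z2 v *: (1, 0) + v.2 *: (0, 1).
  by rewrite /z2w; congr pair; rewrite /= !scaleCE ?mulr1 ?mulr0 ?addr0 ?add0r.
by rewrite linearD !linearZ /= !scaleCE; congr (_ + _); exact: mulrC.
Qed.

Lemma local_automorphism_of (M U W : set V) (F : V -> V) : F 0 = 0 -> U 0 ->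
  biholomorphic F U W -> (forall p, U p -> (M p <-> M (F p))) -> local_automorphism M F.
Proof.
move=> F0 U0 bih H; split=> //; exists U, W; split=> //.
have [_ [g [_ H1 H2]]] := bih.
apply/seteqP; split=> [y [x [Mx Ux] <-]|y [My Wy]].
  by split; [exact: (H x Ux).1|case: (H1 x Ux)].
have [Ux Ey] := H2 y Wy; exists (g y) => //; split=> //.
by apply: (H _ Ux).2; rewrite Ey.
Qed.

(** The derivative at the origin of the map assembled from [F_1], the root formulas
    and [F_3, ..., F_n] is triangular with nonzero diagonal entries, up to the
    block that the rank hypothesis controls. *)
Lemma completion_exists (f1 : C -> C) (Fs : 'I_n -> V -> C) : invertible_germ f1 ->
  (forall j : 'I_n, (1 < j)%N -> holomorphic_near (Fs j) 0 /\ Fs j 0 = 0) ->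
  rank_at_origin Fs = n ->
  exists F2 G : V -> C, [/\ holomorphic_near F2 0, holomorphic_near G 0 &
    local_automorphism (quadric hn) (assemble hn f1 F2 Fs G)].
Proof.
move=> /invertible_germ_dz [f10 /holomorphic_nearP [r r0 df1] d1] HFs rk.
pose h := cbar f1.
have hol_h : hol_ball h 0 r by exact: hol_cbar.
have h0 : h 0 = 0 by rewrite /h /cbar conjC0 f10 conjC0.
have dh0 : dz h 0 != 0.
  have [|_ E] := @cbar_diff R f1 0; first by apply: df1; rewrite subr0 conjC0 nm0.
  by rewrite /h E conjC_eq0 conjC0.
have [d d0 HFG] := F2c_Gc_diff r0 hol_h.
have [q q0 Hq] := quadric_equiv hn Fs r0 hol_h dh0.
have /choice [rho Hrho] : forall j : 'I_n, exists rho : R, 0 < rho /\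
    ((1 < j)%N -> Fs j 0 = 0 /\ forall p, nm p < rho -> differentiable (Fs j) p).
  move=> j; have [/HFs [/holomorphic_nearP [s s0 Hs] Fs0]|_] := boolP (1 < j)%N; last by exists 1.
  by exists s; split=> // _; split=> // p ps; apply: Hs; rewrite subr0.
have [m m0 Hm] := min_radius (fun j => proj1 (Hrho j)).
pose s := Num.min (Num.min r d) m.
have [s0 sr sd sm] : [/\ 0 < s, s <= r, s <= d & s <= m].
  by split; rewrite /s ?lt_min ?r0 ?d0 ?m0 // !ge_min lexx ?orbT.
clearbody s.
pose F2 (p : V) := F2c h (z2w hn p); pose G (p : V) := Gc h (z2w hn p).
pose F := assemble hn f1 F2 Fs G.
have dtail (p : V) : differentiable (z2w hn) p.
  by apply: (@linear_bounded_diff R V (C * C)%type (z2w hn) 1 p); [exact: z2w_lin|exact: z2w_nm].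
have tails p : nm p < s -> nm (z2w hn p) < d.
  by have := z2w_nm hn p; rewrite mul1r; lra.
have dF2 p : nm p < s -> differentiable F2 p.
  by move=> /tails /HFG [D _]; exact: fdiff_comp (dtail p) D.
have dG p : nm p < s -> differentiable G p.
  by move=> /tails /HFG [_ D]; exact: fdiff_comp (dtail p) D.
have z1b p : nm (z1 p) <= 1 * nm p by rewrite mul1r; exact: z1_nm.
have df1z p : nm p < s -> differentiable (fun p => f1 (z1 p)) p.
  move=> ps; have dz1 : differentiable z1 p.
    by apply: (@linear_bounded_diff R V C z1 1 p); [exact: (z1_lin hn)|exact: z1b].
  apply: (fdiff_comp dz1).
  by apply: df1; rewrite subr0; have := z1_nm hn p; lra.
have dFs (j : 'I_n) p : (1 < j)%N -> nm p < s -> differentiable (Fs j) p.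
  move=> j1 ps; have [_ /(_ j1) [_ D]] := Hrho j; apply: D.
  by have := Hm j; lra.
have comp j : (fun p => (F p).1 0 j) =
    if j == i1 then fun p => f1 (z1 p) else if j == i2 then F2 else Fs j.
  by apply: funext => p; rewrite mxE; case: eqP => // _; case: eqP.
have D1 j p : nm p < s -> differentiable (fun p => (F p).1 0 j) p.
  move=> ps; rewrite comp; case: eqVneq => [_|j1]; first exact: df1z.
  by case: eqVneq => [_|j2]; [exact: dF2|apply: dFs => //; exact: (idx_gt1 j1 j2)].
have [dF] := holomorphic_strict s0 D1 dG.
set A := fun v : V => (_, _) => sF.
have n0 : nm (0 : V) < s by rewrite nm0.
have n0C : nm (0 : C * C) < d by rewrite nm0.
have [dF20 dG0] := HFG 0 n0C.
have df10 : differentiable f1 0 by apply: df1; rewrite subr0 nm0.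
have AE v : A v = (\row_j (if j == i1 then dz f1 0 * z1 v else
    if j == i2 then 'd (F2c h) 0 (1, 0) * z2 v + 'd (F2c h) 0 (0, 1) * v.2 else 'd (Fs j) 0 v),
    'd (Gc h) 0 (0, 1) * v.2).
  rewrite /A; congr pair; last first.
    rewrite [LHS](z2w_diff dG0) (Gc_dz2 r0 hol_h h0) mul0r add0r.
    by [].
  apply/rowP => j; rewrite !mxE comp.
  case: eqVneq => [_|_].
    have [_ ->] := diff_comp_lin (z1_lin hn) ltr01 z1b df10.
    by rewrite dz_lin.
  by case: eqVneq => [_|_]; [rewrite (z2w_diff dF20)|].
have [_ dZ] := z1z2Fs_diff (fun j j1 => dFs j 0 j1 n0).
have linD (j : 'I_n) : (1 < j)%N -> linear ('d (Fs j) 0 : V -> C^o).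
  by move=> _ x u v; rewrite linearP.
have ker (z : 'rV[C]_n) : z 0 i1 = 0 -> z 0 i2 = 0 ->
    (forall j : 'I_n, (1 < j)%N -> 'd (Fs j) 0 (z, 0) = 0) -> z = 0.
  move=> zz1 zz2 zj; have /rank_at_originP inj := rk; apply: inj.
  apply/rowP => j; rewrite dZ mxE; case: ltnP => j2; last exact: zj.
  case: j j2 => -[|[|//]] jn _.
    by rewrite -[RHS]zz1; congr (z 0 _); apply: val_inj.
  by rewrite -[RHS]zz2; congr (z 0 _); apply: val_inj.
have [linA [B [K [linB K0 HK BA AB]]]] := @triangular_inverse R n hn _ _ _ _
  (fun j => 'd (Fs j) 0) A d1 (F2c_dz2 r0 hol_h h0 dh0) (Gc_dw r0 hol_h h0 dh0) linD ker AE.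
have cV : nested_complete V.
  by apply: nested_complete_pair; [exact: nested_complete_rV|exact: nested_complete_C].
have t0 : z2w hn (0 : V) = 0 by rewrite /z2w /Defs.z2 /= mxE.
have [F2c0 Gc0] := F2c_Gc0 h0.
have F0 : F 0 = 0.
  rewrite /F /assemble /G t0 Gc0; congr pair; apply/rowP => j; rewrite !mxE.
  case: eqVneq => [_|j1]; first by rewrite /Defs.z1 mxE f10.
  case: eqVneq => [_|j2]; first by rewrite /F2 t0 F2c0.
  by have [_ /(_ (idx_gt1 j1 j2)) []] := Hrho j.
have [U [W [U0 Uq bih]]] := inverse_function cV s0 F0 dF sF linA linB K0 HK BA AB q0.
exists F2, G; split.
- by apply/holomorphic_nearP; exists s => [|p ps]; [exact: s0|apply: dF2; rewrite -[p]subr0].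
- by apply/holomorphic_nearP; exists s => [|p ps]; [exact: s0|apply: dG; rewrite -[p]subr0].
exact: (local_automorphism_of F0 U0 bih (fun p Up => Hq p (Uq p Up))).
Qed.

(** Uniqueness is the statement that the first component determines the others. *)
Lemma completion (f1 : C -> C) (Fs : 'I_n -> V -> C) : invertible_germ f1 ->
  (forall j : 'I_n, (1 < j)%N -> holomorphic_near (Fs j) 0 /\ Fs j 0 = 0) ->
  rank_at_origin Fs = n ->
    exists F2 G : V -> C,
      [/\ holomorphic_near F2 0, holomorphic_near G 0,
          local_automorphism (quadric hn) (assemble hn f1 F2 Fs G) &
          forall F2' G' : V -> C, holomorphic_near F2' 0 -> holomorphic_near G' 0 ->
            local_automorphism (quadric hn) (assemble hn f1 F2' Fs G') ->
            \forall p \near (0 : V), F2' p = F2 p /\ G' p = G p].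
Proof.
move=> H1 H2 H3; have [F2 [G [h2 hG aF]]] := completion_exists H1 H2 H3.
exists F2, G; split=> // F2' G' _ _ aF'.
have /nbhs_nm [d d0 Hd] : \forall p \near (0 : V),
    z2 (assemble hn f1 F2' Fs G' p) = z2 (assemble hn f1 F2 Fs G p) /\ G' p = G p.
  apply: (autom_determined aF' aF); apply/nbhs_nm; exists 1 => // p _.
  by rewrite !assemble_z1.
by apply/nbhs_nm; exists d => // p /Hd; rewrite !assemble_z2.
Qed.

End ExistenceOfCompletion.

Theorem theorem12p4 (R : realType) (n : nat) (hn : (1 < n)%N) :
  (* structure of a local automorphism F = (F_1, ..., F_n, G) *)
  (forall F : 'rV[Cplx R]_n * Cplx R -> 'rV[Cplx R]_n * Cplx R,
    local_automorphism (quadric hn) F ->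
    (exists (f1 : Cplx R -> Cplx R) (f2 g : Cplx R * Cplx R -> Cplx R),
      [/\ holomorphic_near f1 0,
          holomorphic_near f2 0,
          holomorphic_near g 0,
          (\forall p \near (0 : 'rV[Cplx R]_n * Cplx R),
            [/\ z1 hn (F p) = f1 (z1 hn p),
                z2 hn (F p) = f2 (z2 hn p, p.2) &
                (F p).2 = g (z2 hn p, p.2)]) &
          (* a stands for the conjugate of z_1 and b for z_2 *)
          (\forall a \near (0 : Cplx R) & b \near (0 : Cplx R),
            f2 (b, a * b + a ^+ 2) = - (cbar f1 a + cbar f1 (- a - b)) /\
            g (b, a * b + a ^+ 2) = - (cbar f1 a * cbar f1 (- a - b)))]) /\
    rank_at_origin (fun j p => (F p).1 0 j) = n) /\
  (* F_1 determines F_2 and G *)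
  (forall F F' : 'rV[Cplx R]_n * Cplx R -> 'rV[Cplx R]_n * Cplx R,
    local_automorphism (quadric hn) F ->
    local_automorphism (quadric hn) F' ->
    (\forall p \near (0 : 'rV[Cplx R]_n * Cplx R),
      z1 hn (F p) = z1 hn (F' p)) ->
    \forall p \near (0 : 'rV[Cplx R]_n * Cplx R),
      z2 hn (F p) = z2 hn (F' p) /\ (F p).2 = (F' p).2) /\
  (* existence and uniqueness of F_2 and G *)
  (forall (f1 : Cplx R -> Cplx R)
      (Fs : 'I_n -> 'rV[Cplx R]_n * Cplx R -> Cplx R),
    invertible_germ f1 ->
    (forall j : 'I_n, (1 < j)%N -> holomorphic_near (Fs j) 0 /\ Fs j 0 = 0) ->
    rank_at_origin Fs = n ->
    exists F2 G : 'rV[Cplx R]_n * Cplx R -> Cplx R,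
      [/\ holomorphic_near F2 0,
          holomorphic_near G 0,
          local_automorphism (quadric hn) (assemble hn f1 F2 Fs G) &
          forall F2' G' : 'rV[Cplx R]_n * Cplx R -> Cplx R,
            holomorphic_near F2' 0 ->
            holomorphic_near G' 0 ->
            local_automorphism (quadric hn) (assemble hn f1 F2' Fs G') ->
            \forall p \near (0 : 'rV[Cplx R]_n * Cplx R),
              F2' p = F2 p /\ G' p = G p]).
Proof.
split; [|split].
- by move=> F aF; split; [exact: autom_shape|exact: autom_rank].
- by move=> F F'; exact: autom_determined.
- by move=> f1 Fs; exact: completion.
Qed.
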